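(* Let $d\ge 1$, let $f\in L^1(\mathbb{R}^d)$, and let $\Lambda$ be a discrete multi-set in $\mathbb{R}^d$ such that $$\delta_\Lambda=\sum_{j=1}^n \delta_{L_j+z_j},$$ where $n\ge 1$, $L_1,\dots,L_n\subset\mathbb{R}^d$ are (possibly different) lattices and $z_1,\dots,z_n\in\mathbb{R}^d$. If $f+\Lambda$ tiles with a weight, then for each $j\in\{1,\dots,n\}$ there exists a lattice $\widetilde{L_j}\subset\mathbb{R}^d$ containing $L_j$ such that $f+\widetilde{L_j}$ also tiles with a (possibly different) weight.
   Context: A lattice of $\mathbb{R}^d$ is a discrete subgroup of the additive group $\mathbb{R}^d$ that is isomorphic to $\mathbb{Z}^d$ (so it has full rank). A discrete multi-set $\Lambda$ in $\mathbb{R}^d$ is a discrete set each of whose points has a finite multiplicity in $\{1,2,\dots\}$. Write $\delta_\Lambda=\sum_{\lambda\in\Lambda}\delta_\lambda$ (counted with multiplicity), where $\delta_\lambda$ is the Dirac measure at $\lambda$. The condition $\delta_\Lambda=\sum_j \delta_{L_j+z_j}$ says that $\Lambda$ is the union, counted with multiplicity, of the translated lattices $L_j+z_j$. For $f\in L^1(\mathbb{R}^d)$, we say $f+\Lambda$ tiles with a weight $w\in\mathbb{R}$ if $f*\delta_\Lambda(x)=\sum_{\lambda\in\Lambda}f(x-\lambda)=w$ for almost every $x\in\mathbb{R}^d$; ''tiles with a weight'' means this holds for some $w\in\mathbb{R}$. *)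

(* Defs.v *)
From HB Require Import structures.
From mathcomp Require Import all_boot all_order all_algebra finmap.
From mathcomp Require Import all_classical all_reals all_analysis.
From mathcomp Require Import complex.
From mathcomp Require summability.

Set Implicit Arguments.
Unset Strict Implicit.
Unset Printing Implicit Defensive.

Import Order.TTheory GRing.Theory Num.Theory.
Import numFieldNormedType.Exports.

Local Open Scope classical_set_scope.
Local Open Scope ring_scope.

Definition rV_display : measure_display.
Proof. by []. Qed.

(* The Borel sets of R^d, as the sigma-algebra generated by the coordinates. *)
Section borel_rV.
Context (R : realType) (d : nat).

Let coord (i : 'I_d) (x : 'rV[R]_d) : measurableTypeR R := x ord0 i.

Let rV_set0 : g_sigma_preimage coord set0.
Proof. exact: sigma_algebra0. Qed.

Let rV_setC A : g_sigma_preimage coord A -> g_sigma_preimage coord (~` A).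
Proof. exact: sigma_algebraC. Qed.

Let rV_bigcup (F : _^nat) : (forall i, g_sigma_preimage coord (F i)) ->
  g_sigma_preimage coord (\bigcup_i (F i)).
Proof. exact: sigma_algebra_bigcup. Qed.

HB.instance Definition _ := @isMeasurable.Build rV_display
  'rV[R]_d (g_sigma_preimage coord) rV_set0 rV_setC rV_bigcup.

End borel_rV.

Lemma measurable_coord (R : realType) d (i : 'I_d) :
  measurable_fun [set: 'rV[R]_d] (fun x => x ord0 i : measurableTypeR R).
Proof.
move=> _ Y mY; rewrite setTI; apply: sub_sigma_algebra => /=.
rewrite -bigcup_seq/=; exists i => /=; first by rewrite mem_index_enum.
by exists Y => //; rewrite setTI.
Qed.

Lemma measurable_fun_rV d0 (T : measurableType d0) (R : realType) d
    (f : T -> 'rV[R]_d) :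
  (forall i, measurable_fun setT (fun t => f t ord0 i : measurableTypeR R)) ->
  measurable_fun setT f.
Proof.
move=> mf _ A mA; rewrite setTI.
suff: measurable `<=` [set B | measurable (f @^-1` B)] by exact.
apply: smallest_sub; first split => /=.
- by rewrite preimage_set0.
- by move=> B mB; rewrite setTD preimage_setC; exact: measurableC.
- by move=> F mF; rewrite preimage_bigcup; exact: bigcup_measurable.
move=> B; rewrite -bigcup_seq => -[i /= _ [Y mY <-]].
by rewrite setTI; have := mf i measurableT Y mY; rewrite setTI.
Qed.

Section lebesgue_rV.
Context (R : realType).

Definition cons_rV d (p : measurableTypeR R * 'rV[R]_d) : 'rV[R]_d.+1 :=
  row_mx (p.1%:M : 'rV_1) p.2.

(* Lebesgue measure on the Borel sets of R^d. *)
Fixpoint lebesgue_rV d : set 'rV[R]_d -> \bar R :=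
  match d with
  | 0 => dirac (0 : 'rV[R]_0)
  | d'.+1 => pushforward (@lebesgue_measure R \x @lebesgue_rV d')%E
                         (@cons_rV d')
  end.

Lemma cons_rV0 d p : @cons_rV d p ord0 ord0 = p.1.
Proof.
rewrite /cons_rV (_ : ord0 = lshift d (ord0 : 'I_1)); last exact: val_inj.
by rewrite [LHS](@row_mxEl _ 1 1 d) mxE eqxx.
Qed.

Lemma cons_rVS d p (j : 'I_d) : @cons_rV d p ord0 (rshift 1 j) = p.2 ord0 j.
Proof. exact: row_mxEr. Qed.

Lemma measurable_cons_rV d : measurable_fun setT (@cons_rV d).
Proof.
apply: measurable_fun_rV => i.
case: (@split_ordP 1 d i) => j ->.
  rewrite (_ : lshift d j = ord0); last by rewrite ord1; exact: val_inj.
  rewrite (_ : (fun _ => _) = fst); first exact: measurable_fst.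
  by apply/funext => p; exact: cons_rV0.
rewrite (_ : (fun _ => _) =
  (fun x : 'rV[R]_d => x ord0 j : measurableTypeR R) \o snd); last first.
  by apply/funext => p; exact: cons_rVS.
exact: measurableT_comp (@measurable_coord _ _ _) _.
Qed.

Definition uncons_rV d (v : 'rV[R]_d.+1) : measurableTypeR R * 'rV[R]_d :=
  (v ord0 ord0, rsubmx (v : 'rV_(1 + d))).

Lemma cons_rVK d : cancel (@cons_rV d) (@uncons_rV d).
Proof.
move=> [x v]; congr pair; first exact: (cons_rV0 (x, v)).
by apply/rowP => j; rewrite mxE; exact: (cons_rVS (x, v)).
Qed.

Lemma measurable_uncons_rV d : measurable_fun setT (@uncons_rV d).
Proof.
apply/measurable_fun_pairP; split; first exact: measurable_coord.
apply: measurable_fun_rV => i.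
rewrite (_ : (fun _ => _) =
  (fun x : 'rV[R]_d.+1 => x ord0 (rshift 1 i) : measurableTypeR R)).
  exact: measurable_coord.
by apply/funext => x /=; rewrite mxE.
Qed.

Lemma pushforward_cons_sigma_finite d
    (mu : {sigma_finite_measure set 'rV[R]_d -> \bar R}) :
  sigma_finite setT
    (pushforward (@lebesgue_measure R \x mu)%E (@cons_rV d)).
Proof.
have /sigma_finiteP[F [FT ndF Foo]] := sigma_finiteT (@lebesgue_measure R).
have /sigma_finiteP[G [GT ndG Goo]] := sigma_finiteT mu.
exists (fun n => @uncons_rV d @^-1` (F n `*` G n)).
  rewrite -preimage_bigcup -[LHS](@preimage_setT _ _ (@uncons_rV d)).
  congr (_ @^-1` _); rewrite -setXTT FT GT predeqE => -[x y]; split.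
    move=> [/= [n _ Fnx] [k _ Gky]]; exists (maxn n k) => //; split.
    - by move: x Fnx; exact/subsetPset/ndF/leq_maxl.
    - by move: y Gky; exact/subsetPset/ndG/leq_maxr.
  by move=> [n _ [/= ? ?]]; split; exists n.
move=> n; have [? ?] := Foo n; have [? ?] := Goo n; split.
  rewrite -[X in measurable X]setTI; apply: measurable_uncons_rV => //.
  exact: measurableX.
rewrite /pushforward -comp_preimage.
rewrite (_ : _ \o _ = id) ?preimage_id; last first.
  by apply/funext => q /=; rewrite cons_rVK.
by rewrite product_measure1E// lte_mul_pinfty// ge0_fin_numE.
Qed.

Lemma lebesgue_rV_sigma_finite_measure d :
  {mu : {sigma_finite_measure set 'rV[R]_d -> \bar R} |
    mu = @lebesgue_rV d :> (set _ -> _)}.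
Proof.
elim: d => [|d [mu muE]].
  by exists (dirac (0 : 'rV[R]_0)).
have mc := @measurable_cons_rV d.
pose m : {measure set (measurableTypeR R * 'rV[R]_d)%type -> \bar R} :=
  (@lebesgue_measure R \x mu)%E.
pose nu : {measure set 'rV[R]_d.+1 -> \bar R} :=
  measure_function_pushforward__canonical__measure_function_Measure m mc.
pose sf := @Measure_isSigmaFinite.Build _ _ _ nu
  (pushforward_cons_sigma_finite mu).
pose nu' : {sigma_finite_measure set 'rV[R]_d.+1 -> \bar R} :=
  HB.pack (nu : set _ -> _) (Measure.class nu) sf.
by exists nu'; rewrite /= -muE.
Qed.

Section lebesgue_rV_measure.
Local Open Scope ereal_scope.
Context (d : nat).

Let lebesgue_rV0 : @lebesgue_rV d set0 = 0.
Proof. by have [mu <-] := lebesgue_rV_sigma_finite_measure d. Qed.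

Let lebesgue_rV_ge0 A : 0 <= @lebesgue_rV d A.
Proof. by have [mu <-] := lebesgue_rV_sigma_finite_measure d. Qed.

Let lebesgue_rV_sigma_additive : semi_sigma_additive (@lebesgue_rV d).
Proof.
have [mu <-] := lebesgue_rV_sigma_finite_measure d.
exact: measure_semi_sigma_additive.
Qed.

HB.instance Definition _ := isMeasure.Build _ _ _ (@lebesgue_rV d)
  lebesgue_rV0 lebesgue_rV_ge0 lebesgue_rV_sigma_additive.

Let lebesgue_rV_sigma_finite : sigma_finite setT (@lebesgue_rV d).
Proof.
have [mu <-] := lebesgue_rV_sigma_finite_measure d.
exact: sigma_finiteT.
Qed.

HB.instance Definition _ := Measure_isSigmaFinite.Build _ _ _ (@lebesgue_rV d)
  lebesgue_rV_sigma_finite.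

(* Lebesgue measure on the Lebesgue-measurable sets of R^d. *)
Definition completed_lebesgue_rV :=
  @completed_measure_extension _ _ _ (@lebesgue_rV d).

HB.instance Definition _ := Measure.on completed_lebesgue_rV.

HB.instance Definition _ := @Measure_isSigmaFinite.Build _ _ _
  completed_lebesgue_rV
  (completed_measure_extension_sigma_finite lebesgue_rV_sigma_finite).

End lebesgue_rV_measure.

End lebesgue_rV.

Arguments lebesgue_rV R d : clear implicits.
Arguments completed_lebesgue_rV R d : clear implicits.

Section multi_lattice_tiling.
Context (R : realType) (d : nat).
Implicit Types (L : set 'rV[R]_d) (Lam : 'rV[R]_d -> nat).
Implicit Types (f : 'rV[R]_d -> R[i]).

Definition discrete_set (A : set 'rV[R]_d) := A `<=` isolated A.

Record lattice L : Prop := Lattice {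
  lattice_subgroup : L 0 /\ (forall x y, L x -> L y -> L (x - y)) ;
  lattice_discrete : discrete_set L ;
  lattice_iso : exists phi : {additive 'rV[int]_d -> 'rV[R]_d},
    injective phi /\ range phi = L }.

(* A multi-set is given by its multiplicity function; points outside the
   underlying set have multiplicity 0. *)
Definition mset_support Lam : set 'rV[R]_d := [set x | (0 < Lam x)%N].

Definition discrete_mset Lam := discrete_set (mset_support Lam).

Definition mset_of_set (A : set 'rV[R]_d) : 'rV[R]_d -> nat :=
  fun x => (x \in A).

Definition translate (A : set 'rV[R]_d) (z : 'rV[R]_d) : set 'rV[R]_d :=
  [set x + z | x in A].

Definition delta_mset Lam (A : set 'rV[R]_d) : \bar R :=
  (\esum_(x in mset_support Lam) ((Lam x)%:R%:E * dirac x A))%E.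

Definition L1 f :=
  (completed_lebesgue_rV R d).-integrable setT (fun x => (complex.Re (f x))%:E)
  /\
  (completed_lebesgue_rV R d).-integrable setT (fun x => (complex.Im (f x))%:E).

(* The sum over the multi-set is unconditional: the limit of the partial sums
   along the finite sets of points ordered by inclusion. *)
Definition tiles_with_weight f Lam (w : R) :=
  {ae completed_lebesgue_rV R d, forall x : 'rV[R]_d,
    summability.partial_sum (fun y => f (x - y) *+ Lam y : R[i]^o)
      @ summability.totally --> (w%:C%C : R[i]^o)}.

Definition tiles f Lam := exists w : R, tiles_with_weight f Lam w.

End multi_lattice_tiling.

(* Main.v *)
(* Splitting f into real and imaginary parts, let f be real. Tiling with weight w
   says that the Fourier transform of f, multiplied by the exponential sum
     E(xi) = sum over the k with xi in L_k^* of dens(L_k) exp(2 i pi <z_k, xi>),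
   vanishes at each xi <> 0; this is tested against functions whose
   periodizations over all the L_k are explicit. For a suitable N >= 1, E has no
   zero on N L_j^*: the phases on a basis of L_j^* and the densities generate a
   ring that can be specialized to the algebraic closure of a finite field,
   keeping the (positive) sums of densities nonzero; there the phases become
   roots of unity, and N kills them. So the Fourier transform of f vanishes on
   N L_j^* minus 0, the dual of the lattice N^-1 L_j, and the periodization of f
   over N^-1 L_j, having only a zeroth Fourier coefficient, is constant. *)

Require Import Defs.
From mathcomp Require Import all_boot all_order all_algebra all_field finmap.
From mathcomp Require Import all_classical all_reals all_analysis.
From mathcomp Require Import measurable_realfun complex ring lra.
From mathcomp Require summability.

Set Implicit Arguments.
Unset Strict Implicit.
Unset Printing Implicit Defensive.

Import Order.TTheory GRing.Theory Num.Theory.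
Import numFieldNormedType.Exports.

#[local] Existing Instance summability.totally_filter.

Local Open Scope ring_scope.

(** * Exponential sums with nonvanishing partial coefficient sums *)

(** One [N] must serve infinitely many frequencies and every set of indices [k] that a frequency
    selects. A single homomorphism of the ring generated by the phases, the densities and the needed
    inverses achieves this: after it, the exponential sum at a frequency of [N L_j^*] depends on the
    selected set alone. That set contains [j], since [N L_j^*] lies in [L_j^*], so its sum of
    densities is positive and, its inverse being in the ring, stays nonzero.

    On the analytic side [f] is only integrable, and a wave whose frequency lies in some dual
    lattices but not in others has no usable sum over the latter lattices. The test functions start
    from a weight whose sums over all the lattices are constant, multiplied by a wave of frequency
    [xi]; then differences are taken along a vector of each lattice whose dual misses [xi]. A
    difference along a lattice vector has zero sums over that lattice, while the wave only acquires
    a nonzero sine as a factor and a phase. One more difference makes the integral of the test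
    function zero, which removes the weight [w]. *)

Definition torsion_units (F : fieldType) :=
  forall x : F, x != 0 -> exists2 n, (0 < n)%N & x ^+ n = 1.

(** Modulo a monic polynomial with root [x] the powers of ['X] have finitely many remainders, so two
    powers of [x] coincide. *)
Lemma integral_finite_torsion_units (F0 : finFieldType) (F : fieldType)
    (iota : {rmorphism F0 -> F}) : integralRange iota -> torsion_units F.
Proof.
move=> intF x x0; have [p mon_p rpx] := intF x.
pose n := size p; pose r i := 'X^i %% p.
have size_r i : (size (r i) <= n)%N.
  by apply: ltnW; rewrite ltn_modp monic_neq0.
have rE i : (map_poly iota (r i)).[x] = x ^+ i.
  have -> : x ^+ i = (map_poly iota 'X^i).[x] by rewrite map_polyXn hornerXn.
  rewrite [in RHS](divp_eq 'X^i p) rmorphD rmorphM hornerD hornerM.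
  by rewrite (rootP rpx) mulr0 add0r.
pose g (i : 'I_#|{: 'rV[F0]_n}|.+1) := (poly_rV (r i) : 'rV_n).
have /injectivePn[i [j ij gij]] : ~~ injectiveb g.
  apply/injectiveP => /leq_card; rewrite card_ord.
  by rewrite ltnn.
have xij : x ^+ i = x ^+ j.
  by rewrite -!rE -(poly_rV_K (size_r i)) -(poly_rV_K (size_r j)) -/(g i) gij.
wlog ltij : i j ij gij xij / (i < j)%N => [wl|].
  have [ltij|ltji|/val_inj eqij] := ltngtP i j.
  - exact: wl xij ltij.
  - by apply: (wl j i) => //; rewrite eq_sym.
  - by rewrite eqij eqxx in ij.
exists (j - i)%N; first by rewrite subn_gt0.
apply: (mulIf (expf_neq0 i x0)).
by rewrite -exprD subnK ?(ltnW ltij)// mul1r.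
Qed.

(** * Specialization of finitely generated rings to positive characteristic *)

Section specialization.
Variable K : fieldType.

(* Homomorphisms on subrings of K are represented by a ring P evaluated in K:
   a homomorphism of the image of e is one of P vanishing on the kernel of e. *)
Definition specializable (P : comNzRingType) (e : {rmorphism P -> K}) :=
  forall b, e b != 0 ->
  exists (F : closedFieldType) (e' : {rmorphism P -> F}),
    [/\ torsion_units F, forall p, e p = 0 -> e' p = 0 & e' b != 0].

Definition adjoin (P : comNzRingType) (L : fieldType) (e : {rmorphism P -> L})
  (x : L) : {rmorphism {poly P} -> L} := horner_eval x \o map_poly e.

Lemma adjoinE (P : comNzRingType) (L : fieldType) (e : {rmorphism P -> L}) x p :
  adjoin e x p = (map_poly e p).[x].
Proof. by []. Qed.

(** A prime factor of a factorial plus one is larger than [|b|]; reduction modulo it, followed by an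
    algebraic closure, keeps [b] nonzero. *)
Lemma specializable_int (e : {rmorphism int -> K}) :
  [pchar K] =i pred0 -> specializable e.
Proof.
move=> char0 b; rewrite -[b]intz rmorph_int => b0.
have bneq0 : b != 0 by apply: contraNneq b0 => ->.
pose p := pdiv (`|b|.+1`!).+1.
have p_pr : prime p by apply: pdiv_prime; rewrite ltnS fact_gt0.
have ltp : (`|b| < p)%N.
  rewrite ltnNge; apply/negP => lepb.
  have pd : (p %| (`|b|.+1)`!)%N.
    by rewrite dvdn_fact// prime_gt0// (leq_trans lepb).
  have := pdiv_dvd (`|b|.+1`!).+1; rewrite -/p -addn1 dvdn_addr// dvdn1 => /eqP p1.
  by rewrite p1 in p_pr.
have [F [iota intF]] := countable_algebraic_closure 'F_p.
exists F, (intr : {rmorphism int -> F}); split.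
- exact: (@integral_finite_torsion_units 'F_p F iota).
- move=> c; rewrite -[c]intz rmorph_int => /eqP c0.
  suff /eqP -> : c == 0 by rewrite rmorph0.
  by have /pcharf0P chK := char0; move: c0; case: c => n;
    rewrite ?NegzE ?mulrNz ?oppr_eq0 -?pmulrn chK.
- rewrite intz; change (b%:~R != 0 :> F); rewrite -(rmorph_int iota).
  rewrite fmorph_eq0; have pch := pchar_Fp p_pr.
  have : ((`|b|%N)%:R : 'F_p) != 0.
    rewrite -(dvdn_pcharf pch); apply/negP => /dvdn_leq; rewrite absz_gt0 => /(_ bneq0).
    by rewrite leqNgt ltp.
  by case: (b) => n; rewrite ?NegzE ?mulrNz ?oppr_eq0.
Qed.

(** [e] need not be injective, so a leading coefficient may vanish in [K]. A representative of the
    right size has a leading coefficient with nonzero image, and pseudo-division by it in [P] is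
    then meaningful over [K]. *)
Lemma map_poly_truncation (P : comNzRingType) (e : {rmorphism P -> K}) p :
  exists2 q, map_poly e q = map_poly e p & size q = size (map_poly e p).
Proof.
pose n := size (map_poly e p).
have Eq : map_poly e (take_poly n p) = map_poly e p.
  apply/polyP => i; rewrite !coef_map/= coef_take_poly.
  case: ltnP => // ni; rewrite rmorph0.
  by have := nth_default 0 ni; rewrite coef_map.
exists (take_poly n p) => //; apply/eqP; rewrite eqn_leq size_poly/= -{1}Eq.
exact: size_poly.
Qed.

Lemma ex_minimal (A : Type) (S : A -> Prop) (sz : A -> nat) :
  (exists a, S a) -> exists2 a, S a & forall b, S b -> (sz a <= sz b)%N.
Proof.
move=> [a0 Sa0]; have ex : exists n, `[< exists2 a, S a & sz a = n >].
  by exists (sz a0); apply/asboolP; exists a0.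
case: (ex_minnP ex) => n /asboolP[a Sa <-] minn; exists a => // b Sb.
by apply: minn; apply/asboolP; exists b.
Qed.

Lemma map_poly_ker (P : comNzRingType) (F : fieldType)
    (e : {rmorphism P -> K}) (e' : {rmorphism P -> F}) :
  (forall p, e p = 0 -> e' p = 0) ->
  forall p q, map_poly e p = map_poly e q -> map_poly e' p = map_poly e' q.
Proof.
move=> ker p q pq; apply/polyP => i; rewrite !coef_map/=.
apply/eqP; rewrite -subr_eq0 -rmorphB; apply/eqP/ker; rewrite rmorphB.
by have /polyP/(_ i) := pq; rewrite !coef_map/= => ->; rewrite subrr.
Qed.

(** If [x] satisfies no relation over the image of [e], it can be sent anywhere: keep the leading
    coefficient of [b] nonzero, then send [x] to a non-root of the specialized [b], which exists in
    an algebraically closed field. *)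
Lemma specializable_adjoin_trans (P : comNzRingType) (e : {rmorphism P -> K})
    (x : K) : specializable e ->
  (forall p, adjoin e x p = 0 -> map_poly e p = 0) ->
  specializable (adjoin e x).
Proof.
move=> spe trans b b0.
have Eb : map_poly e b != 0.
  by apply: contraNneq b0 => Eb; rewrite adjoinE Eb horner0.
have bi : e b`_(size (map_poly e b)).-1 != 0.
  by move: Eb; rewrite -lead_coef_eq0 lead_coefE coef_map.
have [F [e' [tF ker e'bi]]] := spe _ bi.
have E'b : map_poly e' b != 0.
  apply: contraNneq e'bi => /polyP/(_ (size (map_poly e b)).-1).
  by rewrite coef_map coef0 => ->.
have /closed_nonrootP[y ry] := E'b.
exists F, (adjoin e' y); split => // p.
rewrite !adjoinE => /trans p0.
by rewrite (map_poly_ker ker (q := 0)) ?rmorph0 ?horner0// p0.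
Qed.

(** Here [x] must go to a root of a specialized minimal polynomial [g]. Since [b] does not vanish at
    [x], a Bezout relation makes a nonzero constant out of [b] and [g]; keeping this constant and
    the leading coefficient of [g] nonzero is enough. *)
Lemma specializable_adjoin_alg (P : comNzRingType) (e : {rmorphism P -> K})
    (x : K) : specializable e ->
  (exists p, adjoin e x p = 0 /\ map_poly e p != 0) ->
  specializable (adjoin e x).
Proof.
move=> spe alg b b0.
have [g1 [] + + ming1] := ex_minimal (fun p => size (map_poly e p)) alg.
have [g Egg1 szg] := map_poly_truncation e g1.
rewrite adjoinE -Egg1 => gx Eg0.
have ming p : (map_poly e p).[x] = 0 -> map_poly e p != 0 ->
    (size g <= size (map_poly e p))%N.
  by move=> px p0; rewrite szg; exact: ming1.
rewrite -Egg1 in szg; clear g1 Egg1 ming1.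
have g0 : g != 0 by apply: contraNneq Eg0 => ->; rewrite rmorph0.
have el : e (lead_coef g) != 0.
  by move: Eg0; rewrite -lead_coef_eq0 lead_coefE coef_map -szg.
have divE (p q : {poly P}) := congr1 (map_poly e) (Pdiv.ComRing.rdivp_eq q p).
(* The nonzero elements of the ideal generated by [b] and [g]; one of least degree will turn out to
   be constant. *)
pose S s := map_poly e s != 0 /\
  exists u v, map_poly e s = map_poly e (u * b + v * g).
have [s1 [Es10 [u [v Es1]]] mins1] :
    exists2 s, S s & forall s', S s' -> (size (map_poly e s) <= size (map_poly e s'))%N.
  apply: ex_minimal; exists b; split.
    by apply: contraNneq b0 => Eb; rewrite adjoinE Eb horner0.
  by exists 1, 0; rewrite mul1r mul0r addr0.
have [s Ess1 szs] := map_poly_truncation e s1.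
have mins s' : S s' -> (size s <= size (map_poly e s'))%N.
  by rewrite szs; exact: mins1.
rewrite -Ess1 in Es10 Es1 szs; clear s1 mins1 Ess1.
have s0 : s != 0 by apply: contraNneq Es10 => ->; rewrite rmorph0.
have els : e (lead_coef s) != 0.
  by move: Es10; rewrite -lead_coef_eq0 lead_coefE coef_map -szs.
(* The remainder of [b] by [g] lies in [S]: it is nonzero because [g] vanishes at [x] and [b] does
   not. *)
have ltsg : (size s < size g)%N.
  have := divE b g; set r := Pdiv.Ring.rmodp _ _; set k := Pdiv.Ring.rscalp _ _.
  set q := Pdiv.Ring.rdivp _ _ => dE.
  have Er0 : map_poly e r != 0.
    apply: contraNneq b0 => Er; move: dE.
    rewrite rmorphD/= Er addr0 rmorphM/= map_polyZ/= rmorphXn => /(congr1 (horner^~ x)).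
    rewrite hornerZ hornerM gx mulr0 => /eqP; rewrite mulf_eq0 expf_eq0.
    by rewrite (negbTE el) andbF orFb.
  apply: (@leq_ltn_trans (size (map_poly e r))).
    apply: mins; split => //; exists (lead_coef g ^+ k)%:P, (- q).
    rewrite mul_polyC mulNr rmorphB/= dE rmorphD/=.
    by rewrite addrC addKr.
  apply: (@leq_ltn_trans (size r)); first exact: size_poly.
  exact: Pdiv.Ring.ltn_rmodpN0.
(* Otherwise minimality makes [s] divide [g] up to a power of its leading coefficient, and one of
   the two factors, both shorter than [g], vanishes at [x]. *)
have szs1 : (size s <= 1)%N.
  rewrite leqNgt; apply/negP => s_gt1.
  have := divE g s; set r := Pdiv.Ring.rmodp _ _; set k := Pdiv.Ring.rscalp _ _.
  set q := Pdiv.Ring.rdivp _ _ => dE.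
  have Er0 : map_poly e r = 0.
    apply/eqP; apply/negPn/negP => Er0.
    have : (size r < size s)%N by exact: Pdiv.Ring.ltn_rmodpN0.
    rewrite ltnNge (leq_trans _ (size_poly _ _ : size (map_poly e r) <= _)%N)//.
    apply: mins; split => //.
    exists (- (q * u)), ((lead_coef s ^+ k)%:P - q * v).
    rewrite mulrBl mul_polyC [X in X + _]mulNr addrCA -!mulrA -opprD -mulrDr.
    by rewrite rmorphB [X in _ - X]rmorphM/= -Es1 -rmorphM/= dE rmorphD/= addrC addKr.
  move: dE; rewrite rmorphD/= Er0 addr0 rmorphM/= map_polyZ/= rmorphXn => dE.
  have Eq0 : map_poly e q != 0.
    apply: contraNneq Eg0 => Eq0; move: dE; rewrite Eq0 mul0r => /eqP.
    by rewrite scaler_eq0 expf_eq0 (negbTE els) andbF.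
  have := congr1 (horner^~ x) dE; rewrite hornerZ hornerM gx mulr0 => /esym/eqP.
  rewrite mulf_eq0 => /orP[] /eqP /ming.
    move=> /(_ Eq0); rewrite leqNgt => /negP; apply.
    have := congr1 (fun p : {poly K} => size p) dE.
    rewrite size_scale ?expf_neq0// size_mul// -szg -szs => ->.
    by case: (size s) s_gt1 => [|[|m]]// _; rewrite !addnS/= ltnS leq_addr.
  by move=> /(_ Es10); rewrite -szs leqNgt ltsg.
have sC : map_poly e s = map_poly e (s`_0)%:P by rewrite [in LHS](size1_polyC szs1).
have es0 : e s`_0 != 0.
  by apply: contraNneq Es10 => es0; rewrite sC map_polyC/= es0.
have : e (lead_coef g * s`_0) != 0 by rewrite rmorphM mulf_neq0.
move=> /spe[F [e' [tF ker]]]; rewrite rmorphM mulf_eq0 negb_or => /andP[e'l e's].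
have ker2 := map_poly_ker ker.
have /closed_rootP[y /rootP gy] : size (map_poly e' g) != 1%N.
  rewrite size_map_poly_id0// szg; apply: contraTneq isT => sz1.
  by have := root_size_gt1 Eg0 (introT rootP gx); rewrite sz1.
exists F, (adjoin e' y); split => // [p|].
  rewrite !adjoinE => px; have := divE p g.
  have := congr1 (map_poly e') (Pdiv.ComRing.rdivp_eq g p).
  set r := Pdiv.Ring.rmodp _ _; set k := Pdiv.Ring.rscalp _ _.
  set q := Pdiv.Ring.rdivp _ _ => dE' dE.
  have Er0 : map_poly e r = 0.
    apply/eqP; apply/negPn/negP => Er0.
    have : (size r < size g)%N by exact: Pdiv.Ring.ltn_rmodpN0.
    rewrite ltnNge (leq_trans _ (size_poly _ _ : size (map_poly e r) <= _)%N)//.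
    apply: ming => //; have := congr1 (horner^~ x) dE.
    by rewrite rmorphD rmorphM/= map_polyZ hornerD hornerZ hornerM gx px !mulr0 add0r.
  have E'r0 : map_poly e' r = 0 by rewrite (ker2 _ 0) ?rmorph0// Er0.
  have := congr1 (horner^~ y) dE'.
  rewrite rmorphD rmorphM/= map_polyZ hornerD hornerZ hornerM gy E'r0 horner0.
  rewrite mulr0 addr0 rmorphXn/= => /eqP.
  by rewrite mulf_eq0 expf_eq0 (negbTE e'l) andbF => /eqP.
rewrite adjoinE; apply: contraNneq e's => by0.
have : map_poly e' (s`_0)%:P = map_poly e' (u * b + v * g).
  by apply: ker2; rewrite -sC Es1.
move=> /(congr1 (horner^~ y)).
by rewrite map_polyC hornerC rmorphD !rmorphM hornerD !hornerM by0 gy !mulr0 addr0 => ->.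
Qed.

Lemma specializable_adjoin (P : comNzRingType) (e : {rmorphism P -> K}) (x : K) :
  specializable e -> specializable (adjoin e x).
Proof.
move=> spe.
have [alg|nalg] := pselect (exists p, adjoin e x p = 0 /\ map_poly e p != 0).
  exact: specializable_adjoin_alg.
apply: specializable_adjoin_trans => // p p0; apply: contrapT => /eqP Ep0.
by apply: nalg; exists p.
Qed.

Lemma specializable_seq (s : seq K) : [pchar K] =i pred0 ->
  exists (P : comNzRingType) (e : {rmorphism P -> K}),
    specializable e /\ forall x, x \in s -> exists p, e p = x.
Proof.
move=> ch0; elim: s => [|x s [P [e [spe sP]]]].
  exists int, (intr : {rmorphism int -> K}); split => //.
  exact: specializable_int.
exists {poly P}, (adjoin e x); split; first exact: specializable_adjoin.
move=> y; rewrite inE => /predU1P[->|/sP[p <-]].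
  by exists 'X; rewrite adjoinE map_polyX hornerX.
by exists p%:P; rewrite adjoinE map_polyC hornerC.
Qed.

End specialization.

(* A specialization to positive characteristic makes all u k i torsion, so that
   for a suitable N the exponential sum reduces to a sum of the c k alone. *)
Lemma exp_sum_neq0 (K : fieldType) (T : finType) d (c : T -> K)
    (u : T -> 'I_d -> K) : [pchar K] =i pred0 ->
  (forall k i, u k i != 0) ->
  (forall S : {set T}, S != finset.set0 -> \sum_(k in S) c k != 0) ->
  exists2 N, (0 < N)%N & forall (S : {set T}) (m : 'I_d -> int), S != finset.set0 ->
    \sum_(k in S) c k * \prod_i u k i ^ (N%:Z * m i) != 0.
Proof.
move=> ch0 u0 c0.
(* Adding the inverses turns the phases and all the subset sums of [c] into units, so that no
   specialization can kill them; it then suffices to keep 1 nonzero. *)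
pose s := [seq c k | k : T] ++ [seq u k.1 k.2 | k : T * 'I_d] ++
  [seq (u k.1 k.2)^-1 | k : T * 'I_d] ++
  [seq (\sum_(k in A) c k)^-1 | A : {set T}].
have [P [e [spe sP]]] := specializable_seq s ch0.
have /choice[C CE] : forall k, exists p, e p = c k.
  by move=> k; apply: sP; rewrite !mem_cat fintype.image_f.
have /choice[U UE] : forall k : T * 'I_d, exists p, e p = u k.1 k.2.
  by move=> k; apply: sP; rewrite !mem_cat (fintype.image_f (fun k : T * 'I_d => u k.1 k.2)) ?orbT.
have /choice[V VE] : forall k : T * 'I_d, exists p, e p = (u k.1 k.2)^-1.
  move=> k; apply: sP; rewrite !mem_cat.
  by rewrite (fintype.image_f (fun k : T * 'I_d => (u k.1 k.2)^-1)) ?orbT.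
have /choice[W WE] : forall S : {set T}, exists p, e p = (\sum_(k in S) c k)^-1.
  move=> S; apply: sP; rewrite !mem_cat.
  by rewrite (fintype.image_f (fun S : {set T} => (\sum_(k in S) c k)^-1)) ?orbT.
have [|F [e' [tF ker _]]] := spe 1; first by rewrite rmorph1 oner_eq0.
have ker1 p : e p = 1 -> e' p = 1.
  move=> p1; apply/eqP; rewrite -subr_eq0 -(rmorph1 e') -rmorphB.
  by apply/eqP/ker; rewrite rmorphB rmorph1 p1 subrr.
have UV k : e' (U k) * e' (V k) = 1.
  by rewrite -rmorphM ker1// rmorphM UE VE mulfV.
have U0 k : e' (U k) != 0.
  by apply/eqP => Uk0; have := oner_neq0 F; rewrite -(UV k) Uk0 mul0r eqxx.
have /choice[ord ordP] : forall k, exists n, (0 < n)%N /\ e' (U k) ^+ n = 1.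
  by move=> k; have [n n0 n1] := tF _ (U0 k); exists n.
exists (\prod_k ord k)%N; first by apply: prodn_gt0 => k; have [] := ordP k.
set N := (\prod_k ord k)%N => S m S0.
have U_N k : e' (U k) ^+ N = 1.
  by rewrite /N (bigD1 k)//= exprM (ordP k).2 expr1n.
have V_N k : e' (V k) ^+ N = 1.
  by rewrite -[LHS]mul1r -(U_N k) -exprMn UV expr1n.
(* A preimage in [P] of the power of the phase: [P] has no inverses, so negative exponents use the
   preimages [V] of the inverses. *)
pose X k i := match m i with
  Posz n => (U (k, i)) ^+ (N * n) | Negz n => V (k, i) ^+ (N * n.+1) end.
have XE k i : e (X k i) = u k i ^ (N%:Z * m i).
  rewrite /X; case: (m i) => n.
    by rewrite rmorphXn/= UE.
  by rewrite rmorphXn/= VE NegzE mulrN -PoszM -exprnN exprVn.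
have X1 k i : e' (X k i) = 1.
  by rewrite /X; case: (m i) => n; rewrite rmorphXn exprM ?U_N ?V_N expr1n.
apply/negP => /eqP sum0.
have : e (\sum_(k in S) C k * \prod_i X k i) = 0.
  rewrite -sum0 rmorph_sum; apply: eq_bigr => k _; rewrite rmorphM CE rmorph_prod.
  by congr (_ * _); apply: eq_bigr => i _.
move=> /ker; rewrite rmorph_sum/=.
under eq_bigr do rewrite rmorphM rmorph_prod big1 ?mulr1//.
rewrite -rmorph_sum => C0.
have : e' ((\sum_(k in S) C k) * W S) = 1.
  apply: ker1; rewrite rmorphM WE rmorph_sum/=.
  by under eq_bigr do rewrite CE; rewrite mulfV ?c0.
by rewrite rmorphM/= C0 mul0r => /eqP; rewrite eq_sym oner_eq0.
Qed.

Local Open Scope classical_set_scope.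
Local Open Scope ring_scope.

(** * Lebesgue measure on R^d *)

Section translation.
Variable R : realType.

Lemma measurable_addr_rV d (v : 'rV[R]_d) :
  measurable_fun [set: 'rV[R]_d] (fun x => x + v).
Proof.
apply: measurable_fun_rV => i.
under eq_fun do rewrite mxE.
by apply: measurable_funD => //; exact: measurable_coord.
Qed.

Lemma measurable_mulmx_rV d n (B : 'M[R]_(d, n)) :
  measurable_fun [set: 'rV[R]_d] (fun x : 'rV[R]_d => x *m B).
Proof.
apply: measurable_fun_rV => i.
under eq_fun do rewrite mxE.
apply: measurable_sum => j.
by apply: measurable_funM => //; exact: measurable_coord.
Qed.

Lemma measurable_addr_R (a : R) : measurable_fun [set: measurableTypeR R]
  (fun x : measurableTypeR R => x + a : measurableTypeR R).
Proof. exact: measurable_funD. Qed.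

Lemma lebesgue_measure_translate (a : R) (A : set (measurableTypeR R)) :
  measurable A -> lebesgue_measure ((fun x => x + a) @^-1` A) = lebesgue_measure A.
Proof.
move=> mA.
have mf := measurable_addr_R a.
pose m : {measure set (measurableTypeR R) -> \bar R} :=
  measure_function_pushforward__canonical__measure_function_Measure
    (@lebesgue_measure R) mf.
apply/esym; apply: (@lebesgue_measure_unique _ m) => // X [[x y] _ <-].
rewrite /m/= /pushforward.
have -> : (fun x0 : R => x0 + a) @^-1` `]x, y] = `]x - a, y - a]%classic.
  by apply/seteqP; split => t; rewrite /= !in_itv/= ltrBlDr lerBrDr.
by rewrite !lebesgue_measure_itv/= !lte_fin ltrD2r -!EFinB opprB addrA subrK.
Qed.

Lemma lebesgue_rV_translate d (v : 'rV[R]_d) (A : set 'rV[R]_d) :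
  measurable A -> lebesgue_rV R d ((fun x => x + v) @^-1` A) = lebesgue_rV R d A.
Proof.
elim: d v A => [|d IH] v A mA.
  by congr (_ _); apply/seteqP; split => x; rewrite /= (_ : x + v = x)//;
    apply/rowP; case.
rewrite /= /pushforward.
pose T (p : measurableTypeR R * 'rV[R]_d) : measurableTypeR R * 'rV[R]_d :=
  (p.1 + v ord0 ord0, p.2 + rsubmx (v : 'rV_(1 + d))).
have mT : measurable_fun setT T.
  apply/measurable_fun_pairP; split.
    by apply: measurable_funD => //; exact: measurable_fst.
  exact: measurableT_comp (measurable_addr_rV _) measurable_snd.
have -> : @cons_rV R d @^-1` ((fun x => x + v) @^-1` A) =
    T @^-1` (@cons_rV R d @^-1` A).
  suff E p : cons_rV p + v = cons_rV (T p).
    by apply/seteqP; split => p /=; rewrite E.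
  apply/rowP => i; rewrite mxE; case: (@split_ordP 1 d i) => j ->.
    rewrite (_ : lshift d j = ord0); last by rewrite ord1; exact: val_inj.
    by rewrite !cons_rV0.
  by rewrite !cons_rVS /T/= !mxE.
pose m : {measure set (measurableTypeR R * 'rV[R]_d) -> \bar R} :=
  measure_function_pushforward__canonical__measure_function_Measure
    (@lebesgue_measure R \x lebesgue_rV R d)%E mT.
apply/esym; apply: (@product_measure_unique _ _ _ _ R (@lebesgue_measure R)
  (lebesgue_rV R d) m); last first.
  by rewrite -[X in measurable X]setTI; exact: measurable_cons_rV.
move=> A1 A2 mA1 mA2; rewrite /m/= /pushforward.
have -> : T @^-1` (A1 `*` A2) = ((fun x => x + v ord0 ord0) @^-1` A1) `*`
    ((fun x => x + rsubmx (v : 'rV_(1 + d))) @^-1` A2) by [].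
rewrite product_measure1E; last 2 first.
- by rewrite -[X in measurable X]setTI; exact: measurable_addr_R.
- by rewrite -[X in measurable X]setTI; exact: measurable_addr_rV.
by congr (_ * _)%E; [exact: lebesgue_measure_translate|exact: IH].
Qed.

Lemma lebesgue_rV_setT d : (0 < lebesgue_rV R d setT)%E.
Proof.
elim: d => [|d IH]; first by rewrite /= diracT.
rewrite /= /pushforward preimage_setT -setXTT product_measure1E//.
have h : (0 < lebesgue_measure [set: measurableTypeR R])%E.
  by rewrite -[X in lebesgue_measure X]set_itvNyy lebesgue_measure_itv/= adde_gt0.
exact: mule_gt0.
Qed.

Lemma lebesgue_rV_box d (a b : R) :
  (lebesgue_rV R d [set x : 'rV[R]_d | forall i, (a <= x ord0 i <= b)%R] < +oo)%E.
Proof.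
elim: d => [|d IH]; first by rewrite /= diracE; case: (_ \in _); rewrite ltry.
rewrite /= /pushforward.
rewrite (_ : _ @^-1` _ = `[a, b]%classic `*`
  [set x : 'rV[R]_d | forall i, a <= x ord0 i <= b]); last first.
  apply/seteqP; split => p /=.
    move=> h; split; first by have := h ord0; rewrite cons_rV0 in_itv.
    by move=> i; have := h (rshift 1 i); rewrite cons_rVS.
  rewrite in_itv/= => -[h1 h2] i; case: (@split_ordP 1 d i) => j ->.
    rewrite (_ : lshift d j = ord0); last by rewrite ord1; exact: val_inj.
    by rewrite cons_rV0.
  by rewrite cons_rVS.
rewrite product_measure1E//; last first.
  rewrite [X in measurable X](_ : _ =
    \bigcap_(i in [set: 'I_d])
      ((fun x : 'rV[R]_d => x ord0 i : measurableTypeR R) @^-1` `[a, b]%classic)).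
    apply: fin_bigcap_measurable => // i _.
    by rewrite -[X in measurable X]setTI; exact: measurable_coord.
  apply/seteqP; split => x /= h i; have := h i; rewrite /= in_itv//=.
  exact.
have h : (@lebesgue_measure R `[a, b] < +oo)%E.
  by rewrite lebesgue_measure_itv/=; case: ifP; rewrite ?ltry.
by apply: lte_mul_pinfty => //; rewrite ge0_fin_numE.
Qed.

End translation.

Section integral_translation.
Context (R : realType) (d : nat).
Notation leb := (lebesgue_rV R d).
Notation V := 'rV[R]_d.
Local Open Scope ereal_scope.

Let shift_measure (v : V) : {measure set V -> \bar R} :=
  measure_function_pushforward__canonical__measure_function_Measure
    leb (measurable_addr_rV v).

Let shift_measureE (v : V) A : measurable A -> shift_measure v A = leb A.
Proof. exact: lebesgue_rV_translate. Qed.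

Lemma ge0_integral_translate (v : V) D (f : V -> \bar R) : measurable D ->
  measurable_fun D f -> (forall x, D x -> 0 <= f x) ->
  \int[leb]_(x in (fun x => x + v)%R @^-1` D) f (x + v)%R = \int[leb]_(x in D) f x.
Proof.
move=> mD mf f0.
rewrite -[RHS](@eq_measure_integral _ _ _ _ leb (shift_measure v)); last first.
  by move=> A mA _; exact: shift_measureE.
rewrite ge0_integral_pushforward//; last by move=> y /set_mem; exact: f0.
exact: measurable_addr_rV.
Qed.

Lemma integrable_translate (v : V) (f : V -> \bar R) :
  leb.-integrable setT f -> leb.-integrable setT (fun x => f (x + v)%R).
Proof.
move=> /integrableP[mf foo]; apply/integrableP; split.
  by apply: measurableT_comp => //; exact: measurable_addr_rV.
have := @ge0_integral_translate v setT (abse \o f) measurableT.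
by rewrite preimage_setT/= => ->//; exact: measurableT_comp.
Qed.

Lemma integral_translate (v : V) (f : V -> \bar R) :
  leb.-integrable setT f ->
  \int[leb]_x f (x + v)%R = \int[leb]_x f x.
Proof.
move=> fi; have /integrableP[mf foo] := fi.
rewrite -[RHS](@eq_measure_integral _ _ _ _ leb (shift_measure v)); last first.
  by move=> A mA _; exact: shift_measureE.
rewrite integral_pushforward ?preimage_setT//.
- exact: measurable_addr_rV.
- exact: integrable_translate.
Qed.

End integral_translation.

(** * Borel representatives of completed-measurable sets and functions *)

Section completion.
Context d (T : measurableType d) (R : realType)
  (mu : {sigma_finite_measure set T -> \bar R}).
Local Open Scope ereal_scope.
Local Notation cmu := (@completed_measure_extension _ _ _ mu).

(** The completed measure is the outer measure, so [X] may be arbitrary: intersect countable covers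
    whose measures exceed the infimum by at most 1/(n+1). *)
Lemma measurable_hull (X : set T) :
  exists B, [/\ measurable B, X `<=` B & mu B <= cmu X].
Proof.
have [Xoo|] := eqVneq (cmu X) +oo.
  by exists setT; split => //; rewrite Xoo leey.
rewrite -ltey => Xoo.
have Xfin : cmu X \is a fin_num by rewrite ge0_fin_numE// mu_ext_ge0.
have /choice[F FP] n : exists F, [/\ measurable F, X `<=` F &
    mu F <= cmu X + n.+1%:R^-1%:E].
  have n0 : (0 < n.+1%:R^-1 :> R)%R by rewrite invr_gt0.
  have [_/= [A [mA XA] <-] Alt] := lb_ereal_inf_adherent n0 Xfin.
  exists (\bigcup_k A k); split => //; first exact: bigcupT_measurable.
  apply: le_trans (ltW Alt).
  by apply: measure_sigma_subadditive => //; exact: bigcupT_measurable.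
exists (\bigcap_n F n); split.
- by apply: bigcapT_measurable => n; have [] := FP n.
- by apply: sub_bigcap => n _; have [] := FP n.
apply/lee_addgt0Pr => e e0.
near \oo => n; have [mF _ Fle] := FP n.
apply: (@le_trans _ _ (mu (F n))).
  apply: le_measure; rewrite ?inE//; last exact: bigcap_inf.
  by apply: bigcapT_measurable => k; have [] := FP k.
rewrite (le_trans Fle)// leeD2l// lee_fin ltW//.
by near: n; exact: near_infty_natSinv_lt (PosNum e0).
Unshelve. all: by end_near. Qed.

(** Sigma-finiteness cuts [X] into pieces of finite measure; only there does equality of measures
    make the hull minus the piece a null set, which has a Borel null hull. *)
Lemma caratheodory_borel (X : set T) : (mu^*)%mu.-cara.-measurable X ->
  exists B N, [/\ measurable B, measurable N, mu N = 0 &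
    forall x, ~ N x -> (X x <-> B x)].
Proof.
move=> mX.
have /sigma_finiteP[F [FT _ Foo]] := sigma_finiteT mu.
have cF k : (mu^*)%mu.-cara.-measurable (F k).
  by apply: caratheodory_measurable_mu_ext; have [] := Foo k.
have /choice[BN BNP] k : exists BN : set T * set T, [/\ measurable BN.1,
    measurable BN.2, mu BN.2 = 0, X `&` F k `<=` BN.1 &
    BN.1 `\` (X `&` F k) `<=` BN.2].
  have mXF : (mu^*)%mu.-cara.-measurable (X `&` F k) by exact: measurableI.
  have [B [mB XB muB]] := measurable_hull (X `&` F k).
  have XFoo : cmu (X `&` F k) < +oo.
    apply: (@le_lt_trans _ _ (cmu (F k))).
      by apply: le_mu_ext; exact: subIsetr.
    by have [mFk muFk] := Foo k; rewrite /completed_measure_extension measurable_mu_extE.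
  have cB : (mu^*)%mu.-cara.-measurable B by exact: caratheodory_measurable_mu_ext.
  have BE : cmu B = cmu (X `&` F k).
    apply/eqP; rewrite eq_le; apply/andP; split; last exact: le_mu_ext.
    by rewrite {1}/completed_measure_extension measurable_mu_extE.
  have B0 : cmu (B `\` (X `&` F k)) = 0.
    rewrite [LHS](@measureD _ _ _ cmu)//=; last by rewrite BE.
    rewrite setIidr// BE subee// ge0_fin_numE//; exact: mu_ext_ge0.
  have [N [mN BN muN]] := measurable_hull (B `\` (X `&` F k)).
  exists (B, N); split => //=.
  by apply/eqP; rewrite eq_le measure_ge0 andbT -B0.
exists (\bigcup_k (BN k).1), (\bigcup_k (BN k).2); split.
- by apply: bigcupT_measurable => k; have [] := BNP k.
- by apply: bigcupT_measurable => k; have [] := BNP k.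
- apply/eqP; rewrite eq_le measure_ge0 andbT.
  apply: (le_trans (@generalized_Boole_inequality _ _ _ mu (fun k => (BN k).2) _ _)) => //.
  + by move=> k; have [] := BNP k.
  + by apply: bigcupT_measurable => k; have [] := BNP k.
  + by rewrite eseries0// => k _ _; have [] := BNP k.
move=> x Nx; split=> [Xx|[k _ Bx]].
  have [k _ Fx] : (\bigcup_k F k) x by rewrite -FT.
  by exists k => //; have [_ _ _ + _] := BNP k; apply.
apply: contrapT => Xx; apply: Nx; exists k => //.
by have [_ _ _ _] := BNP k; apply; split => // -[].
Qed.

Lemma completed_ae (P : set T) : {ae mu, forall x, P x} ->
  {ae cmu, forall x, P x}.
Proof.
move=> [N [mN N0 PN]]; exists N; split => //.
- exact: caratheodory_measurable_mu_ext.
- by rewrite /completed_measure_extension measurable_mu_extE.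
Qed.

Lemma ae_completed (P : set T) : {ae cmu, forall x, P x} ->
  {ae mu, forall x, P x}.
Proof.
move=> [N [mN N0 PN]]; have [B [mB NB muB]] := measurable_hull N.
exists B; split => //; last exact: subset_trans NB.
by apply/eqP; rewrite eq_le measure_ge0 andbT -N0.
Qed.

(** The sets where [f] is below a rational are Borel up to null sets. There are countably many of
    them, so setting [f] to 0 on the union of these null sets makes it Borel. *)
Lemma completed_integrable_borel (f : T -> R) :
  cmu.-integrable setT (EFin \o f) ->
  exists g : T -> R, mu.-integrable setT (EFin \o g) /\
    {ae mu, forall x, f x = g x}.
Proof.
move=> /integrableP[mf foo].
(* An enumeration of the rationals; a number that encodes none gives 0. *)
pose q (k : nat) : R := ratr (odflt 0%R (choice.unpickle k : option rat)).
have q_dense (a b : R) : (a < b)%R -> exists k, (a < q k < b)%R.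
  move=> /rat_in_itvoo[r]; rewrite in_itv/= => rab.
  by exists (choice.pickle r); rewrite /q choice.pickleK.
have mlt k : (mu^*)%mu.-cara.-measurable [set x | (f x < q k)%R].
  have := emeasurable_fun_infty_o measurableT mf (q k)%:E.
  by rewrite setTI.
have /choice[BN BNP] k : exists BN : set T * set T, [/\ measurable BN.1,
    measurable BN.2, mu BN.2 = 0 &
    forall x, ~ BN.2 x -> ((f x < q k)%R <-> BN.1 x)].
  by have [B [N [? ? ? ?]]] := caratheodory_borel (mlt k); exists (B, N).
pose N := \bigcup_k (BN k).2.
have mN : measurable N by apply: bigcupT_measurable => k; have [] := BNP k.
have N0 : mu N = 0.
  apply/eqP; rewrite eq_le measure_ge0 andbT.
  apply: (le_trans (@generalized_Boole_inequality _ _ _ mu (fun k => (BN k).2) _ _)) => //.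
    by move=> k; have [] := BNP k.
  by rewrite eseries0// => k _ _; have [] := BNP k.
pose g x := (f x * \1_(~` N) x)%R.
have gN x : N x -> g x = 0%R by move=> Nx; rewrite /g indicE memNset ?mulr0//= => /(_ Nx).
have gNN x : ~ N x -> g x = f x by move=> Nx; rewrite /g indicE mem_set ?mulr1.
have mg : measurable_fun setT g.
  apply: (measurability _ (RGenInftyO.measurableE R)) => //.
  move=> _ [_ [a ->] <-]; rewrite setTI.
  rewrite [X in measurable X](_ : _ = (\bigcup_(k in [set k | (q k < a)%R])
    ((BN k).1 `&` ~` N)) `|` (N `&` [set _ | (0 < a)%R])).
    apply: measurableU; last first.
      by apply: measurableI => //; have [a0|a0] := boolP (0 < a)%R;
        [rewrite (_ : [set _ | _] = setT)|rewrite (_ : [set _ | _] = set0)] => //;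
        apply/seteqP; split => // x.
    apply: bigcup_measurable => k _; apply: measurableI; last exact: measurableC.
    by have [] := BNP k.
  have BNE k x : ~ N x -> (f x < q k)%R <-> (BN k).1 x.
    by move=> Nx; have [_ _ _] := BNP k; apply => ?; apply: Nx; exists k.
  apply/seteqP; split => x; rewrite /= in_itv/=.
    have [Nx|Nx] := pselect (N x); first by rewrite gN//; right.
    rewrite gNN// => /q_dense[k /andP[fq qa]]; left; exists k => //; split => //.
    exact/BNE.
  move=> [[k /= qa [Bx Nx]]|[Nx /= a0]]; last by rewrite gN.
  by rewrite gNN// (lt_trans _ qa)//; apply/BNE.
exists g; split; last first.
  exists N; split => // x /= fg; apply: contrapT => /gNN gf; exact: fg.
apply/integrableP; split; first exact/measurable_EFinP.
(* [mu] is the image of the completed measure under the identity map to the Borel sigma-algebra,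
   which transfers the bound on the integral. *)
have mid : measurable_fun setT (id : caratheodory_type (mu^*)%mu -> T).
  by move=> _ Y mY; rewrite setTI preimage_id; exact: caratheodory_measurable_mu_ext.
have mg' : measurable_fun setT (g : caratheodory_type (mu^*)%mu -> R).
  exact: (measurableT_comp mg mid).
have mabs : measurable_fun setT (fun x => `|(g x)%:E|).
  by apply: measurableT_comp => //; exact/measurable_EFinP.
rewrite (@eq_measure_integral _ T R setT
  (measure_function_pushforward__canonical__measure_function_Measure cmu mid)); last first.
  by move=> A mA _; apply/esym; exact: measurable_mu_extE.
rewrite ge0_integral_pushforward; last 4 first.
- exact: mid.
- exact: measurableT.
- exact: mabs.
- by move=> y _.
rewrite preimage_setT; apply: le_lt_trans foo; apply: ge0_le_integral.
- exact: measurableT.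
- by move=> x _; exact: abse_ge0.
- exact: (measurableT_comp mabs mid).
- have abs_comp d' (T' : measurableType d') (h : T' -> \bar R) :
    measurable_fun setT h -> measurable_fun setT (fun x => `|h x|).
    by move=> mh; exact: measurableT_comp.
  exact: (abs_comp _ (caratheodory_type (mu^*)%mu) _ mf).
- move=> x _; rewrite /= lee_fin /g normrM ler_piMr// indicE.
  by case: (_ \in _); rewrite ?normr1 ?normr0.
Qed.

End completion.

(** * Unconditional sums *)

Section enumerated_sums.
Context (R : realType) (I : choiceType).
Implicit Types (e : nat -> I) (a : I -> R).

(** A finite set meets the range of [e] in finitely many points, so its sum consists of terms of a
    long enough initial segment. *)
Lemma partial_sum_enum e a (A : {fset I}) : injective e ->
  (forall i, ~ range e i -> a i = 0) ->
  exists M0, forall M, (M0 <= M)%N ->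
    summability.partial_sum a A = \sum_(0 <= n < M | e n \in A) a (e n).
Proof.
move=> inj_e a0.
have [M0 M0P] : exists M0, forall n, e n \in A -> (n < M0)%N.
  elim/finSet_rect: A => A IH.
  have [->|/fset0Pn[i iA]] := eqVneq A fset0%fset; first by exists 0%N => n; rewrite inE.
  have [M0 M0P] := IH _ (fproperD1 iA).
  have [[k _ eki]|ni] := pselect (range e i).
    exists (maxn M0 k.+1) => n enA; rewrite leq_max.
    have [eni|eni] := eqVneq (e n) i.
      by rewrite -eki in eni; rewrite (inj_e _ _ eni) ltnSn orbT.
    by rewrite M0P// in_fsetD1 eni.
  exists M0 => n enA; rewrite M0P// in_fsetD1 enA andbT.
  by apply/eqP => eni; apply: ni; exists n.
exists M0 => M M0M; rewrite /summability.partial_sum.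
rewrite -(big_seq_fsetE _ _ xpredT a)/=.
transitivity (\sum_(i <- A) \sum_(0 <= n < M | e n == i) a (e n)).
  rewrite [LHS]big_seq [RHS]big_seq; apply: eq_bigr => i iA.
  have [[k _ eki]|ni] := pselect (range e i).
    rewrite (big_rem k)/=; last first.
      by rewrite mem_index_iota/= (leq_trans _ M0M)// M0P// eki.
    rewrite eki eqxx big_seq_cond big1 ?addr0// => n /andP[+ /eqP eni].
    rewrite (inj_e n k) ?mem_rem_uniq ?inE ?eqxx ?iota_uniq//.
    by rewrite eni eki.
  by rewrite a0// big1// => n /eqP eni; exfalso; apply: ni; exists n.
rewrite (exchange_big_dep xpredT)//= [RHS]big_mkcond/=; apply: eq_bigr => n _.
case: ifPn => enA.
  rewrite big_mkcond (big_fsetD1 _ enA)/= eqxx big_seq big1 ?addr0// => i.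
  by rewrite !inE eq_sym => /andP[/negbTE -> _].
rewrite big_seq_cond big1// => i /andP[iA /eqP eni].
by rewrite eni iA in enA.
Qed.

Definition abs_summable (u : nat -> R) := cvgn [normed series u].

Lemma abs_summable_cvg u : abs_summable u -> cvgn (series u).
Proof. exact: normed_cvg. Qed.

Lemma abs_summable_bound (u : nat -> R) (M : R) :
  (forall n, \sum_(0 <= k < n) `|u k| <= M) -> abs_summable u.
Proof.
move=> uM; apply: nondecreasing_is_cvgn.
  by apply: nondecreasing_series => n _ _; exact: normr_ge0.
by exists M => _ [n _ <-]; exact: uM.
Qed.

Lemma abs_summable_le u n : abs_summable u ->
  \sum_(0 <= k < n) `|u k| <= limn [normed series u].
Proof.
move=> su; apply: (nondecreasing_cvgn_le _ su).
by apply: nondecreasing_series => k _ _; exact: normr_ge0.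
Qed.

(** The sum over a finite set containing the first [N] points differs from the partial series by at
    most a tail of the series of absolute values. *)
Lemma has_sum_enum e a : injective e -> (forall i, ~ range e i -> a i = 0) ->
  abs_summable (a \o e) ->
  summability.partial_sum a @ summability.totally --> limn (series (a \o e)).
Proof.
move=> inj_e a0 sa; have ca := abs_summable_cvg sa.
apply/cvgrPdist_le => eps eps0.
have e2 : 0 < eps / 2 by rewrite divr_gt0.
have /cvgrPdist_le/(_ _ e2) near1 := ca.
have /cvgrPdist_le/(_ _ e2) near2 := sa.
have [N [N1 N2]] : exists N, `|limn (series (a \o e)) - series (a \o e) N| <= eps / 2
    /\ `|limn [normed series (a \o e)] - [normed series (a \o e)] N| <= eps / 2.
  near \oo => N; exists N; split; [by near: N|by near: N].
exists [fset e n | n in iota 0 N]%fset => // A /= NA.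
have [M0 M0P] := partial_sum_enum A inj_e a0.
have eA n : (n < N)%N -> e n \in A.
  move=> nN; apply: (fsubsetP NA); apply/imfsetP; exists n => //=.
  by rewrite mem_iota.
rewrite (M0P (maxn M0 N)) ?leq_maxl//.
rewrite (@big_cat_nat _ _ _ N) ?leq_maxr//=.
rewrite (_ : \sum_(0 <= i < N | _) _ = series (a \o e) N); last first.
  rewrite seriesEnat/= big_nat_cond [RHS]big_nat_cond.
  apply: eq_bigl => n; apply/andP/andP => -[nN _]; split => //.
  by apply: eA; case/andP: nN.
rewrite opprD addrA (splitr eps) (le_trans (ler_normB _ _))// lerD//.
rewrite (le_trans (ler_norm_sum _ _ _))//.
apply: (@le_trans _ _ (\sum_(N <= n < maxn M0 N) `|(a \o e) n|)).
  rewrite [leRHS]big_mkcond/= [leLHS]big_mkcond/=; apply: ler_sum => n _.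
  by case: ifP.
apply: le_trans N2.
rewrite ger0_norm ?subr_ge0; last exact: abs_summable_le.
rewrite lerBrDr addrC; apply: le_trans (abs_summable_le (maxn M0 N) sa).
by rewrite [leRHS](@big_cat_nat _ _ _ N) ?leq_maxr.
Unshelve. all: by end_near. Qed.

Lemma abs_summable_reindex e e' a : injective e -> injective e' ->
  range e' `<=` range e -> abs_summable (a \o e) -> abs_summable (a \o e').
Proof.
move=> inj_e inj_e' ee' sa.
pose b i := if `[< range e i >] then `|a i| else 0.
have be n : b (e n) = `|a (e n)|.
  by rewrite /b asboolT//; exists n.
apply: (@abs_summable_bound _ (limn [normed series (a \o e)])) => m.
have b0 i : ~ range e i -> b i = 0 by rewrite /b; case: asboolP.
have [M0 M0P] := partial_sum_enum [fset e' n | n in iota 0 m]%fset inj_e b0.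
have -> : \sum_(0 <= k < m) `|(a \o e') k| =
    summability.partial_sum b [fset e' n | n in iota 0 m]%fset.
  rewrite /summability.partial_sum -(big_seq_fsetE _ _ xpredT b)/=.
  rewrite (perm_big [seq e' k | k <- index_iota 0 m])/=; last first.
    apply: uniq_perm; first exact: fset_uniq.
      by rewrite map_inj_uniq ?iota_uniq.
    move=> x; rewrite /index_iota subn0.
    by apply/imfsetP/mapP => -[n nm ->]; exists n.
  rewrite big_map; apply: eq_bigr => n _.
  by rewrite /b asboolT//; apply: ee'; exists n.
rewrite (M0P M0 (leqnn _)) (le_trans _ (abs_summable_le M0 sa))//.
rewrite big_mkcond/=; apply: ler_sum => n _; rewrite be.
by case: ifP.
Qed.

(** Both series compute the limit along finite sets of one family, namely [a] extended by 0 outside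
    the common range. *)
Lemma limn_series_reindex e e' a : injective e -> injective e' ->
  range e' = range e -> abs_summable (a \o e) ->
  limn (series (a \o e')) = limn (series (a \o e)).
Proof.
move=> inj_e inj_e' ee' sa.
have sa' : abs_summable (a \o e').
  by apply: (abs_summable_reindex inj_e inj_e') sa; rewrite ee'.
pose b i := if `[< range e i >] then a i else 0.
have b0 i : ~ range e i -> b i = 0 by rewrite /b; case: asboolP.
have be : b \o e = a \o e.
  by apply/funext => n; rewrite /b/= asboolT//; exists n.
have be' : b \o e' = a \o e'.
  apply/funext => n; have re : range e (e' n) by rewrite -ee'; exists n.
  by rewrite /b/= asboolT.
have h : summability.partial_sum b @ summability.totally --> limn (series (a \o e)).
  by rewrite -be; apply: has_sum_enum; rewrite ?be.
have h' : summability.partial_sum b @ summability.totally --> limn (series (a \o e')).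
  by rewrite -be'; apply: has_sum_enum => //; [rewrite ee'|rewrite be'].
exact: (cvg_unique _ h' h).
Qed.

End enumerated_sums.

(** * Lattices *)

Section lattice_basis.
Variables (R : realType) (d : nat).
Implicit Types (B : 'M[R]_d) (L : set 'rV[R]_d) (x y v : 'rV[R]_d).

Definition intv (m : 'rV[int]_d) : 'rV[R]_d := map_mx intr m.

Definition lspan B : set 'rV[R]_d := [set intv m *m B | m in setT].

Definition fracr (t : R) : R := t - (Num.floor t)%:~R.

Lemma fracr_itv t : 0 <= fracr t < 1.
Proof.
have /andP[h1 h2] := floor_itv t; rewrite /fracr subr_ge0 h1/= ltrBlDl.
by move: h2; rewrite intrD addrC.
Qed.

Lemma intv_inj : injective intv.
Proof.
move=> m m' /rowP h; apply/rowP => i.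
by have := h i; rewrite !mxE => /intr_inj.
Qed.

Lemma intvD m m' : intv (m + m') = intv m + intv m'.
Proof. exact: map_mxD. Qed.

Lemma intvN m : intv (- m) = - intv m.
Proof. exact: map_mxN. Qed.

Lemma intvB m m' : intv (m - m') = intv m - intv m'.
Proof. exact: map_mxB. Qed.

Lemma additive_row_basis (phi : {additive 'rV[int]_d -> 'rV[R]_d}) :
  exists B, forall m, phi m = intv m *m B.
Proof.
exists (\matrix_(i < d) phi (delta_mx ord0 i)) => m.
rewrite {1}(row_sum_delta m) raddf_sum mulmx_sum_row; apply: eq_bigr => i _.
by rewrite rowK mxE scaler_int -[X in X *: _]intz scaler_int raddfMz.
Qed.

(** Simultaneous approximation: rounding down a multiple of [c] changes its image under [B] from 0
    to minus that of the fractional parts. By the pigeonhole principle two multiples have nearby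
    fractional parts, and the difference of their roundings is the required vector. *)
Lemma dirichlet_small (B : 'M[R]_d) (c : 'rV[R]_d) (eps : R) : 0 < eps ->
  c != 0 -> c *m B = 0 ->
  exists2 m : 'rV[int]_d, m != 0 & forall i, `|(intv m *m B) ord0 i| < eps.
Proof.
move=> eps0 c0 cB.
have [j cj] : exists j, c ord0 j != 0.
  apply/existsP; move: c0; apply: contraNT; rewrite negb_exists => /forallP h.
  by apply/eqP/rowP => i; rewrite mxE; have := h i; rewrite negbK => /eqP.
(* Scaling coordinate [j] to 1 makes entry [j] of [m k] equal to [k], so that the [m k] are
   distinct. *)
pose t (k : nat) i : R := k%:R * (c ord0 i / c ord0 j).
pose m k : 'rV[int]_d := \row_i Num.floor (t k i).
have mBE k : intv (m k) *m B = - (\row_i fracr (t k i)) *m B.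
  have tB : (\row_i t k i) *m B = 0.
    rewrite (_ : \row_i _ = (k%:R / c ord0 j) *: c) -?scalemxAl ?cB ?scaler0//.
    by apply/rowP => i; rewrite !mxE /t mulrA mulrAC.
  rewrite -[LHS]addr0 -oppr0 -tB -mulNmx -mulmxDl; congr (_ *m _).
  by apply/rowP => i; rewrite !mxE /fracr opprB.
have mkj k : m k ord0 j = k%:Z.
  by rewrite mxE /t divff// mulr1 -[k%:R]/(k%:Z%:~R) intrKfloor.
pose S : R := \sum_i \sum_l `|B i l|.
have S0 : 0 <= S by apply: sumr_ge0 => i _; apply: sumr_ge0.
(* Cells have side 1/(K+1), and [B] enlarges this by a factor at most [S]; the choice gives S/(K+1)
   < eps. *)
pose K := (Num.truncn (S / eps)).
have SK : S < K.+1%:R * eps by rewrite -ltr_pdivrMr// truncnS_gt.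
pose cell (k : 'I_#|{ffun 'I_d -> 'I_K.+1}|.+1) : {ffun 'I_d -> 'I_K.+1} :=
  [ffun i => inord `|Num.floor (K.+1%:R * fracr (t k i))|].
have /injectivePn[k [k' kk' cellE]] : ~~ injectiveb cell.
  by apply/injectiveP => /leq_card; rewrite card_ord ltnn.
exists (m k - m k').
  apply: contraNneq kk' => /subr0_eq/rowP/(_ j); rewrite !mkj => -[h].
  exact/eqP/val_inj.
have Kfrac u : (`|Num.floor (K.+1%:R * fracr u)|%:Z = Num.floor (K.+1%:R * fracr u)) /\
    (`|Num.floor (K.+1%:R * fracr u)| < K.+1)%N.
  have /andP[f0 f1] := fracr_itv u.
  have fl0 : 0 <= Num.floor (K.+1%:R * fracr u) by rewrite floor_ge0 mulr_ge0.
  split; first by rewrite gez0_abs.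
  rewrite -ltz_nat gez0_abs// -(ltr_int R) (le_lt_trans (floor_le _))//.
  by rewrite -[ltRHS]mulr1 ltr_pM2l.
have small i : `|fracr (t k' i) - fracr (t k i)| < K.+1%:R^-1.
  have := congr1 (fun g : {ffun _ -> _} => nat_of_ord (g i)) cellE.
  rewrite !ffunE !inordK ?(Kfrac _).2// => /(congr1 Posz); rewrite !(Kfrac _).1 => fl.
  rewrite -[ltRHS]mul1r ltr_pdivlMr// -[X in _ * X]ger0_norm// -normrM mulrBl.
  rewrite ![_ * K.+1%:R]mulrC.
  have := floor_itv (K.+1%:R * fracr (t k i)); have := floor_itv (K.+1%:R * fracr (t k' i)).
  rewrite fl !intrD => /andP[a1 a2] /andP[b1 b2].
  by rewrite ltr_norml; apply/andP; split; lra.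
move=> l; rewrite intvB mulmxBl !mBE -mulmxBl opprK addrC !mxE.
apply: (le_lt_trans (ler_norm_sum _ _ _)).
apply: (@le_lt_trans _ _ (\sum_i K.+1%:R^-1 * `|B i l|)).
  apply: ler_sum => i _; rewrite !mxE normrM ler_wpM2r// ltW//.
rewrite -mulr_sumr mulrC ltr_pdivrMr// mulrC (le_lt_trans _ SK)//.
apply: ler_sum => i _; rewrite (bigD1 l)//= lerDl; exact: sumr_ge0.
Qed.

End lattice_basis.

Section lattice_span.
Variables (R : realType) (d : nat).
Implicit Types (B : 'M[R]_d) (L : set 'rV[R]_d) (x y v : 'rV[R]_d).

(** The images of the unit vectors span [L] over the integers. Were they dependent over the reals,
    [dirichlet_small] would put nonzero points of [L] in every neighbourhood of 0, against
    discreteness. *)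
Lemma lattice_basis L : lattice L -> exists2 B, B \in unitmx & L = lspan B.
Proof.
move=> [[L0 LB] Ldisc [phi [inj_phi rphi]]].
have [B phiB] := additive_row_basis phi.
have LE : L = lspan B.
  by rewrite -rphi; apply/seteqP; split => _ [m _ <-]; exists m.
exists B => //; rewrite -row_free_unit -kermx_eq0; apply/negPn/negP.
move=> /rowV0Pn[c /sub_kermxP cB c0].
have [_ [U /nbhs_ballP[eps /= eps0 epsU] UL]] := Ldisc _ L0.
have [m m0 mB] := dirichlet_small eps0 c0 cB.
have : (U `&` L) (intv R m *m B).
  split; last by rewrite LE; exists m.
  apply: epsU; split => //= i j; rewrite -ball_normE/= ord1 !mxE sub0r normrN.
  by have := mB j; rewrite !mxE.
rewrite UL -phiB => /= h; move/eqP: m0; apply.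
by apply: inj_phi; rewrite h raddf0.
Qed.

Lemma mulmx_rV_lt (A : 'M[R]_d) : exists2 r, 0 < r &
  forall x, (forall i, `|x ord0 i| < r) -> forall l, `|(x *m A) ord0 l| < 1.
Proof.
pose S : R := \sum_i \sum_l `|A i l|.
have S0 : 0 <= S by apply: sumr_ge0 => i _; apply: sumr_ge0.
exists (S + 1)^-1; first by rewrite invr_gt0 ltr_wpDl.
move=> x xr l; rewrite mxE.
apply: (le_lt_trans (ler_norm_sum _ _ _)).
apply: (@le_lt_trans _ _ (\sum_i (S + 1)^-1 * `|A i l|)).
  by apply: ler_sum => i _; rewrite normrM ler_wpM2r// ltW.
rewrite -mulr_sumr mulrC ltr_pdivrMr ?ltr_wpDl// mul1r.
apply: (@le_lt_trans _ _ S); last by rewrite ltrDl.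
by apply: ler_sum => i _; rewrite (bigD1 l)//= lerDl; exact: sumr_ge0.
Qed.

Lemma lspan0 B : lspan B 0.
Proof. by exists 0 => //; rewrite /intv map_mx0 mul0mx. Qed.

Lemma lspanD B x y : lspan B x -> lspan B y -> lspan B (x + y).
Proof. by move=> [m _ <-] [m' _ <-]; exists (m + m') => //; rewrite intvD mulmxDl. Qed.

Lemma lspanN B x : lspan B x -> lspan B (- x).
Proof. by move=> [m _ <-]; exists (- m) => //; rewrite intvN mulNmx. Qed.

Lemma lspan_small B x : B \in unitmx -> lspan B x ->
  (forall i, `|(x *m invmx B) ord0 i| < 1) -> x = 0.
Proof.
move=> uB [m _ <-]; rewrite mulmxK// => h.
suff -> : m = 0 by rewrite /intv map_mx0 mul0mx.
apply/rowP => i; rewrite mxE; have := h i.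
rewrite mxE -intr_norm -[1]/(1%:~R) ltr_int => hi.
by apply/eqP; rewrite -normr_le0 -ltzD1 add0r.
Qed.

Lemma lattice_lspan B : B \in unitmx -> lattice (lspan B).
Proof.
move=> uB; split.
- by split; [exact: lspan0|move=> x y Lx Ly; apply: lspanD => //; exact: lspanN].
- move=> x Lx; split; first exact/mem_set.
  have [r r0 rP] := mulmx_rV_lt (invmx B).
  exists (ball x r); first exact: nbhsx_ballx.
  apply/seteqP; split => [y [xy Ly]|_ ->]; last first.
    by split => //; exact: ballxx.
  apply/eqP; rewrite eq_sym -subr_eq0; apply/eqP; apply: (lspan_small uB).
    by apply: lspanD => //; exact: lspanN.
  apply: rP => i; have := xy.2 ord0 i.
  by rewrite -ball_normE/= !mxE.
- exists (mulmxr B \o map_mx intr : {additive 'rV[int]_d -> 'rV[R]_d}); split.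
    move=> m m' /= /(can_inj (mulmxK uB)); exact: intv_inj.
  by [].
Qed.

(** Coordinates, in the basis [B], of the representative of [x] in the half-open cell [fdom B]. *)
Definition fcoord B x : 'rV[R]_d := \row_i fracr ((x *m invmx B) ord0 i).

Definition fdom B : set 'rV[R]_d :=
  [set x | forall i, 0 <= (x *m invmx B) ord0 i < 1].

Lemma fdom_fcoord B x : B \in unitmx -> fdom B (fcoord B x *m B).
Proof. by move=> uB i; rewrite mulmxK// mxE fracr_itv. Qed.

Lemma fcoord_lspan B x : B \in unitmx -> lspan B (fcoord B x *m B - x).
Proof.
move=> uB; exists (- \row_i Num.floor ((x *m invmx B) ord0 i)) => //.
rewrite -[in RHS](mulmxKV uB x) -mulmxBl; congr (_ *m _).
by apply/rowP => i; rewrite !mxE mulmxKV// /fracr addrAC subrr add0r rmorphN.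
Qed.

Lemma fdom_uniq B x y : B \in unitmx -> fdom B x -> fdom B y ->
  lspan B (x - y) -> x = y.
Proof.
move=> uB Dx Dy Lxy; apply/eqP; rewrite -subr_eq0; apply/eqP.
apply: (lspan_small uB) => // i; rewrite mulmxBl.
have /andP[x0 x1] := Dx i; have /andP[y0 y1] := Dy i.
by rewrite mxE [X in _ + X]mxE ltr_norml; apply/andP; split; lra.
Qed.

(** Positive dimension makes the lattice infinite, so a sequence without repetition can exhaust it
    and lattice sums become series. *)
Lemma lspan_enum B : (0 < d)%N -> B \in unitmx ->
  exists e : nat -> 'rV[R]_d, injective e /\ range e = lspan B.
Proof.
move=> d0 uB.
have : ([set: 'rV[int]_d] #= [set: nat])%card.
  apply: eq_card_nat; first exact: countableP.
  move=> fin; apply: infinite_nat.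
  have -> : [set: nat] = (fun n : nat => const_mx n%:Z : 'rV[int]_d) @^-1` setT.
    by rewrite preimage_setT.
  apply: finite_preimage => // n m _ _ /rowP/(_ (Ordinal d0)).
  by rewrite !mxE => -[].
move=> /card_set_bijP[f [_ inj_f surj_f]].
have /choice[g gP] n : exists m, f m = n by have [m _ <-] := surj_f n I; exists m.
exists (fun n => intv R (g n) *m B); split.
  by move=> n m /(can_inj (mulmxK uB)) /intv_inj gnm; rewrite -(gP n) -(gP m) gnm.
apply/seteqP; split => [_ [n _ <-]|_ [m _ <-]]; first by exists (g n).
exists (f m) => //; congr (intv R _ *m B).
by apply: inj_f; rewrite ?in_setT// gP.
Qed.

Lemma fdom_enum B (e : nat -> 'rV[R]_d) x : B \in unitmx -> injective e -> range e = lspan B ->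
  exists n, x + e n = fcoord B x *m B /\ forall k, fdom B (x + e k) -> k = n.
Proof.
move=> uB inj_e re.
have [n _ en] : range e (fcoord B x *m B - x) by rewrite re; exact: fcoord_lspan.
have xe : x + e n = fcoord B x *m B by rewrite en addrC subrK.
exists n; split => // k Dk; apply: inj_e; apply: (addrI x).
apply: (fdom_uniq uB Dk); first by rewrite xe; exact: fdom_fcoord.
rewrite opprD addrACA subrr add0r; apply: lspanD; last apply: lspanN.
  by rewrite -re; exists k.
by rewrite -re; exists n.
Qed.

Lemma fcoord_add B x l : B \in unitmx -> lspan B l -> fcoord B (x + l) = fcoord B x.
Proof.
move=> uB Ll; apply: (can_inj (mulmxK uB)); apply: (fdom_uniq uB).
- exact: fdom_fcoord.
- exact: fdom_fcoord.
rewrite (_ : _ - _ = (fcoord B (x + l) *m B - (x + l)) + l - (fcoord B x *m B - x)).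
  apply: lspanD; last by apply: lspanN; exact: fcoord_lspan.
  by apply: lspanD => //; exact: fcoord_lspan.
by rewrite opprB opprD !addrA !subrK.
Qed.

Lemma measurable_fracr : measurable_fun setT (@fracr R).
Proof.
apply: measurable_funB => //; apply: nondecreasing_measurable => // s t st.
by rewrite ler_int le_floor.
Qed.

Lemma measurable_fcoord B : measurable_fun setT (fcoord B).
Proof.
apply: measurable_fun_rV => i; under eq_fun do rewrite mxE.
apply: measurableT_comp; first exact: measurable_fracr.
apply: (measurableT_comp (measurable_coord i)).
exact: measurable_mulmx_rV.
Qed.

Lemma measurable_fdom B : measurable (fdom B).
Proof.
rewrite (_ : fdom B = \bigcap_(i in [set: 'I_d])
    ((fun x : 'rV[R]_d => (x *m invmx B) ord0 i : measurableTypeR R) @^-1` `[0, 1[%classic)).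
  apply: fin_bigcap_measurable => // i _.
  rewrite -[X in measurable X]setTI.
  apply: (measurableT_comp (measurable_coord i)) => //.
  exact: measurable_mulmx_rV.
by apply/seteqP; split => x /= h i; have := h i; rewrite /= in_itv//=; exact.
Qed.

Lemma fdom_lty B : B \in unitmx -> (lebesgue_rV R d (fdom B) < +oo)%E.
Proof.
move=> uB; pose S : R := \sum_i \sum_l `|B i l|.
apply: le_lt_trans (lebesgue_rV_box d (- S) S).
apply: le_measure; rewrite ?inE.
- exact: measurable_fdom.
- rewrite [X in measurable X](_ : _ =
    \bigcap_(i in [set: 'I_d])
      ((fun x : 'rV[R]_d => x ord0 i : measurableTypeR R) @^-1` `[- S, S]%classic)).
    apply: fin_bigcap_measurable => // i _.
    by rewrite -[X in measurable X]setTI; exact: measurable_coord.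
  by apply/seteqP; split => x /= h i; have := h i; rewrite /= in_itv//=; exact.
move=> x Dx l; rewrite -ler_norml -(mulmxKV uB x) mxE.
apply: (le_trans (ler_norm_sum _ _ _)); apply: ler_sum => i _.
apply: (@le_trans _ _ `|B i l|).
  rewrite normrM ler_piMl//; have /andP[x0 x1] := Dx i.
  by rewrite ger0_norm// ltW.
by rewrite (bigD1 l)//= lerDl; exact: sumr_ge0.
Qed.

End lattice_span.

(** * Periodization *)

Section nonneg_series.
Variable R : realType.
Implicit Types u : nat -> R.

Lemma cvg_EFinE u (s : R) : (u @ \oo --> s) <-> ((EFin \o u) @ \oo --> s%:E).
Proof.
split=> us; last exact: (fine_cvg us).
by apply/fine_cvgP; split => //; exact: nearW.
Qed.

Lemma nneseries_EFin u : (fun n => \sum_(0 <= k < n) (u k)%:E)%E = EFin \o series u.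
Proof. by apply/funext => n; rewrite /= sumEFin. Qed.

Lemma cvg_nneseriesE u (s : R) : (forall k, 0 <= u k) ->
  (series u @ \oo --> s) <-> (\sum_(0 <= k <oo) (u k)%:E = s%:E)%E.
Proof.
move=> u0; split=> us.
  by rewrite nneseries_EFin; apply/cvg_lim => //; exact/cvg_EFinE.
have cu : cvgn (series u) by apply: nnseries_is_cvg => //; rewrite us ltry.
suff <- : limn (series u) = s by [].
by apply: EFin_inj; rewrite -EFin_lim// -us nneseries_EFin.
Qed.

Lemma abs_summableP u :
  abs_summable u <-> (\sum_(0 <= k <oo) `|u k|%:E < +oo)%E.
Proof.
split=> [/(@cvg_nneseriesE (fun k => `|u k|)) ->//|]; first exact: ltry.
exact: nnseries_is_cvg.
Qed.

End nonneg_series.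

Section real_integral.
Context (R : realType) (d : nat).
Local Notation V := 'rV[R]_d.
Local Notation leb := (lebesgue_rV R d).
Local Notation integ g := (leb.-integrable setT (EFin \o g)).
Local Notation Int g := (Rintegral leb setT g).
Implicit Types (f g h : V -> R).

Lemma integ_measurable g : integ g -> measurable_fun setT g.
Proof. by move=> /integrableP[/measurable_EFinP]. Qed.

Lemma EFin_Int g : integ g -> (Int g)%:E = (\int[leb]_x (g x)%:E)%E.
Proof. by move=> ig; rewrite /Rintegral fineK//; exact: integrable_fin_num. Qed.

Lemma integ_bounded_mul (M : R) f h : integ f -> measurable_fun setT h ->
  (forall x, `|h x| <= M) -> integ (fun x => f x * h x).
Proof.
move=> fi mh hM; have mf := integ_measurable fi.
apply: (@le_integrable _ _ _ _ _ measurableT _ (fun x => M%:E * (f x)%:E)%E).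
- by apply/measurable_EFinP; exact: measurable_funM.
- move=> x _ /=; rewrite lee_fin !normrM mulrC ler_wpM2r//.
  by rewrite (le_trans (hM x))// ler_norm.
- exact: integrableZl.
Qed.

Lemma integ_add f g : integ f -> integ g -> integ (fun x => f x + g x).
Proof. by move=> fi gi; exact: (integrableD measurableT fi gi). Qed.

Lemma integ_scale (a : R) f : integ f -> integ (fun x => a * f x).
Proof. by move=> fi; exact: (integrableZl measurableT a fi). Qed.

Lemma integ_shift f v : integ f -> integ (fun x => f (x + v)).
Proof. by move=> fi; exact: (integrable_translate v fi). Qed.

Lemma Int_add f g : integ f -> integ g ->
  Int (fun x => f x + g x) = Int f + Int g.
Proof. by move=> fi gi; exact: RintegralD. Qed.

Lemma Int_scale (a : R) f : integ f -> Int (fun x => a * f x) = a * Int f.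
Proof. by move=> fi; exact: RintegralZl. Qed.

Lemma Int_shift f v : integ f -> Int (fun x => f (x + v)) = Int f.
Proof. by move=> fi; congr fine; exact: (integral_translate v fi). Qed.

Lemma integ_sum (I : Type) (s : seq I) (F : I -> V -> R) :
  (forall i, integ (F i)) -> integ (fun x => \sum_(i <- s) F i x).
Proof.
move=> Fi; elim: s => [|i s IH].
  by under eq_fun do rewrite big_nil; exact: integrable0.
under eq_fun do rewrite big_cons.
exact: integ_add.
Qed.

Lemma Int_sum (I : Type) (s : seq I) (F : I -> V -> R) :
  (forall i, integ (F i)) ->
  Int (fun x => \sum_(i <- s) F i x) = \sum_(i <- s) Int (F i).
Proof.
move=> Fi; elim: s => [|i s IH].
  rewrite big_nil; under eq_Rintegral do rewrite big_nil.
  by rewrite /Rintegral integral0.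
rewrite big_cons -IH -Int_add//; last exact: integ_sum.
by under eq_Rintegral do rewrite big_cons.
Qed.

End real_integral.

(** * Unfolding a periodization against a test function *)

Section periodization.
Context (R : realType) (d : nat).
Local Notation V := 'rV[R]_d.
Local Notation leb := (lebesgue_rV R d).
Local Notation integ g := (leb.-integrable setT (EFin \o g)).
Local Notation Int g := (Rintegral leb setT g).
Implicit Types (f g h : V -> R) (e : nat -> V).

Definition summable_at e f : set V := [set x | abs_summable (fun k => f (x - e k))].

(* Outside summable_at e f the value is 0. *)
Definition period_sum e f (x : V) : R :=
  limn (series (fun k => \1_(summable_at e f) x * f (x - e k))).

Lemma measurable_shift_fun f (v : V) : measurable_fun setT f ->
  measurable_fun setT (fun x : V => f (x + v)).
Proof. by move=> mf; apply: measurableT_comp => //; exact: measurable_addr_rV. Qed.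

Lemma measurable_summable_at e f : measurable_fun setT f ->
  measurable (summable_at e f).
Proof.
move=> mf.
have mS : measurable_fun setT (fun x : V => \sum_(0 <= k <oo) `|f (x - e k)|%:E)%E.
  apply: (ge0_emeasurable_sum (P := xpredT)) => [k x _ _|k _].
    by rewrite lee_fin.
  apply/measurable_EFinP; apply: measurableT_comp => //.
  exact: measurable_shift_fun.
rewrite (_ : summable_at e f =
    setT `&` [set x : V | \sum_(0 <= k <oo) `|f (x - e k)|%:E < +oo]%E).
  exact: emeasurable_fun_infty_o.
by apply/seteqP; split => [x /abs_summableP|x [_ /abs_summableP]].
Qed.

Lemma period_sum_series e f x :
  series (fun k => \1_(summable_at e f) x * f (x - e k)) @ \oo --> period_sum e f x.
Proof.
rewrite /period_sum; apply: abs_summable_cvg.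
rewrite indicE; case: (boolP (x \in _)) => xS.
  under eq_fun do rewrite mul1r; exact: (set_mem xS).
apply: (@abs_summable_bound _ _ 0) => n.
by rewrite big1// => k _; rewrite mul0r normr0.
Qed.

Lemma period_sum_cvg e f x : summable_at e f x ->
  series (fun k => f (x - e k)) @ \oo --> period_sum e f x.
Proof.
move=> Sx; have := @period_sum_series e f x.
by rewrite indicE mem_set//; under eq_fun do rewrite mul1r.
Qed.

Lemma measurable_period_sum e f : measurable_fun setT f ->
  measurable_fun setT (period_sum e f).
Proof.
move=> mf; apply: (measurable_fun_cvg (h := fun n x =>
    series (fun k => \1_(summable_at e f) x * f (x - e k)) n)).
  move=> n; rewrite /series/=; apply: measurable_sum => k.
  apply: measurable_funM; last exact: measurable_shift_fun.
  by apply: measurable_indic; exact: measurable_summable_at.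
by move=> x _; exact: period_sum_series.
Qed.

Section duality.
Variables (e : nat -> V) (f h : V -> R) (M : R).
Hypotheses (fi : integ f) (mh : measurable_fun setT h).
Hypothesis hM : forall y n, \sum_(0 <= k < n) `|h (y + e k)| <= M.

Let mf : measurable_fun setT f := integ_measurable fi.

Let mhf k : measurable_fun setT (fun x : V => h x * f (x - e k)).
Proof. by apply: measurable_funM => //; exact: measurable_shift_fun. Qed.

Let hbound k y : `|h (y + e k)| <= M.
Proof.
apply: le_trans (hM y k.+1); rewrite big_nat_recr//= lerDr.
exact: sumr_ge0.
Qed.

Let ihf k : integ (fun y => f y * h (y + e k)).
Proof.
apply: (integ_bounded_mul fi (M := M)) => [|y]; last exact: hbound.
exact: measurable_shift_fun.
Qed.

Let ihf' k : integ (fun x => h x * f (x - e k)).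
Proof.
have := integ_shift (- e k) (ihf k).
by apply: eq_integrable => // x _; rewrite /= subrK mulrC.
Qed.

Let G (x : V) : \bar R := (\sum_(0 <= k <oo) `|h x * f (x - e k)|%:E)%E.

Let mG : measurable_fun setT G.
Proof.
apply: (ge0_emeasurable_sum (P := xpredT)) => [k x _ _|k _].
  by rewrite lee_fin.
by apply/measurable_EFinP; apply: measurableT_comp.
Qed.

(** Translating each term turns the integral of [G] into that of [|f|] times the series of the
    [|h (x + e k)|], which is at most [M]. *)
Let iG : leb.-integrable setT G.
Proof.
apply/integrableP; split => //.
have G0 x : (0 <= G x)%E by apply: nneseries_ge0 => k _ _; rewrite lee_fin.
under eq_integral do rewrite gee0_abs//.
rewrite integral_nneseries//; last first.
  by move=> n; apply/measurable_EFinP; apply: measurableT_comp.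
have -> : (\sum_(0 <= k <oo) \int[leb]_x `|h x * f (x - e k)|%:E)%E =
    (\sum_(0 <= k <oo) \int[leb]_x (`|f x| * `|h (x + e k)|)%:E)%E.
  apply: eq_eseriesr => k _.
  have := @ge0_integral_translate R d (- e k) setT
    (fun x => (`|f x| * `|h (x + e k)|)%:E) measurableT.
  rewrite preimage_setT => <-.
  - by apply: eq_integral => x _; rewrite subrK normrM mulrC.
  - apply/measurable_EFinP; apply: measurable_funM; apply: measurableT_comp => //.
    exact: measurable_shift_fun.
  - by move=> x _; rewrite lee_fin mulr_ge0.
rewrite -integral_nneseries//; last first.
  move=> k; apply/measurable_EFinP; apply: measurable_funM; apply: measurableT_comp => //.
  exact: measurable_shift_fun.
have /integrableP[_] := integrableZl measurableT M (integrable_abse fi).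
apply: le_lt_trans; apply: ge0_le_integral => //.
- by move=> x _; apply: nneseries_ge0 => k _ _; rewrite lee_fin mulr_ge0.
- apply: (ge0_emeasurable_sum (P := xpredT)) => [k x _ _|k _].
    by rewrite lee_fin mulr_ge0.
  apply/measurable_EFinP; apply: measurable_funM; apply: measurableT_comp => //.
  exact: measurable_shift_fun.
- apply: measurableT_comp => //; apply/measurable_EFinP.
  by apply: measurable_funM => //; exact: measurableT_comp.
- move=> x _.
  apply: lime_le.
    by apply: is_cvg_nneseries => k _ _; rewrite lee_fin mulr_ge0.
  apply: nearW => n; rewrite sumEFin lee_fin -mulr_sumr normrM normr_id mulrC.
  by rewrite ler_wpM2r// (le_trans (hM x n))// ler_norm.
Qed.

(** The integrable majorant [G] is finite almost everywhere, and where [h] is nonzero it can be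
    divided by [|h x|]. *)
Lemma ae_summable_at : {ae leb, forall x, h x != 0 -> summable_at e f x}.
Proof.
have := integrable_ae measurableT iG.
apply: filterS => x /(_ I) Gx hx; rewrite /summable_at/= abs_summableP.
have G0 : (0 <= G x)%E by apply: nneseries_ge0 => k _ _; rewrite lee_fin.
have : ((`|h x|^-1)%:E * G x < +oo)%E.
  by rewrite -(fineK Gx) -EFinM ltry.
rewrite /G -nneseriesZl//.
apply: le_lt_trans; rewrite le_eqVlt; apply/orP; left; apply/eqP.
apply: eq_eseriesr => k _; rewrite -EFinM normrM mulrA mulVf ?mul1r//.
by rewrite normr_eq0.
Qed.

Let H y := limn (series (fun k => h (y + e k))).

(** The finite sums agree by translation invariance; dominated convergence passes to the limit, with
    majorant [G] on one side and [M] times [|f|] on the other. *)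
Lemma period_sum_duality :
  [/\ integ (fun x => h x * period_sum e f x), integ (fun y => f y * H y) &
   Int (fun x => h x * period_sum e f x) = Int (fun y => f y * H y)].
Proof.
have cH y : series (fun k => h (y + e k)) @ \oo --> H y.
  by apply: abs_summable_cvg; apply: abs_summable_bound => n; exact: hM.
have mH : measurable_fun setT H.
  apply: (measurable_fun_cvg (h := fun n (y : V) =>
    series (fun k => h (y + e k)) n)); last by move=> y _; exact: cH.
  by move=> n; apply: measurable_sum => k; exact: measurable_shift_fun.
have HM y : `|H y| <= M.
  have cn : (fun n => `|series (fun k => h (y + e k)) n|) @ \oo --> `|H y|.
    by apply: cvg_norm; exact: cH.
  rewrite -(cvg_lim _ cn)//; apply: limr_le; first by apply/cvg_ex; exists `|H y|.
  by apply: nearW => n; rewrite (le_trans (ler_norm_sum _ _ _)).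
have ifH := integ_bounded_mul fi mH HM.
pose g n x := \sum_(0 <= k < n) h x * f (x - e k).
pose g' n y := \sum_(0 <= k < n) f y * h (y + e k).
have gg' n : (\int[leb]_x (g n x)%:E = \int[leb]_y (g' n y)%:E)%E.
  rewrite -!EFin_Int; [|exact: integ_sum..].
  rewrite !Int_sum//; congr EFin; apply: eq_bigr => k _.
  rewrite -(Int_shift (- e k) (ihf k)).
  by apply: eq_Rintegral => x _; rewrite subrK mulrC.
have [] := @dominated_convergence _ _ _ leb setT measurableT
  (fun n => EFin \o g n) (fun x => (h x * period_sum e f x)%:E) G.
- move=> n; apply/measurable_EFinP; apply: measurable_sum => k; exact: mhf.
- apply/measurable_EFinP; apply: measurable_funM => //.
  exact: measurable_period_sum.
- apply: filterS ae_summable_at => x Sx _; apply/cvg_EFinE.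
  have [hx|hx] := eqVneq (h x) 0.
    rewrite hx mul0r (_ : g^~ x = fun=> 0); first exact: cvg_cst.
    by apply/funext => n; rewrite /g hx big1// => k _; rewrite mul0r.
  rewrite (_ : g^~ x = fun n => h x * series (fun k => f (x - e k)) n).
    by apply: cvgMr; apply: period_sum_cvg; exact: Sx.
  by apply/funext => n; rewrite /g -mulr_sumr.
- exact: iG.
- apply: aeW => x n _ /=; rewrite /G.
  apply: (@le_trans _ _ (\sum_(0 <= k < n) `|h x * f (x - e k)|%:E)%E).
    by rewrite sumEFin lee_fin; exact: ler_norm_sum.
  by apply: nneseries_lim_ge => k _ _; rewrite lee_fin.
move=> ihp _ cvg1.
have [] := @dominated_convergence _ _ _ leb setT measurableT
  (fun n => EFin \o g' n) (fun x => (f x * H x)%:E) (fun x => M%:E * `|(f x)%:E|)%E.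
- move=> n; apply/measurable_EFinP; apply: measurable_sum => k.
  by apply: measurable_funM => //; exact: measurable_shift_fun.
- by apply/measurable_EFinP; exact: measurable_funM.
- apply: aeW => x _; apply/cvg_EFinE.
  rewrite (_ : g'^~ x = fun n => f x * series (fun k => h (x + e k)) n).
    by apply: cvgMr; exact: cH.
  by apply/funext => n; rewrite /g' -mulr_sumr.
- by apply: (integrableZl measurableT M); exact: integrable_abse.
- apply: aeW => x n _ /=; rewrite lee_fin /g' -mulr_sumr normrM mulrC.
  rewrite ler_wpM2r// (le_trans _ (hM x n))//; exact: ler_norm_sum.
move=> _ _ cvg2; split => //; congr fine.
suff seqE : (fun n => \int[leb]_x (EFin \o g n) x)%E =
            (fun n => \int[leb]_x (EFin \o g' n) x)%E.
  by move: cvg1; rewrite /mk_sequence seqE => cvg1; exact: (cvg_unique _ cvg1 cvg2).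
by apply/funext => n; exact: gg'.
Qed.

End duality.
End periodization.

(** * Test functions with prescribed periodizations *)

Section universal_weight.
Context (R : realType) (d : nat).
Local Notation V := 'rV[R]_d.
Local Notation leb := (lebesgue_rV R d).
Local Open Scope ereal_scope.
Implicit Types (B : 'M[R]_d) (e : nat -> V).

Lemma nneseries_single (u : nat -> \bar R) n :
  (forall k, 0 <= u k) -> (forall k, k != n -> u k = 0) ->
  \sum_(0 <= k <oo) u k = u n.
Proof.
move=> u0 un.
have un0 : u n = \sum_(0 <= k < n.+1) u k.
  rewrite big_nat_recr//= big_nat_cond big1 ?add0e// => k /andP[/andP[_ kn] _].
  by rewrite un// neq_ltn kn.
rewrite un0 (nneseries_split_cond 0%N n.+1)//.
by rewrite add0n eseries0 ?adde0// => k nk _; rewrite un// neq_ltn nk orbT.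
Qed.

Lemma nneseries_fdom B e (x : V) (g : V -> \bar R) : B \in unitmx ->
  injective e -> range e = lspan B -> (forall y, 0 <= g y) ->
  \sum_(0 <= k <oo) g (x + e k)%R * (\1_(fdom B) (x + e k)%R)%:E =
  g (fcoord B x *m B)%R.
Proof.
move=> uB inj_e re g0; have [n [xn nP]] := fdom_enum x uB inj_e re.
rewrite (nneseries_single (n := n)).
- by rewrite xn indicE mem_set ?mule1//; exact: fdom_fcoord.
- by move=> k; rewrite mule_ge0// lee_fin.
- move=> k kn; rewrite indicE memNset ?mule0//.
  by move=> /nP kn'; rewrite kn' eqxx in kn.
Qed.

Lemma nneseries_fdom1 B e (x : V) : B \in unitmx ->
  injective e -> range e = lspan B ->
  \sum_(0 <= k <oo) (\1_(fdom B) (x + e k)%R)%:E = 1 :> \bar R.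
Proof.
move=> uB inj_e re.
rewrite -[RHS](@nneseries_fdom B e x (cst 1))//.
by apply: eq_eseriesr => k _; rewrite mul1e.
Qed.

Lemma enum_opp B e : injective e -> range e = lspan B ->
  injective (fun k => - e k)%R /\ range (fun k => - e k)%R = lspan B.
Proof.
move=> inj_e re; split; first by move=> k l /oppr_inj /inj_e.
apply/seteqP; split => [_ [k _ <-]|y /lspanN]; first by apply: lspanN; rewrite -re; exists k.
by rewrite -re => -[k _ ek]; exists k => //; rewrite ek opprK.
Qed.

Lemma lebesgue_indic D : measurable D -> \int[leb]_x (\1_D x)%:E = leb D.
Proof. by move=> mD; rewrite integral_indic// setIT. Qed.

(** Countably many translates of the cell cover space, which is not null. *)
Lemma fdom_gt0 B e : B \in unitmx -> injective e -> range e = lspan B ->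
  0 < leb (fdom B).
Proof.
move=> uB inj_e re; rewrite lt0e measure_ge0 andbT; apply/eqP => D0.
have := lebesgue_rV_setT R d; rewrite lt_neqAle => /andP[/eqP + _]; apply.
rewrite -(lebesgue_indic measurableT).
transitivity (\int[leb]_x \sum_(0 <= k <oo) (\1_(fdom B) (x + e k)%R)%:E : \bar R); last first.
  by apply: eq_integral => x _; rewrite nneseries_fdom1// indicT.
have mf k : measurable_fun setT (fun x : V => (\1_(fdom B) (x + e k)%R)%:E : \bar R).
  apply/measurable_EFinP; apply: measurable_shift_fun.
  by apply: measurable_indic; exact: measurable_fdom.
rewrite integral_nneseries//.
rewrite eseries0// => k _ _.
have := @ge0_integral_translate R d (e k) setT (fun x => (\1_(fdom B) x)%:E) measurableT.
rewrite preimage_setT => ->//; last first.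
  by apply/measurable_EFinP; apply: measurable_indic; exact: measurable_fdom.
by rewrite lebesgue_indic//; exact: measurable_fdom.
Qed.

(** [psi'] averages [psi] over the cell of [B0]. The translates of that cell partition space, so the
    sums of [psi'] over the new lattice equal the integral of [psi]; sums of [psi] that were already
    constant are merely multiplied by the volume of the cell. *)
Lemma weight_step (psi : V -> R) B0 e0 : B0 \in unitmx -> injective e0 ->
  range e0 = lspan B0 ->
  measurable_fun setT psi -> (forall x, (0 <= psi x)%R) ->
  0 < \int[leb]_x (psi x)%:E < +oo ->
  exists psi' : V -> R, [/\ measurable_fun setT psi', (forall x, (0 <= psi' x)%R),
    0 < \int[leb]_x (psi' x)%:E < +oo,
    (exists2 c, (0 < c)%R & forall x,
       \sum_(0 <= i <oo) (psi' (x + e0 i)%R)%:E = c%:E) &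
    forall (e : nat -> V) c, (0 < c)%R ->
      (forall x, \sum_(0 <= i <oo) (psi (x + e i)%R)%:E = c%:E) ->
      exists2 c', (0 < c')%R & forall x,
        \sum_(0 <= i <oo) (psi' (x + e i)%R)%:E = c'%:E].
Proof.
move=> uB inj_e re mpsi psi0 /andP[Ipsi0 Ipsioo].
pose D := fdom B0; have mD : measurable D by exact: measurable_fdom.
have D0 : 0 < leb D by exact: fdom_gt0 inj_e re.
have Doo : leb D < +oo by exact: fdom_lty.
have Dfin : leb D \is a fin_num by rewrite ge0_fin_numE.
have Ifin : \int[leb]_x (psi x)%:E \is a fin_num by rewrite ge0_fin_numE// ltW.
pose F (p : V * V) : \bar R := (psi (p.1 + p.2)%R * \1_D p.2)%:E.
have F0 p : 0 <= F p by rewrite lee_fin mulr_ge0.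
have madd : measurable_fun [set: V * V] (fun p : V * V => p.1 + p.2)%R.
  apply: measurable_fun_rV => i.
  rewrite (_ : (fun _ => _) = (fun p : V * V => (p.1 ord0 i + p.2 ord0 i)%R)); last first.
    by apply/funext => p; rewrite mxE.
  by apply: measurable_funD; [exact: (measurableT_comp (measurable_coord i) measurable_fst)
    |exact: (measurableT_comp (measurable_coord i) measurable_snd)].
have mF : measurable_fun [set: V * V] F.
  apply/measurable_EFinP; apply: measurable_funM; first exact: measurableT_comp.
  by apply: measurableT_comp => //; exact: measurable_indic.
pose P x := \int[leb]_t F (x, t).
have mP : measurable_fun setT P by exact: measurable_fun_fubini_tonelli_F.
have P0 x : 0 <= P x by apply: integral_ge0.
have mF1 x : measurable_fun [set: V] (fun t => F (x, t)).
  exact: measurable_fun_pair2.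
have mshift (v : V) : measurable_fun setT (fun x : V => (psi (x + v)%R)%:E).
  by apply/measurable_EFinP; exact: measurable_shift_fun.
have Ishift (v : V) : \int[leb]_x (psi (x + v)%R)%:E = \int[leb]_x (psi x)%:E.
  have := @ge0_integral_translate R d v setT (fun x => (psi x)%:E) measurableT.
  rewrite preimage_setT => ->//; first exact/measurable_EFinP.
  by move=> x _; rewrite lee_fin.
have Poo x : P x < +oo.
  apply: le_lt_trans Ipsioo; rewrite -(Ishift x); apply: ge0_le_integral => //.
  move=> t _; rewrite lee_fin addrC indicE; case: (_ \in _); first by rewrite mulr1.
  by rewrite mulr0.
have mD1 (x y : V) : measurable_fun setT (fun s : V => \1_D (s - x - y)%R : R).
  rewrite (_ : (fun _ => _) = (fun s : V => \1_D (s + (- x - y))%R)).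
    by apply: measurable_shift_fun; exact: measurable_indic.
  by apply/funext => s; rewrite addrA.
have PE x : (fine (P x))%:E = P x by rewrite fineK// ge0_fin_numE.
exists (fine \o P); split.
- apply/measurable_EFinP; rewrite (_ : EFin \o _ = P)//.
  by apply/funext => x; exact: PE.
- by move=> x /=; rewrite fine_ge0.
- have -> : \int[leb]_x ((fine \o P) x)%:E = \int[leb]_x (psi x)%:E * leb D.
    under eq_integral do rewrite /= PE.
    rewrite (fubini_tonelli F)// -lebesgue_indic//.
    rewrite -ge0_integralZl//; last 2 first.
      by apply/measurable_EFinP; exact: measurable_indic.
      exact: ltW.
    apply: eq_integral => t _; rewrite /F/=.
    under eq_integral do rewrite mulrC EFinM.
    rewrite ge0_integralZl//; last by move=> x _; rewrite lee_fin.
    by rewrite Ishift muleC.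
  by rewrite mule_gt0//= lte_mul_pinfty// ltW.
- exists (fine (\int[leb]_x (psi x)%:E)); first by rewrite fine_gt0// Ipsi0.
  move=> x; rewrite fineK//; under eq_eseriesr do rewrite /= PE.
  have [inj_e' re'] := enum_opp inj_e re.
  (* The substitution s = t + x + e0 i moves the index from [psi] to the indicator of the cell,
     whose series is 1. *)
  transitivity (\sum_(0 <= i <oo)
      \int[leb]_s ((psi s) * \1_D (s - x - e0 i))%:E : \bar R).
    apply: eq_eseriesr => i _; rewrite /P.
    have := @ge0_integral_translate R d (x + e0 i)%R setT
      (fun s => (psi s * \1_D (s - x - e0 i))%:E) measurableT.
    rewrite preimage_setT => <-.
    + apply: eq_integral => t _; rewrite /F/= (_ : t + (x + e0 i) - x - e0 i = t)%R.
        by rewrite addrC.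
      by rewrite -addrA -opprD addrK.
    + apply/measurable_EFinP; apply: measurable_funM => //.
    + by move=> s _; rewrite lee_fin mulr_ge0.
  rewrite -integral_nneseries; last first.
    by move=> i s _; rewrite lee_fin mulr_ge0.
    by move=> i; apply/measurable_EFinP; apply: measurable_funM => //; exact: mD1.
    exact: measurableT.
  apply: eq_integral => s _.
  under eq_eseriesr do rewrite EFinM.
  rewrite nneseriesZl//.
  by rewrite (nneseries_fdom1 (s - x)%R uB inj_e' re') mule1.
- move=> e c c0 ec; exists (c * fine (leb D))%R.
    by rewrite mulr_gt0// fine_gt0// D0.
  move=> x; under eq_eseriesr do rewrite /= PE.
  rewrite -integral_nneseries//.
  transitivity (\int[leb]_t (c%:E * (\1_D t)%:E)); last first.
    rewrite ge0_integralZl//.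
    + by rewrite lebesgue_indic// EFinM fineK.
    + by apply/measurable_EFinP; exact: measurable_indic.
    + by rewrite lee_fin ltW.
  apply: eq_integral => t _; rewrite /F/=.
  under eq_eseriesr do rewrite mulrC EFinM addrAC.
  by rewrite nneseriesZl ?ec 1?muleC// => i _; rewrite lee_fin.
Qed.

End universal_weight.

(** * Trigonometry with angles measured in turns *)

Section turns.
Variable R : realType.
Implicit Types s t : R.

Definition cosT t : R := cos (pi *+ 2 * t).

Definition sinT t : R := sin (pi *+ 2 * t).

Lemma cosTDn t (k : nat) : cosT (t + k%:R) = cosT t.
Proof. by rewrite /cosT mulrDr mulr_natr periodicn//; exact: cosD2pi. Qed.

Lemma cosTDz t (m : int) : cosT (t + m%:~R) = cosT t.
Proof.
case: m => k; first exact: cosTDn.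
by rewrite NegzE mulrNz -[LHS](cosTDn _ k.+1) -pmulrn subrK.
Qed.

Lemma cosTD s t : cosT (s + t) = cosT s * cosT t - sinT s * sinT t.
Proof. by rewrite /cosT mulrDr cosD. Qed.

Lemma sinTD s t : sinT (s + t) = sinT s * cosT t + cosT s * sinT t.
Proof. by rewrite /sinT mulrDr sinD. Qed.

Lemma cosT_quarter t : cosT (t - 4^-1) = sinT t.
Proof.
rewrite /cosT mulrBr (_ : pi *+ 2 / 4 = pi / 2) ?cosBpihalf//.
by rewrite -mulr_natr; field.
Qed.

(** The sine from the sum-to-product formula is written as a cosine shifted by a quarter turn, so
    that a difference of waves is again a multiple of a wave. *)
Lemma cosT_diff s t : cosT (t + s) - cosT t =
  - 2 * sin (pi * s) * cosT (t + s / 2 - 4^-1).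
Proof.
rewrite cosT_quarter /cosT /sinT.
set a := pi *+ 2 * (t + s / 2); set b := pi * s.
have -> : pi *+ 2 * (t + s) = a + b by rewrite /a /b -mulr_natr; field.
have -> : pi *+ 2 * t = a - b by rewrite /a /b -mulr_natr; field.
by rewrite cosD cosB; ring.
Qed.

Lemma norm_cosT t : `|cosT t| <= 1.
Proof. exact: cos_max. Qed.

Lemma sin_pi_neq0 t : t \isn't a Num.int -> sin (pi * t) != 0.
Proof.
move=> tN; apply: contraNneq tN => st0.
have /andP[f0 f1] := fracr_itv t.
have tE : t = fracr t + (Num.floor t)%:~R by rewrite /fracr subrK.
have : sin (pi * fracr t) = 0.
  rewrite /fracr mulrBr sinB st0 mul0r sub0r.
  suff -> : sin (pi * (Num.floor t)%:~R) = 0 :> R by rewrite mulr0 oppr0.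
  have nat_case (k : nat) : sin (pi * k%:R) = 0 :> R.
    by rewrite mulr_natr -[X in sin X]add0r alternatingn ?sin0 ?mulr0//; exact: sinDpi.
  case: (Num.floor t) => k; first exact: nat_case.
  by rewrite NegzE mulrNz mulrN sinN -pmulrn nat_case oppr0.
have [f00 _|fN0] := eqVneq (fracr t) 0; first by rewrite tE f00 add0r; exact: intr_int.
have fpos : 0 < fracr t by rewrite lt_neqAle eq_sym fN0.
move=> sf; have := @sin_gt0_pi R (pi * fracr t).
by rewrite sf ltxx mulr_gt0 ?pi_gt0// gtr_pMr ?pi_gt0// f1 => /(_ isT).
Qed.

Lemma measurable_cosT : measurable_fun setT cosT.
Proof.
apply: measurableT_comp; last exact: mulrl_measurable.
by apply: continuous_measurable_fun; exact: continuous_cos.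
Qed.

End turns.

Section dot_product.
Context (R : realType) (d : nat).
Implicit Types x y v : 'rV[R]_d.

Definition dot x y : R := (x *m y^T) ord0 ord0.

Lemma dotDl x y v : dot (x + y) v = dot x v + dot y v.
Proof. by rewrite /dot mulmxDl mxE. Qed.

Lemma dotZl (a : R) x v : dot (a *: x) v = a * dot x v.
Proof. by rewrite /dot -scalemxAl mxE. Qed.

Lemma dot0r x : dot x 0 = 0.
Proof. by rewrite /dot trmx0 mulmx0 mxE. Qed.

Lemma dotxx_gt0 x : x != 0 -> 0 < dot x x.
Proof.
move=> x0; rewrite /dot mxE.
have [j xj] : exists j, x ord0 j != 0.
  apply/existsP; move: x0; apply: contraNT; rewrite negb_exists => /forallP h.
  by apply/eqP/rowP => i; rewrite mxE; have := h i; rewrite negbK => /eqP.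
rewrite (bigD1 j)//= mxE ltr_pwDl//; first by rewrite lt0r sqr_ge0 mulf_neq0.
by apply: sumr_ge0 => i _; rewrite mxE -expr2 sqr_ge0.
Qed.

Lemma measurable_dot v : measurable_fun setT (dot ^~ v).
Proof.
apply: (measurableT_comp (measurable_coord ord0)).
exact: measurable_mulmx_rV.
Qed.

(** The free phase replaces complex exponentials: 0 and -1/4 give the cosine and the sine of the
    same frequency. *)
Definition wave (xi : 'rV[R]_d) (theta : R) (x : 'rV[R]_d) : R :=
  cosT (dot x xi + theta).

Lemma measurable_wave xi theta : measurable_fun setT (wave xi theta).
Proof.
apply: measurableT_comp; first exact: measurable_cosT.
by apply: measurable_funD => //; exact: measurable_dot.
Qed.

Lemma waveD xi theta x v : wave xi theta (x + v) = wave xi (theta + dot v xi) x.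
Proof. by rewrite /wave dotDl -addrA [dot v xi + _]addrC. Qed.

Definition dual_mem (B : 'M[R]_d) (xi : 'rV[R]_d) :=
  forall l, lspan B l -> dot l xi \is a Num.int.

Lemma waveD_dual B xi theta x l : dual_mem B xi -> lspan B l ->
  wave xi theta (x + l) = wave xi theta x.
Proof.
move=> Bxi /Bxi /intrP[m lE].
by rewrite waveD lE /wave addrA cosTDz.
Qed.

End dot_product.

(** * Test functions from a universal weight and finite differences *)

Section test_functions.
Context (R : realType) (d : nat).
Local Notation V := 'rV[R]_d.
Local Notation leb := (lebesgue_rV R d).
Local Notation integ g := (leb.-integrable setT (EFin \o g)).
Local Notation Int g := (Rintegral leb setT g).
Variables (n : nat) (B : 'I_n -> 'M[R]_d) (e : 'I_n -> nat -> V).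
Hypothesis d0 : (0 < d)%N.
Hypothesis uB : forall k, B k \in unitmx.
Hypothesis inj_e : forall k, injective (e k).
Hypothesis re : forall k, range (e k) = lspan (B k).

(** Starting from the indicator of the unit cube, [weight_step] treats one lattice after another.
    Integration over a cell shows that [c k] is [Int psi] divided by the volume of the cell of
    [B k]: the [c k] are the densities up to a common factor. *)
Lemma universal_weight : exists (psi : V -> R) (c : 'I_n -> R),
  [/\ measurable_fun setT psi, (forall x, 0 <= psi x), integ psi, 0 < Int psi &
   forall k, 0 < c k /\
     forall x, series (fun i => psi (x + e k i)) @ \oo --> c k].
Proof.
suff /(_ n (leqnn n))[psi [mpsi psi0 /andP[Ipsi0 Ipsioo] psic]] :
    forall m, (m <= n)%N -> exists psi : V -> R,
    [/\ measurable_fun setT psi, (forall x, 0 <= psi x),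
    (0 < \int[leb]_x (psi x)%:E < +oo)%E &
    forall k : 'I_n, (k < m)%N -> exists2 c, 0 < c & forall x,
      (\sum_(0 <= i <oo) (psi (x + e k i))%:E = c%:E)%E].
  have /choice[c cP] : forall k, exists c, 0 < c /\ forall x,
      (\sum_(0 <= i <oo) (psi (x + e k i))%:E = c%:E)%E.
    by move=> k; have [c c0 cE] := psic k (ltn_ord k); exists c.
  exists psi, c; split => //.
  - apply/integrableP; split; first exact/measurable_EFinP.
    by under eq_integral do rewrite /= ger0_norm//.
  - by rewrite /Rintegral fine_gt0// Ipsi0.
  - move=> k; have [ck0 ckE] := cP k; split => // x.
    by apply/cvg_nneseriesE => // i; exact: psi0.
elim=> [_|m IH mn].
  have u1 : (1%:M : 'M[R]_d) \in unitmx by exact: unitmx1.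
  have [e0 [inj_e0 re0]] := lspan_enum d0 u1.
  exists (\1_(fdom 1%:M)); split => //.
  - by apply: measurable_indic; exact: measurable_fdom.
  - rewrite lebesgue_indic; last exact: measurable_fdom.
    by rewrite (fdom_gt0 u1 inj_e0 re0) fdom_lty.
have [psi [mpsi psi0 Ipsi psic]] := IH (ltnW mn).
have [psi' [mpsi' psi'0 Ipsi' new old]] :=
  weight_step (uB (Ordinal mn)) (inj_e (k := Ordinal mn)) (re (Ordinal mn)) mpsi psi0 Ipsi.
exists psi'; split => // k; rewrite ltnS leq_eqVlt => /predU1P[km|km].
  by rewrite (_ : k = Ordinal mn)//; exact: val_inj.
by have [c c0 cE] := psic _ km; exact: old c0 cE.
Qed.

Variables (psi : V -> R) (c : 'I_n -> R).
Hypothesis mpsi : measurable_fun setT psi.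
Hypothesis psi0 : forall x, 0 <= psi x.
Hypothesis ipsi : integ psi.
Hypothesis psi_cvg : forall k x, series (fun i => psi (x + e k i)) @ \oo --> c k.

(* On the union of the dual lattices of the k in P, or with xi in the dual, the
   Fourier transform of h vanishes except possibly at xi and - xi. *)
Definition test_fun (kappa : R) xi theta (P : 'I_n -> Prop) (h : V -> R) :=
  [/\ measurable_fun setT h, integ h,
   forall k, exists M, forall y N, \sum_(0 <= i < N) `|h (y + e k i)| <= M,
   forall k, dual_mem (B k) xi -> forall y,
     series (fun i => h (y + e k i)) @ \oo --> kappa * c k * wave xi theta y &
   forall k, P k -> forall y, series (fun i => h (y + e k i)) @ \oo --> (0 : R)].

Lemma psi_bound k y N : \sum_(0 <= i < N) psi (y + e k i) <= c k.
Proof.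
have := @psi_cvg k y; move=> cv.
rewrite -(cvg_lim _ cv)//.
apply: (@nondecreasing_cvgn_le _ (series (fun i => psi (y + e k i)))).
  by apply: nondecreasing_series => i _ _.
by apply/cvg_ex; exists (c k).
Qed.

Lemma test_fun_base xi theta :
  test_fun 1 xi theta (fun=> False) (fun x => psi x * wave xi theta x).
Proof.
have mw := measurable_wave xi theta.
split => //.
- exact: measurable_funM.
- by apply: (integ_bounded_mul ipsi (M := 1)) => // x; exact: norm_cosT.
- move=> k; exists (c k) => y N; apply: le_trans (psi_bound k y N).
  apply: ler_sum => i _; rewrite normrM ger0_norm// ler_piMr//.
  exact: norm_cosT.
- move=> k xik y; rewrite mul1r mulrC.
  rewrite (_ : series _ = (fun N => wave xi theta y * series (fun i => psi (y + e k i)) N)).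
    by apply: cvgMr; exact: psi_cvg.
  apply/funext => N; rewrite /series/= mulr_sumr; apply: eq_bigr => i _.
  by rewrite mulrC (waveD_dual _ _ xik)// -re; exists i.
Qed.

(** If [v] belongs to a lattice, translation by [v] only permutes the terms of the sum over it, so
    the difference sums to 0. On waves the difference is [cosT_diff]; the phase assumed for [h] is
    chosen so that the result has phase [theta]. *)
Lemma test_fun_diff kappa xi theta (P Q : 'I_n -> Prop) v h :
  test_fun kappa xi (theta - dot v xi / 2 + 4^-1) P h ->
  (forall k, Q k -> P k \/ lspan (B k) v) ->
  test_fun (kappa * (- 2 * sin (pi * dot v xi))) xi theta Q
    (fun x => h (x + v) - h x) /\ Int (fun x => h (x + v) - h x) = 0.
Proof.
move=> [mh ih bh gh kh] QP.
have ihv := integ_shift v ih.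
have ihN : integ (fun x => - h x).
  have -> : (fun x => - h x) = (fun x => -1 * h x) by apply/funext => x; rewrite mulN1r.
  exact: integ_scale.
have Eser k y : series (fun i => h (y + e k i + v) - h (y + e k i)) =
    (fun N => series (fun i => h (y + v + e k i)) N - series (fun i => h (y + e k i)) N).
  apply/funext => N; rewrite /series/= -sumrB; apply: eq_bigr => i _.
  by rewrite addrAC.
split; last first.
  rewrite Int_add// Int_shift//.
  have -> : Int (fun x => - h x) = - Int h.
    rewrite -mulN1r -Int_scale//; apply: eq_Rintegral => x _.
    by rewrite mulN1r.
  by rewrite subrr.
split.
- by apply: measurable_funB => //; exact: measurable_shift_fun.
- exact: integ_add.
- move=> k; have [M hM] := bh k; exists (M + M) => y N.
  apply: le_trans (lerD (hM (y + v) N) (hM y N)); rewrite -big_split/=.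
  apply: ler_sum => i _; rewrite [y + v + _]addrAC; exact: ler_normB.
- move=> k xik y; rewrite Eser.
  rewrite (_ : _ * wave _ _ _ = kappa * c k * wave xi (theta - dot v xi / 2 + 4^-1) (y + v) -
      kappa * c k * wave xi (theta - dot v xi / 2 + 4^-1) y).
    by apply: cvgB; exact: gh.
  rewrite -mulrBr waveD /wave [theta - _ / 2 + _ + _]addrC.
  rewrite (_ : dot y xi + (dot v xi + _) =
    dot y xi + (theta - dot v xi / 2 + 4^-1) + dot v xi); last by ring.
  rewrite cosT_diff (_ : _ + dot v xi / 2 - 4^-1 = dot y xi + theta); last by ring.
  by ring.
- move=> k /QP[Pk|vk] y; rewrite Eser.
    by rewrite -[X in _ --> X](subrr (0 : R)); apply: cvgB; exact: kh.
  have [M hM] := bh k.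
  have sh : abs_summable ((fun z => h (y + z)) \o e k).
    by apply: (@abs_summable_bound _ _ M) => N; exact: hM.
  pose e' i := v + e k i.
  have inj_e' : injective e' by move=> i j /addrI; exact: inj_e.
  have re' : range e' = range (e k).
    rewrite re; apply/seteqP; split => [_ [i _ <-]|l lk].
      by apply: lspanD => //; rewrite -re; exists i.
    have : lspan (B k) (l - v) by apply: lspanD => //; exact: lspanN.
    by rewrite -re => -[i _ ei]; exists i => //; rewrite /e' ei addrC subrK.
  have sh' := abs_summable_reindex (inj_e (k := k)) inj_e'.
  have := limn_series_reindex (inj_e (k := k)) inj_e' re' sh.
  have {}sh' : abs_summable ((fun z => h (y + z)) \o e') by apply: sh' => //; rewrite re'.
  have c1 := abs_summable_cvg sh; have c2 := abs_summable_cvg sh'.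
  move=> lE; rewrite -[X in _ --> X](subrr (limn (series ((fun z => h (y + z)) \o e k)))).
  apply: cvgB => //; rewrite -lE.
  by under eq_fun do rewrite -addrA; exact: c2.
Qed.

(** A lattice whose dual misses [xi] has a vector pairing with [xi] to a non-integer: the difference
    along it kills the sums over this lattice, at the cost of a nonzero sine. Every difference
    shifts the phase, hence the induction over all [theta]. *)
Lemma test_fun_exists xi : xi != 0 -> exists2 kappa, kappa != 0 &
  forall theta, exists2 h, test_fun kappa xi theta (fun k => ~ dual_mem (B k) xi) h &
    Int h = 0.
Proof.
move=> xi0.
suff /(_ n (leqnn n))[kappa kappa0 kP] : forall m, (m <= n)%N ->
    exists2 kappa, kappa != 0 & forall theta, exists h,
    test_fun kappa xi theta (fun k => (k < m)%N /\ ~ dual_mem (B k) xi) h.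
  have u0 : dot xi xi != 0 by rewrite gt_eqF// dotxx_gt0.
  (* A last difference, along a vector pairing with [xi] to 1/2, gives integral 0; the factor is -2
     sin(pi/2) = -2. *)
  pose u := (2 * dot xi xi)^-1 *: xi.
  have ux : dot u xi = 2^-1 by rewrite dotZl; field.
  exists (kappa * (- 2 * sin (pi * dot u xi))).
    rewrite ux sin_pihalf mulr1 mulf_neq0// oppr_eq0 pnatr_eq0//.
  move=> theta; have [h hP] := kP (theta - dot u xi / 2 + 4^-1).
  have [] := @test_fun_diff _ _ _ _ (fun k => ~ dual_mem (B k) xi) u h hP.
    by move=> k; left; split.
  by exists (fun x => h (x + u) - h x).
elim=> [_|m IH mn].
  exists 1; first exact: oner_neq0.
  move=> theta; have [h1 h2 h3 h4 h5] := test_fun_base xi theta.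
  by exists (fun x => psi x * wave xi theta x); split => // k [].
have [kappa kappa0 kP] := IH (ltnW mn).
pose k0 := Ordinal mn.
have [g0|b0] := pselect (dual_mem (B k0) xi).
  exists kappa => // theta; have [h [h1 h2 h3 h4 h5]] := kP theta.
  exists h; split => // k [+ kb]; rewrite ltnS leq_eqVlt => /predU1P[km|km].
    by exfalso; apply: kb; rewrite (_ : k = k0)//; exact: val_inj.
  by apply: h5.
have [l lk lxi] : exists2 l, lspan (B k0) l & dot l xi \isn't a Num.int.
  apply: contrapT => h; apply: b0 => l ll; apply: contrapT => /negP ln.
  by apply: h; exists l.
exists (kappa * (- 2 * sin (pi * dot l xi))).
  by rewrite mulf_neq0// mulf_neq0// ?oppr_eq0 ?pnatr_eq0// sin_pi_neq0.
move=> theta; have [h hP] := kP (theta - dot l xi / 2 + 4^-1).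
exists (fun x => h (x + l) - h x).
apply: (@test_fun_diff _ _ _ _ _ l h hP _).1 => k [+ kb].
rewrite ltnS leq_eqVlt => /predU1P[km|km]; last by left.
by right; rewrite (_ : k = k0)//; exact: val_inj.
Qed.

End test_functions.

(** * The spectral equations of a tiling *)

Section tiling_spectrum.
Context (R : realType) (d : nat).
Local Notation V := 'rV[R]_d.
Local Notation leb := (lebesgue_rV R d).
Local Notation integ g := (leb.-integrable setT (EFin \o g)).
Local Notation Int g := (Rintegral leb setT g).
Variables (n : nat) (e : 'I_n -> nat -> V) (z : 'I_n -> V).
Variables (f : V -> R) (w : R).
Hypothesis fi : integ f.
Hypothesis fw : {ae leb, forall x, \sum_(k < n) period_sum (e k) f (x - z k) = w}.

Lemma tiling_duality (h : V -> R) : measurable_fun setT h -> integ h ->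
  (forall k, exists M, forall y N, \sum_(0 <= i < N) `|h (y + e k i)| <= M) ->
  w * Int h = \sum_(k < n)
    Int (fun y => f y * limn (series (fun i => h (y + z k + e k i)))).
Proof.
move=> mh ih bh; have mf := integ_measurable fi.
pose g k x := h (x + z k) * period_sum (e k) f x.
have gP k : integ (g k) /\ Int (g k) =
    Int (fun y => f y * limn (series (fun i => h (y + z k + e k i)))).
  have [M hM] := bh k.
  have [] := @period_sum_duality R d (e k) f (fun x => h (x + z k)) M fi.
  - exact: measurable_shift_fun.
  - by move=> y N; under eq_bigr do rewrite addrAC; exact: hM.
  move=> ig _ Ig; split => //; rewrite Ig; apply: eq_Rintegral => y _.
  congr (_ * _); congr (limn (series _)); apply/funext => i.
  by rewrite addrAC.
have igs k : integ (fun x => g k (x - z k)) by apply: integ_shift; exact: (gP k).1.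
have gE k : Int (fun y => f y * limn (series (fun i => h (y + z k + e k i)))) =
    Int (fun x => g k (x - z k)).
  by rewrite -(gP k).2 -(Int_shift (- z k) (gP k).1).
rewrite -Int_scale// (eq_bigr _ (fun k _ => gE k)).
rewrite -Int_sum//; congr fine; apply: ae_eq_integral => //.
- by apply/measurable_EFinP; exact: measurable_funM.
- by have /integrableP[] := integ_sum (index_enum 'I_n) igs.
- apply: filterS fw => x fx _; congr EFin; rewrite -fx mulr_suml.
  by apply: eq_bigr => k _; rewrite /g subrK mulrC.
Qed.

Variables (B : 'I_n -> 'M[R]_d) (psi : V -> R) (c : 'I_n -> R).
Hypothesis d0 : (0 < d)%N.
Hypothesis uB : forall k, B k \in unitmx.
Hypothesis inj_e : forall k, injective (e k).
Hypothesis re : forall k, range (e k) = lspan (B k).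
Hypothesis mpsi : measurable_fun setT psi.
Hypothesis psi0 : forall x, 0 <= psi x.
Hypothesis ipsi : integ psi.
Hypothesis psi_cvg : forall k x, series (fun i => psi (x + e k i)) @ \oo --> c k.

(** The zero frequency: [psi] itself is the test function, and its integral does not vanish. *)
Lemma tiling_mean : w * Int psi = (\sum_k c k) * Int f.
Proof.
rewrite tiling_duality//; last first.
  move=> k; exists (c k) => y N.
  by under eq_bigr do rewrite ger0_norm//; exact: (psi_bound psi0 psi_cvg).
rewrite mulr_suml; apply: eq_bigr => k _; rewrite -Int_scale//.
apply: eq_Rintegral => y _; rewrite mulrC; congr (_ * _).
by apply/cvg_lim => //; exact: psi_cvg.
Qed.

(** For fixed [theta] this is one real component of the product of the exponential sum and the
    Fourier integral of [f] at [xi]; varying [theta] gives the whole complex equation. *)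
Lemma tiling_spectrum xi theta : xi != 0 ->
  \sum_(k | `[< dual_mem (B k) xi >])
     c k * Int (fun y => f y * wave xi (theta + dot (z k) xi) y) = 0.
Proof.
move=> xi0; have [kappa kappa0 kP] :=
  test_fun_exists inj_e re mpsi psi0 ipsi psi_cvg xi0.
have [h [mh ih bh gh kh] Ih0] := kP theta.
have := tiling_duality mh ih bh; rewrite Ih0 mulr0 => /esym hsum.
apply: (mulfI kappa0); rewrite mulr0 -[RHS]hsum mulr_sumr big_mkcond/=.
apply: eq_bigr => k _; case: asboolP => xik.
  rewrite mulrA -Int_scale; last first.
    apply: (integ_bounded_mul fi (M := 1)); first exact: measurable_wave.
    by move=> x; exact: norm_cosT.
  apply: eq_Rintegral => y _.
  rewrite (cvg_lim _ (gh k xik (y + z k)))// waveD.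
  by rewrite mulrCA.
apply/esym; rewrite (_ : (fun _ => _) = fun=> 0); first by rewrite /Rintegral integral0.
by apply/funext => y; rewrite (cvg_lim _ (kh k xik (y + z k)))// mulr0.
Qed.

End tiling_spectrum.

(** * Uniqueness of Fourier coefficients on a lattice tile *)

Section power_threshold.
Variable R : realType.
Implicit Types q r s t : R.

Lemma bernoulli_ineq t (M : nat) : -1 <= t -> 1 + M%:R * t <= (1 + t) ^+ M.
Proof.
move=> t1; have t0 : 0 <= 1 + t by rewrite addrC -lerBlDr sub0r.
elim: M => [|M IH]; first by rewrite mul0r addr0 expr0.
rewrite exprS; apply: (@le_trans _ _ ((1 + t) * (1 + M%:R * t))); last exact: ler_wpM2l.
rewrite -subr_ge0 -natr1.
have -> : (1 + t) * (1 + M%:R * t) - (1 + (M%:R + 1) * t) = M%:R * t ^+ 2 by ring.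
by rewrite mulr_ge0// sqr_ge0.
Qed.

(** With r = s^2, the product n s^n is below the geometric sum, hence bounded, and the remaining
    factor s^n tends to 0. *)
Lemma cvg_mulrn_geometric r : 0 <= r < 1 ->
  (fun n => n%:R * r ^+ n) @ \oo --> (0 : R).
Proof.
move=> /andP[r0 r1]; pose s := Num.sqrt r.
have s0 : 0 <= s by exact: sqrtr_ge0.
have s1 : s < 1 by rewrite -sqrtr1 ltr_sqrt.
have bnd n : n%:R * s ^+ n <= (1 - s)^-1.
  rewrite -[leRHS]mul1r ler_pdivlMr ?subr_gt0//.
  apply: (@le_trans _ _ (1 - s ^+ n)); last by rewrite gerBl exprn_ge0.
  have -> : 1 - s ^+ n = (1 - s) * \sum_(i < n) s ^+ i.
    by rewrite -[LHS]opprB subrX1 -mulNr opprB.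
  rewrite mulrC ler_wpM2l ?subr_ge0 ?(ltW s1)//.
  have -> : n%:R * s ^+ n = \sum_(i < n) s ^+ n.
    by rewrite sumr_const card_ord mulr_natl.
  by apply: ler_sum => i _; apply: ler_wiXn2l => //; [exact: ltW|exact: ltnW].
have sr n : r ^+ n = s ^+ n * s ^+ n by rewrite -exprMn -expr2 sqr_sqrtr.
apply: (@squeeze_cvgr _ _ _ _ (fun=> 0) (geometric (1 - s)^-1 s)).
- apply: nearW => n; rewrite mulr_ge0 ?exprn_ge0//= sr mulrA.
  by rewrite ler_wpM2r ?exprn_ge0.
- exact: cvg_cst.
- by apply: cvg_geometric; rewrite ger0_norm.
Qed.

(** Polynomials in [q] that approach a step at 1/2 on [0, 1], as in elementary proofs of the
    Stone-Weierstrass theorem. Applied to a trigonometric polynomial they give trigonometric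
    polynomials approaching an indicator. *)
Definition power_step (q : R) (n : nat) : R := (1 - q ^+ n) ^+ (n * 2 ^ n).

Lemma power_step_itv q n : 0 <= q <= 1 -> 0 <= power_step q n <= 1.
Proof.
move=> /andP[q0 q1].
have t0 : 0 <= q ^+ n by exact: exprn_ge0.
have t1 : q ^+ n <= 1 by exact: exprn_ile1.
by rewrite exprn_ge0 ?subr_ge0//= exprn_ile1 ?subr_ge0// gerBl.
Qed.

(* With the exponent 2 ^ n the limit at q = 1/2 would be 1/e; the factor n
   makes it 0. *)
Lemma cvg_power_step q : 0 <= q <= 1 ->
  power_step q @ \oo --> ((q < 2^-1)%R%:R : R).
Proof.
move=> /andP[q0 q1].
have t0 n : 0 <= q ^+ n by exact: exprn_ge0.
have t1 n : q ^+ n <= 1 by exact: exprn_ile1.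
have ps n : 0 <= power_step q n <= 1 by apply: power_step_itv; rewrite q0.
have Mq n : (n * 2 ^ n)%:R * q ^+ n = n%:R * (2 * q) ^+ n.
  by rewrite natrM natrX exprMn mulrA.
have [qlt|qge] := ltP q 2^-1.
  apply: (@squeeze_cvgr _ _ _ _ (fun n => 1 - n%:R * (2 * q) ^+ n) (fun=> 1)).
  - apply: nearW => n; apply/andP; split.
      rewrite -Mq -mulrN; apply: bernoulli_ineq; by rewrite lerN2.
    by have /andP[] := ps n.
  - rewrite -[X in _ --> X]subr0; apply: cvgB; first exact: cvg_cst.
    by apply: cvg_mulrn_geometric; rewrite mulr_ge0//=; lra.
  - exact: cvg_cst.
apply: (@squeeze_cvgr _ _ _ _ (fun=> 0) harmonic).
- apply: nearW => n; apply/andP; split.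
    by have /andP[] := ps n.
  rewrite /= -[leRHS]mul1r ler_pdivlMr//.
  (* Multiplying by the same power of 1 + q^n gives a power of 1 - q^(2n), at most 1, whereas by
     Bernoulli that factor is at least 1 + n (2q)^n >= n + 1. *)
  apply: (@le_trans _ _ (power_step q n * (1 + q ^+ n) ^+ (n * 2 ^ n))).
    rewrite ler_wpM2l//; first by have /andP[] := ps n.
    apply: le_trans (bernoulli_ineq _ _); last by rewrite (le_trans _ (t0 n))// lerN10.
    rewrite Mq -natr1 addrC lerD2l ler_peMr// exprn_ege1//; lra.
  rewrite /power_step -exprMn exprn_ile1//.
    by rewrite mulr_ge0 ?subr_ge0// addr_ge0.
  rewrite (_ : _ * _ = 1 - (q ^+ n) ^+ 2); last by ring.
  by rewrite gerBl sqr_ge0.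
- exact: cvg_cst.
- exact: cvg_harmonic.
Qed.

End power_threshold.

(** * Arcs of the circle as superlevel sets of a cosine *)

Section arcs.
Variable R : realType.
Implicit Types a b l s t u v : R.

Lemma cosT_lt u v : 0 <= u <= 2^-1 -> 0 <= v <= 2^-1 -> (cosT u < cosT v) = (v < u).
Proof.
move=> /andP[u0 u1] /andP[v0 v1]; have p0 := pi_gt0 R.
have itv w : 0 <= w -> w <= 2^-1 -> pi *+ 2 * w \in `[0, (pi : R)].
  move=> w0 w1; have w1' : pi *+ 2 * w <= pi.
    by rewrite -mulr_natr -mulrA -[leRHS]mulr1 ler_pM2l//; lra.
  rewrite in_itv; apply/andP; split => //.
  by apply: mulr_ge0 => //; apply: mulrn_wge0; exact: ltW.
by rewrite /cosT ltr_cos ?itv// ltr_pM2l// pmulrn_lgt0.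
Qed.

Lemma cosTN t : cosT (- t) = cosT t.
Proof. by rewrite /cosT mulrN cosN. Qed.

(** The open arc from 0 to [l] is centred at l/2, and on the circle the cosine decreases with the
    distance to the centre. *)
Lemma cosT_arc l t : 0 < l < 1 ->
  (cosT (l / 2) < cosT (t - l / 2)) = (0 < fracr t < l).
Proof.
move=> /andP[l0 l1].
have -> : cosT (t - l / 2) = cosT (fracr t - l / 2).
  by rewrite -[RHS](cosTDz _ (Num.floor t)) /fracr; congr cosT; ring.
have /andP[s0 s1] := fracr_itv t; set s := fracr t in s0 s1 *.
have [sl|sl] := ltP s l.
  rewrite andbT.
  have [u0|u0] := leP 0 (s - l / 2).
    rewrite cosT_lt; [|apply/andP; split; lra..].
    by apply/idP/idP; lra.
  rewrite -[cosT (s - _)]cosTN cosT_lt; [|apply/andP; split; lra..].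
  by apply/idP/idP; lra.
rewrite andbF; have [u1|u1] := leP (s - l / 2) 2^-1.
  rewrite cosT_lt; [|apply/andP; split; lra..].
  by apply/negbTE; rewrite -leNgt; lra.
have -> : cosT (s - l / 2) = cosT (1 - (s - l / 2)).
  by rewrite -[RHS]cosTN opprB -[RHS](cosTDn _ 1%N); congr cosT; ring.
rewrite cosT_lt; [|apply/andP; split; lra..].
by apply/negbTE; rewrite -leNgt; lra.
Qed.

Lemma fracr_unique t s (m : int) : 0 <= s < 1 -> t = s + m%:~R -> fracr t = s.
Proof.
move=> /andP[s0 s1] tE.
rewrite /fracr (_ : Num.floor t = m); first by rewrite tE addrK.
by apply: floor_def; rewrite tE intrD; apply/andP; split; lra.
Qed.

(** Strict thresholds give open arcs, while the cell needs the half-open arc [0, a). After a shift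
    by [b] it is the difference of the open arcs (0, a + b) and (0, b); the value of [b] ensures b >
    0 and a + b < 1. *)
Lemma fracr_lt_arcs a t : 0 < a < 1 -> let b := (1 - a) / 2 in
  (fracr t < a)%R%:R =
  (0 < fracr (t + b) < a + b)%R%:R - (0 < fracr (t + b) < b)%R%:R :> R.
Proof.
move=> /andP[a0 a1] b; have b0 : 0 < b by rewrite /b; lra.
have ab : a + b < 1 by rewrite /b; lra.
have /andP[s0 s1] := fracr_itv t.
have tE : t = fracr t + (Num.floor t)%:~R by rewrite /fracr subrK.
have [sb|sb] := ltP (fracr t + b) 1.
  have -> : fracr (t + b) = fracr t + b.
    apply: (@fracr_unique _ _ (Num.floor t)); first by apply/andP; split; lra.
    by rewrite {1}tE addrAC.
  rewrite (_ : (fracr t + b < b) = false); last by apply/negbTE; rewrite -leNgt; lra.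
  by rewrite andbF subr0 (_ : 0 < fracr t + b) ?ltrD2r//; lra.
have -> : fracr (t + b) = fracr t + b - 1.
  apply: (@fracr_unique _ _ (Num.floor t + 1)); first by apply/andP; split; lra.
  by rewrite {1}tE intrD; ring.
rewrite (_ : (fracr t < a) = false); last by apply/negbTE; rewrite -leNgt; lra.
rewrite (_ : (_ < a + b) = true); last by lra.
rewrite (_ : (fracr t + b - 1 < b) = true); last by lra.
by rewrite subrr.
Qed.

End arcs.

(** * Trigonometric polynomials with frequencies in a dual lattice *)

Section trigonometric_polynomials.
Context (R : realType) (d : nat).
Local Notation V := 'rV[R]_d.
Local Notation leb := (lebesgue_rV R d).
Local Notation integ g := (leb.-integrable setT (EFin \o g)).
Local Notation Int g := (Rintegral leb setT g).
Variable B : 'M[R]_d.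
Implicit Types (xi : V) (p q : V -> R).

Lemma dotDr (x : V) xi xi' : dot x (xi + xi') = dot x xi + dot x xi'.
Proof. by rewrite /dot linearD mulmxDr mxE. Qed.

Lemma dotNr (x : V) xi : dot x (- xi) = - dot x xi.
Proof. by rewrite /dot linearN mulmxN mxE. Qed.

Lemma dual_memD xi xi' : dual_mem B xi -> dual_mem B xi' -> dual_mem B (xi + xi').
Proof. by move=> h h' l ll; rewrite dotDr rpredD ?h ?h'. Qed.

Lemma dual_memN xi : dual_mem B xi -> dual_mem B (- xi).
Proof. by move=> h l ll; rewrite dotNr rpredN h. Qed.

Lemma dual_mem0 : dual_mem B 0.
Proof. by move=> l ll; rewrite dot0r rpred0. Qed.

Inductive trig_poly : (V -> R) -> Prop :=
| trig_poly_wave xi theta : dual_mem B xi -> trig_poly (wave xi theta)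
| trig_poly_add p q : trig_poly p -> trig_poly q -> trig_poly (fun x => p x + q x)
| trig_poly_scale a p : trig_poly p -> trig_poly (fun x => a * p x).

Lemma wave00 : wave 0 0 = cst (1 : R) :> (V -> R).
Proof. by apply/funext => x; rewrite /wave dot0r addr0 /cosT mulr0 cos0. Qed.

Lemma trig_poly_cst (a : R) : trig_poly (cst a).
Proof.
rewrite (_ : cst a = fun x => a * wave 0 0 x); last first.
  by apply/funext => x; rewrite wave00 /cst mulr1.
by apply: trig_poly_scale; apply: trig_poly_wave; exact: dual_mem0.
Qed.

Lemma cosTM (s t : R) : cosT s * cosT t = 2^-1 * (cosT (s + t) + cosT (s + - t)).
Proof. by rewrite !cosTD cosTN /sinT mulrN sinN; field. Qed.

Lemma trig_poly_mul p q : trig_poly p -> trig_poly q -> trig_poly (fun x => p x * q x).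
Proof.
have ext p1 p2 : p1 =1 p2 -> trig_poly p1 -> trig_poly p2 by move=> /funext ->.
move=> tp tq; elim: tp => [xi theta xiB|p1 p2 _ h1 _ h2|a p1 _ h1]; last 2 first.
- by apply: ext (trig_poly_add h1 h2) => x; rewrite mulrDl.
- by apply: ext (trig_poly_scale a h1) => x; rewrite mulrA.
elim: tq => [xi' theta' xiB'|q1 q2 _ h1 _ h2|a q1 _ h1].
- apply: ext (trig_poly_scale 2^-1 (trig_poly_add
    (trig_poly_wave (theta + theta') (dual_memD xiB xiB'))
    (trig_poly_wave (theta - theta') (dual_memD xiB (dual_memN xiB'))))) => x.
  rewrite /wave cosTM !dotDr dotNr; congr (_ * (cosT _ + cosT _)); ring.
- by apply: ext (trig_poly_add h1 h2) => x; rewrite mulrDr.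
- by apply: ext (trig_poly_scale a h1) => x; rewrite mulrCA.
Qed.

Lemma trig_poly_exp p n : trig_poly p -> trig_poly (fun x => p x ^+ n).
Proof.
move=> tp; elim: n => [|n IH]; first exact: trig_poly_cst.
rewrite (_ : (fun _ => _) = fun x => p x * p x ^+ n); first exact: trig_poly_mul.
by apply/funext => x; rewrite exprS.
Qed.

Lemma trig_poly_affine (a b : R) p : trig_poly p -> trig_poly (fun x => a + b * p x).
Proof.
by move=> tp; exact: trig_poly_add (trig_poly_cst a) (trig_poly_scale b tp).
Qed.

Lemma trig_poly_power_step p n : trig_poly p ->
  trig_poly (fun x => power_step (p x) n).
Proof.
move=> tp; apply: trig_poly_exp.
rewrite (_ : (fun _ => _) = fun x => 1 + (-1) * p x ^+ n).
  by apply: trig_poly_affine; exact: trig_poly_exp.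
by apply/funext => x; rewrite mulN1r.
Qed.

Lemma trig_poly_prod n (p : 'I_n -> V -> R) : (forall i, trig_poly (p i)) ->
  trig_poly (fun x => \prod_(i < n) p i x).
Proof.
move=> tp; elim: n p tp => [|n IH] p tp.
  rewrite (_ : (fun _ => _) = cst 1); first exact: trig_poly_cst.
  by apply/funext => x; rewrite big_ord0.
rewrite (_ : (fun _ => _) = fun x => p ord0 x * \prod_(i < n) p (lift ord0 i) x).
  by apply: trig_poly_mul => //; exact: IH.
by apply/funext => x; rewrite big_ord_recl.
Qed.

Definition bounded_by (M : R) p := forall x, `|p x| <= M.

Lemma trig_poly_bounded p : trig_poly p ->
  measurable_fun setT p /\ exists M, bounded_by M p.
Proof.
elim=> [xi theta _|p1 p2 _ [m1 [M1 b1]] _ [m2 [M2 b2]]|a p1 _ [m1 [M1 b1]]].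
- by split; [exact: measurable_wave|exists 1 => x; exact: norm_cosT].
- split; first exact: measurable_funD.
  by exists (M1 + M2) => x; rewrite (le_trans (ler_normD _ _))// lerD.
- split; first exact: measurable_funM.
  by exists (`|a| * M1) => x; rewrite normrM ler_wpM2l.
Qed.

Lemma trig_poly_Int f p : integ f ->
  (forall xi theta, dual_mem B xi -> Int (fun x => f x * wave xi theta x) = 0) ->
  trig_poly p -> Int (fun x => f x * p x) = 0.
Proof.
move=> fi f0; have ifp q : trig_poly q -> integ (fun x => f x * q x).
  by move=> /trig_poly_bounded[mq [M qM]]; exact: integ_bounded_mul qM.
elim=> [xi theta xiB|p1 p2 t1 h1 t2 h2|a p1 t1 h1]; first exact: f0.
  under eq_Rintegral do rewrite mulrDr.
  by rewrite Int_add ?ifp// h1 h2 addr0.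
under eq_Rintegral do rewrite mulrCA.
by rewrite Int_scale ?ifp// h1 mulr0.
Qed.

(** The common bound 1 allows dominated convergence against an integrable [f], with majorant
    [|f|]. *)
Definition trig_limit (g : V -> R) := exists p : nat -> V -> R,
  [/\ forall n, trig_poly (p n), forall n, bounded_by 1 (p n) &
   forall x, p ^~ x @ \oo --> g x].

Lemma trig_limit_Int f g : integ f ->
  (forall xi theta, dual_mem B xi -> Int (fun x => f x * wave xi theta x) = 0) ->
  trig_limit g -> measurable_fun setT g -> Int (fun x => f x * g x) = 0.
Proof.
move=> fi f0 [p [tp p1 pg]] mg; have mf := integ_measurable fi.
have mp k : measurable_fun setT (p k) by have [] := trig_poly_bounded (tp k).
have [] := @dominated_convergence _ _ _ leb setT measurableT
  (fun n x => (f x * p n x)%:E) (fun x => (f x * g x)%:E) (fun x => `|(f x)%:E|)%E.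
- by move=> k; apply/measurable_EFinP; exact: measurable_funM.
- by apply/measurable_EFinP; exact: measurable_funM.
- by apply: aeW => x _; apply/cvg_EFinE; apply: cvgMr; exact: pg.
- exact: integrable_abse.
- by apply: aeW => x k _; rewrite /= lee_fin normrM ler_piMr//; exact: p1.
move=> _ _; rewrite /mk_sequence (_ : (fun _ => _) = fun=> 0%E).
  by move=> /(cvg_unique _ (cvg_cst _)) h; rewrite /Rintegral -h.
apply/funext => k.
rewrite -EFin_Int; last exact: (integ_bounded_mul fi (mp k) (p1 k)).
by rewrite trig_poly_Int.
Qed.

Hypothesis uB : B \in unitmx.

(** The dual basis: pairing with it reads off the coordinates in the basis [B]. *)
Definition dual_vec (i : 'I_d) : V := row i (invmx B)^T.

Lemma dot_dual_vec x i : dot x (dual_vec i) = (x *m invmx B) ord0 i.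
Proof. by rewrite /dot /dual_vec !mxE; apply: eq_bigr => j _; rewrite !mxE. Qed.

Lemma dual_mem_vec i : dual_mem B (dual_vec i).
Proof. by move=> _ [m _ <-]; rewrite dot_dual_vec mulmxK// mxE intr_int. Qed.

(* The threshold cosT (l / 2) is moved to 1/2 by an affine map into [0, 1]. *)
Lemma arc_approx (i : 'I_d) (l b : R) : 0 < l < 1 -> exists p : nat -> V -> R,
  [/\ forall n, trig_poly (p n), forall n x, 0 <= p n x <= 1 &
   forall x, p ^~ x @ \oo --> ((0 < fracr ((x *m invmx B) ord0 i + b) < l)%R%:R : R)].
Proof.
move=> l01.
pose q x := 2^-1 - (wave (dual_vec i) (b - l / 2) x - cosT (l / 2)) / 4.
have q01 x : 0 <= q x <= 1.
  rewrite /q /wave.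
  have := norm_cosT (dot x (dual_vec i) + (b - l / 2)); have := norm_cosT (l / 2).
  by rewrite !ler_norml => /andP[? ?] /andP[? ?]; apply/andP; split; lra.
exists (fun n x => power_step (q x) n); split.
- move=> n; apply: trig_poly_power_step.
  rewrite (_ : q = fun x => (2^-1 + cosT (l / 2) / 4) +
      (- 4^-1) * wave (dual_vec i) (b - l / 2) x).
    by apply: trig_poly_affine; apply: trig_poly_wave; exact: dual_mem_vec.
  by apply/funext => x; rewrite /q; field.
- by move=> n x; exact: power_step_itv.
- move=> x; rewrite -cosT_arc// -dot_dual_vec.
  rewrite (_ : (_ < _) = (q x < 2^-1)); first exact: cvg_power_step.
  by rewrite /q /wave addrA; apply/idP/idP; lra.
Qed.

Lemma fcoord_approx (i : 'I_d) (a : R) :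
  trig_limit (fun x => (fcoord B x ord0 i < a)%R%:R).
Proof.
have fc x : fcoord B x ord0 i = fracr ((x *m invmx B) ord0 i) by rewrite mxE.
have [a0|a0] := leP a 0.
  exists (fun=> cst 0); split.
  - by move=> _; exact: trig_poly_cst.
  - by move=> _ x; rewrite normr0.
  - move=> x; have /andP[f0 _] := fracr_itv ((x *m invmx B) ord0 i).
    rewrite fc (_ : (_ < _) = false); first exact: cvg_cst.
    by apply/negbTE; rewrite -leNgt (le_trans a0).
have [a1|a1] := leP 1 a.
  exists (fun=> cst 1); split.
  - by move=> _; exact: trig_poly_cst.
  - by move=> _ x; rewrite normr1.
  - move=> x; have /andP[_ f1] := fracr_itv ((x *m invmx B) ord0 i).
    rewrite fc (_ : (_ < _) = true); first exact: cvg_cst.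
    by rewrite (lt_le_trans f1).
have a01 : 0 < a < 1 by rewrite a0.
pose b := (1 - a) / 2.
have [|p [tp p01 pc]] := @arc_approx i (a + b) b.
  by rewrite /b; apply/andP; split; lra.
have [|q [tq q01 qc]] := @arc_approx i b b.
  by rewrite /b; apply/andP; split; lra.
exists (fun n x => p n x - q n x); split.
- move=> n; rewrite (_ : (fun _ => _) = fun x => p n x + (-1) * q n x).
    by apply: trig_poly_add => //; exact: trig_poly_scale.
  by apply/funext => x; rewrite mulN1r.
- move=> n x; rewrite ler_norml.
  by have /andP[? ?] := p01 n x; have /andP[? ?] := q01 n x; apply/andP; split; lra.
- by move=> x; rewrite fc fracr_lt_arcs//; apply: cvgB; [exact: pc|exact: qc].
Qed.

Lemma cvg_prod n (u : 'I_n -> nat -> R) (l : 'I_n -> R) :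
  (forall i, u i @ \oo --> l i) ->
  (fun k => \prod_(i < n) u i k) @ \oo --> \prod_(i < n) l i.
Proof.
elim: n u l => [|n IH] u l ul.
  rewrite big_ord0 (_ : (fun _ => _) = fun=> 1); first exact: cvg_cst.
  by apply/funext => k; rewrite big_ord0.
rewrite big_ord_recl (_ : (fun _ => _) =
    fun k => u ord0 k * \prod_(i < n) u (lift ord0 i) k).
  by apply: cvgM; [exact: ul|apply: IH].
by apply/funext => k; rewrite big_ord_recl.
Qed.

Lemma fcoord_box_approx (a : V) :
  trig_limit (fun x => \prod_(i < d) (fcoord B x ord0 i < a ord0 i)%R%:R).
Proof.
have /choice[p pP] i := fcoord_approx i (a ord0 i).
exists (fun n x => \prod_(i < d) p i n x); split.
- by move=> n; apply: trig_poly_prod => i; have [] := pP i.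
- move=> n x; rewrite normr_prod.
  apply: (@le_trans _ _ (\prod_(i < d) 1)); last by rewrite big1.
  apply: ler_prod => i _.
  by rewrite normr_ge0/=; have [_ + _] := pP i; apply.
- by move=> x; apply: (cvg_prod (u := fun i n => p i n x)) => i; have [_ _] := pP i; apply.
Qed.

End trigonometric_polynomials.

(** * A pi-system generating the Borel sets *)

Section borel_boxes.
Context (R : realType) (d : nat).
Local Notation V := 'rV[R]_d.

Definition lower_box (a : V) : set V := [set t | forall i, t ord0 i < a ord0 i].

Lemma lower_box_setI : setI_closed (range lower_box).
Proof.
move=> _ _ [a _ <-] [b _ <-].
exists (\row_i Num.min (a ord0 i) (b ord0 i)) => //.
apply/seteqP; split => t /=.
  by move=> h; split => i; have := h i; rewrite mxE lt_min => /andP[].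
by move=> [h1 h2] i; rewrite mxE lt_min h1 h2.
Qed.

Lemma measurable_lower_box a : measurable (lower_box a).
Proof.
rewrite (_ : lower_box a = \bigcap_(i in [set: 'I_d])
    ((fun x : V => x ord0 i : measurableTypeR R) @^-1` `]-oo, a ord0 i[%classic)).
  apply: fin_bigcap_measurable => // i _.
  by rewrite -[X in measurable X]setTI; exact: measurable_coord.
apply/seteqP; split => x /= h i; last by have := h i I; rewrite /= in_itv.
by move=> _; rewrite /= in_itv/=; exact: h.
Qed.

(** A coordinate half-space is the union over k of the boxes whose other bounds all equal k. *)
Lemma measurable_sub_lower_box : @measurable _ V `<=` <<s range lower_box >>.
Proof.
have mcoord i : measurable_fun [set: g_sigma_algebraType (range lower_box)]
    (fun x : V => x ord0 i : R).
  apply: (measurability _ (RGenInftyO.measurableE R)) => _ [_ [a ->] <-].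
  rewrite setTI (_ : _ @^-1` _ = \bigcup_k lower_box
    (\row_j (if j == i then a else k%:R))).
    by apply: bigcupT_measurable => k; apply: sub_sigma_algebra; exists
      (\row_j (if j == i then a else k%:R)).
  apply/seteqP; split => x; last first.
    by move=> [k _ /(_ i)]; rewrite mxE eqxx /= in_itv.
  rewrite /= in_itv/= => xa.
  pose M : R := \sum_j `|x ord0 j|.
  exists (Num.truncn M).+1 => // j; rewrite mxE; case: eqP => [->//|_].
  apply: le_lt_trans (truncnS_gt M).
  apply: (le_trans (ler_norm _)); rewrite /M (bigD1 j)//= lerDl.
  exact: sumr_ge0.
apply: smallest_sub; first exact: smallest_sigma_algebra.
move=> A; rewrite -bigcup_seq => -[i /= _ [Y mY <-]].
exact: (mcoord i measurableT Y mY).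
Qed.

End borel_boxes.

Section lattice_tiles.
Context (R : realType) (d : nat).
Local Notation V := 'rV[R]_d.
Local Notation leb := (lebesgue_rV R d).
Local Notation integ g := (leb.-integrable setT (EFin \o g)).
Variables (B : 'M[R]_d) (e : nat -> V).
Hypothesis uB : B \in unitmx.
Hypothesis inj_e : injective e.
Hypothesis re : range e = lspan B.

Lemma norm_indic_le1 (T : Type) (A : set T) x : `|\1_A x : R| <= 1.
Proof. by rewrite indicE; case: (_ \in _); rewrite ?normr1 ?normr0. Qed.

(** Exactly one lattice translate of [y] lies in the cell moved by [l]; the series reduces to the
    value of the indicator of [A] there. *)
Lemma fdom_shift_series (l y : V) (A : set V) : lspan B l ->
  series (fun k => \1_A (y + e k) * \1_(fdom B) (y + e k - l)) @ \oo -->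
  (\1_A (fcoord B y *m B + l) : R).
Proof.
move=> ll; apply/cvg_nneseriesE => [k|]; first by rewrite mulr_ge0.
have g0 u : (0 <= (\1_A (u + l))%:E :> \bar R)%E by rewrite lee_fin.
have := nneseries_fdom (y - l) uB inj_e re g0.
rewrite fcoord_add//; last exact: lspanN.
move=> <-; apply: eq_eseriesr => k _; rewrite -EFinM.
by rewrite [y - l + _]addrAC subrK.
Qed.

Lemma fdom_shift_bound (l y : V) (A : set V) N : lspan B l ->
  \sum_(0 <= k < N) `|\1_A (y + e k) * \1_(fdom B) (y + e k - l) : R| <= 1.
Proof.
move=> ll; have cv := fdom_shift_series (y := y) (A := A) ll.
apply: (@le_trans _ _ (\1_A (fcoord B y *m B + l))); last first.
  exact: le_trans (ler_norm _) (norm_indic_le1 _ _).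
rewrite -(cvg_lim _ cv)//.
under eq_bigr do rewrite ger0_norm ?mulr_ge0//.
apply: (@nondecreasing_cvgn_le _ (series (fun k => \1_A (y + e k) * \1_(fdom B) (y + e k - l)))).
  by apply: nondecreasing_series => k _ _; rewrite mulr_ge0.
by apply/cvg_ex; exists (\1_A (fcoord B y *m B + l)).
Qed.

Lemma measurable_fdom_shift (l : V) : measurable_fun setT (fun x : V => \1_(fdom B) (x - l) : R).
Proof.
by apply: measurable_shift_fun; apply: measurable_indic; exact: measurable_fdom.
Qed.

Lemma ae_fdom_shift (P : set V) :
  (forall l, lspan B l -> {ae leb, forall x, fdom B (x - l) -> P x}) ->
  {ae leb, forall x, P x}.
Proof.
move=> h.
have : {ae leb, forall x, forall k, fdom B (x - e k) -> P x}.
  by apply/ae_foralln => k; apply: h; rewrite -re; exists k.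
apply: filterS => x hx; have [inj_e' re'] := enum_opp inj_e re.
have [k [xk _]] := fdom_enum x uB inj_e' re'.
by apply: (hx k); rewrite xk; exact: fdom_fcoord.
Qed.

(** [ae_summable_at] speaks only of points where the test function is nonzero; the indicators of the
    translated cells together reach every point. *)
Lemma ae_summable_lattice (f : V -> R) : integ f ->
  {ae leb, forall x, summable_at e f x}.
Proof.
move=> fi; apply: ae_fdom_shift => l ll.
have [||N [mN N0 fN]] := @ae_summable_at R d e f
  (fun x => \1_setT x * \1_(fdom B) (x - l)) 1 fi.
- by apply: measurable_funM; [exact: measurable_indic|exact: measurable_fdom_shift].
- by move=> y n; exact: fdom_shift_bound.
exists N; split => //; apply: subset_trans fN => x /= h h'; apply: h => Dx.
by apply: h'; rewrite indicT mul1r indicE mem_set// oner_neq0.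
Qed.

End lattice_tiles.

(** * Vanishing Fourier coefficients and null periodizations *)

Section fourier_uniqueness.
Context (R : realType) (d : nat).
Local Notation V := 'rV[R]_d.
Local Notation leb := (lebesgue_rV R d).
Local Notation integ g := (leb.-integrable setT (EFin \o g)).
Local Notation Int g := (Rintegral leb setT g).
Variables (B : 'M[R]_d) (f : V -> R).
Hypothesis uB : B \in unitmx.
Hypothesis fi : integ f.
Hypothesis f0 : forall xi theta, dual_mem B xi ->
  Int (fun x => f x * wave xi theta x) = 0.

Let mf : measurable_fun setT f := integ_measurable fi.

Let mind (A : set V) : measurable A ->
  measurable_fun setT (fun x => \1_A (fcoord B x) : R).
Proof.
by move=> mA; apply: measurableT_comp; [exact: measurable_indic|exact: measurable_fcoord].
Qed.

Let iind (A : set V) : measurable A -> integ (fun x => f x * \1_A (fcoord B x)).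
Proof.
by move=> mA; apply: (integ_bounded_mul fi (M := 1));
  [exact: mind|move=> x; exact: norm_indic_le1].
Qed.

(** For boxes the indicator is a bounded limit of trigonometric polynomials, against which [f]
    integrates to 0; a monotone class argument extends this to Borel sets. The whole space is
    frequency 0. *)
Lemma Int_fcoord_set (A : set V) : measurable A ->
  Int (fun x => f x * \1_A (fcoord B x)) = 0.
Proof.
pose H : set (set V) :=
  [set A | measurable A /\ Int (fun x => f x * \1_A (fcoord B x)) = 0].
suff : <<s range (@lower_box R d) >> `<=` H.
  by move=> h mA; have [] := h A (measurable_sub_lower_box mA).
apply: lambda_system_subset => //.
- exact: lower_box_setI.
- split => //.
  + split => //; rewrite -[RHS](f0 0 (@dual_mem0 R d B)).
    by apply: eq_Rintegral => x _; rewrite indicT wave00.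
  + move=> A1 A2 A21 [mA1 h1] [mA2 h2]; split; first exact: measurableD.
    have -> : Int (fun x => f x * \1_(A1 `\` A2) (fcoord B x)) =
        Int (fun x => f x * \1_A1 (fcoord B x) + (-1) * (f x * \1_A2 (fcoord B x))).
      apply: eq_Rintegral => x _; rewrite mulN1r -mulrBr; congr (_ * _).
      rewrite !indicE; case: (boolP (fcoord B x \in A2)) => [/set_mem|/negP] xA2.
        rewrite memNset; last by case.
        by rewrite mem_set ?subrr//; exact: A21.
      rewrite subr0; congr (_%:R); congr nat_of_bool.
      apply/idP/idP => [/set_mem[h _]|/set_mem h]; first exact: mem_set.
      by apply: mem_set; split => // h'; apply: xA2; exact: mem_set.
    rewrite Int_add ?Int_scale ?h1 ?h2 ?mulr0 ?addr0//.
    - exact: iind.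
    - exact: iind.
    - by apply: integ_scale; exact: iind.
  + move=> F ndF HF; have mF k : measurable (F k) by have [] := HF k.
    have mU : measurable (\bigcup_k F k) by exact: bigcupT_measurable.
    split => //.
    have [] := @dominated_convergence _ _ _ leb setT measurableT
      (fun n x => (f x * \1_(F n) (fcoord B x))%:E)
      (fun x => (f x * \1_(\bigcup_k F k) (fcoord B x))%:E) (fun x => `|(f x)%:E|)%E.
    - by move=> k; apply/measurable_EFinP; apply: measurable_funM => //; exact: mind.
    - by apply/measurable_EFinP; apply: measurable_funM => //; exact: mind.
    - apply: aeW => x _; apply/cvg_EFinE; apply: cvgMr.
      have [[k _ Fk]|nF] := pselect ((\bigcup_k F k) (fcoord B x)).
        apply: (@cvg_near_cst _ _ _ _ _).
        near=> m; have km : (k <= m)%N by near: m; exact: nbhs_infty_ge.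
        have Fm : F m (fcoord B x) by move: Fk; apply/subsetPset; exact: ndF.
        by rewrite !indicE !mem_set//; exists k.
      rewrite (_ : (fun _ => _) = fun=> \1_(\bigcup_k F k) (fcoord B x)); first exact: cvg_cst.
      apply/funext => k; rewrite !indicE !memNset// => Fk.
      by apply: nF; exists k.
    - exact: integrable_abse.
    - by apply: aeW => x k _; rewrite /= lee_fin normrM ler_piMr// norm_indic_le1.
    move=> _ _; rewrite /mk_sequence (_ : (fun _ => _) = fun=> 0%E).
      by move=> /(cvg_unique _ (cvg_cst _)) h; rewrite /Rintegral -h.
    apply/funext => k; rewrite -EFin_Int; last exact: iind.
    by have [_ ->] := HF k.
- move=> _ [a _ <-]; split; first exact: measurable_lower_box.
  have boxE : (fun x => \prod_(i < d) (fcoord B x ord0 i < a ord0 i)%R%:R) =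
      (fun x => \1_(lower_box a) (fcoord B x) : R).
    apply/funext => x; rewrite indicE; case: (boolP (_ \in _)) => [/set_mem xa|/negP xa].
      by rewrite big1// => i _; rewrite xa.
    have [i xi] : exists i, ~~ (fcoord B x ord0 i < a ord0 i).
      apply/existsP; rewrite -negb_forall; apply/negP => /forallP h.
      by apply: xa; apply/mem_set => i; exact: h.
    by rewrite (bigD1 i)//= (negbTE xi) mul0r.
  have := fcoord_box_approx uB a; rewrite boxE => /(trig_limit_Int fi f0); apply.
  by apply: mind; exact: measurable_lower_box.
Unshelve. all: by end_near. Qed.

Variable e : nat -> V.
Hypothesis inj_e : injective e.
Hypothesis re : range e = lspan B.

(** The periodization is tested against the indicator of its own positivity set, inside one
    translated cell at a time, so periodicity is never invoked. Unfolding turns the pairing into an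
    integral of [f] against a function of the fractional coordinates, which is 0; the sign [sg]
    gives both inequalities. *)
Lemma fourier_uniqueness : {ae leb, forall x, period_sum e f x = 0}.
Proof.
pose PS := period_sum e f.
have mPS : measurable_fun setT PS by exact: measurable_period_sum.
suff one_side (sg : R) : {ae leb, forall x, sg * PS x <= 0}.
  have := one_side (- 1); apply: filterS2 (one_side 1) => x.
  rewrite mul1r mulN1r oppr_le0 => h1 h2.
  by apply/eqP; rewrite eq_le h1.
apply: (ae_fdom_shift uB inj_e re) => l ll.
pose A := [set x | 0 < sg * PS x].
have mA : measurable A.
  rewrite (_ : A = setT `&` (fun x => sg * PS x) @^-1` `]0, +oo[%classic).
    by apply: (measurable_funM (measurable_cst sg) mPS).
  by apply/seteqP; split => x; rewrite /A /= in_itv/= andbT => // -[].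
pose h (x : V) : R := \1_A x * \1_(fdom B) (x - l).
have mh : measurable_fun setT h.
  by apply: measurable_funM; [exact: measurable_indic|exact: measurable_fdom_shift].
have [ihPS _] := period_sum_duality fi mh (fun y n => fdom_shift_bound uB inj_e re y A n ll).
pose A' := [set t : V | A (t *m B + l)].
have mA' : measurable A'.
  rewrite -[A']setTI.
  apply: (measurableT_comp (measurable_addr_rV l) (measurable_mulmx_rV B)) => //.
have -> : Int (fun y => f y * limn (series (fun k => h (y + e k)))) =
    Int (fun y => f y * \1_A' (fcoord B y)).
  apply: eq_Rintegral => y _; congr (_ * _).
  by rewrite (cvg_lim _ (fdom_shift_series uB inj_e re (y := y) (A := A) ll)).
rewrite Int_fcoord_set// => Int0.
have hPS0 x : 0 <= sg * (h x * PS x).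
  rewrite /h indicE; case: (boolP (x \in A)) => [/set_mem Ax|_].
    rewrite mul1r mulrCA mulr_ge0//.
    exact: ltW.
  by rewrite !mul0r mulr0.
have ish := integ_scale sg ihPS.
have : (\int[leb]_x `|(sg * (h x * PS x))%:E| = 0)%E.
  under eq_integral do rewrite gee0_abs ?lee_fin//.
  by rewrite -EFin_Int// Int_scale// Int0 mulr0.
have /integrableP[msh _] := ish.
move=> /(ae_eq_integral_abs leb measurableT msh).
apply: filterS => x /(_ I) [hx0] Dx; rewrite leNgt; apply/negP => Ax.
move: hx0; rewrite /h indicE mem_set// indicE mem_set// !mul1r => hx0.
by rewrite hx0 ltxx in Ax.
Qed.

End fourier_uniqueness.

(** * From the spectrum to a superlattice *)

Section phases.
Variable R : realType.

Definition expi (t : R) : R[i] := Complex (cosT t) (sinT t).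

Lemma expiD s t : expi (s + t) = expi s * expi t.
Proof. by rewrite /expi cosTD sinTD; apply/eqP; rewrite eq_complex/= eqxx addrC eqxx. Qed.

Lemma expi0 : expi 0 = 1.
Proof. by rewrite /expi /cosT /sinT mulr0 cos0 sin0. Qed.

Lemma expi_neq0 t : expi t != 0.
Proof.
apply/eqP => t0; have := expiD t (- t); rewrite subrr expi0 t0 mul0r => /eqP.
by rewrite oner_eq0.
Qed.

Lemma expiN t : expi (- t) = (expi t)^-1.
Proof.
apply: (mulfI (expi_neq0 t)).
by rewrite mulfV ?expi_neq0// -expiD subrr expi0.
Qed.

Lemma expiMz t (m : int) : expi (m%:~R * t) = expi t ^ m.
Proof.
have nat_case (k : nat) : expi (k%:R * t) = expi t ^+ k.
  elim: k => [|k IH]; first by rewrite mul0r expi0.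
  by rewrite -natr1 mulrDl mul1r expiD IH exprSr.
case: m => k; first exact: nat_case.
by rewrite NegzE mulrNz mulNr expiN -exprnN -pmulrn nat_case.
Qed.

Lemma expi_sum (I : Type) (r : seq I) (F : I -> R) :
  expi (\sum_(i <- r) F i) = \prod_(i <- r) expi (F i).
Proof. by elim/big_rec2: _ => [|i x y _ <-]; rewrite ?expi0 ?expiD. Qed.

End phases.

(** * Vanishing of the spectrum and the resulting superlattice *)

Section spectrum_to_sublattice.
Context (R : realType) (d : nat).
Local Notation V := 'rV[R]_d.
Local Notation leb := (lebesgue_rV R d).
Local Notation integ g := (leb.-integrable setT (EFin \o g)).
Local Notation Int g := (Rintegral leb setT g).
Hypothesis d0 : (0 < d)%N.

Lemma dot_dual_basis (B : 'M[R]_d) (x xi : V) : B \in unitmx ->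
  dot x xi = \sum_i dot (row i B) xi * dot x (dual_vec B i).
Proof.
move=> uB; rewrite -{1}(mulmxKV uB x) mulmx_sum_row /dot mulmx_suml summxE.
apply: eq_bigr => i _; rewrite -scalemxAl mxE mulrC; congr (_ * _).
exact/esym/dot_dual_vec.
Qed.

Lemma row_lspan (B : 'M[R]_d) i : lspan B (row i B).
Proof. by exists (delta_mx ord0 i) => //; rewrite /intv map_delta_mx -rowE. Qed.

Lemma lspan_scale (B : 'M[R]_d) (N : nat) : (0 < N)%N ->
  lspan B `<=` lspan (N%:R^-1 *: B).
Proof.
move=> N0 _ [m _ <-]; exists (m *+ N) => //.
rewrite -scalemxAr (_ : intv R (m *+ N) = N%:R *: intv R m).
  by rewrite -scalemxAl scalerA mulVf ?scale1r// pnatr_eq0 -lt0n.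
by apply/rowP => i; rewrite !mxE mulmxnE rmorphMn mulr_natl.
Qed.

Lemma unitmx_scaleV (B : 'M[R]_d) (N : nat) : (0 < N)%N -> B \in unitmx ->
  N%:R^-1 *: B \in unitmx.
Proof.
by move=> N0 uB; rewrite unitmxZ// unitfE invr_eq0 pnatr_eq0 -lt0n.
Qed.

Lemma integ_fdom (B : 'M[R]_d) : B \in unitmx -> integ (\1_(fdom B)).
Proof.
move=> uB; apply/integrableP; split.
  by apply/measurable_EFinP; apply: measurable_indic; exact: measurable_fdom.
under eq_integral do rewrite gee0_abs ?lee_fin//.
rewrite lebesgue_indic; first exact: fdom_lty.
exact: measurable_fdom.
Qed.

Lemma period_sum_fdom (B : 'M[R]_d) (e : nat -> V) x : B \in unitmx ->
  injective e -> range e = lspan B ->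
  series (fun k => \1_(fdom B) (x - e k) : R) @ \oo --> (1 : R).
Proof.
move=> uB inj_e re; have [inj_e' re'] := enum_opp inj_e re.
by apply/cvg_nneseriesE => [k //|]; exact: nneseries_fdom1.
Qed.

Lemma summable_at_fdom (B : 'M[R]_d) (e : nat -> V) x : B \in unitmx ->
  injective e -> range e = lspan B -> summable_at e (\1_(fdom B)) x.
Proof.
move=> uB inj_e re; apply/abs_summableP.
have := period_sum_fdom x uB inj_e re.
move=> /cvg_nneseriesE h; under eq_eseriesr do rewrite ger0_norm//.
by rewrite h// ltry.
Qed.

(** The indicator of a cell tiles with its own lattice with weight 1, so [tiling_spectrum] for this
    single lattice gives its Fourier coefficients without computing an integral. *)
Lemma Int_fdom_wave (B : 'M[R]_d) xi theta : B \in unitmx -> dual_mem B xi ->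
  xi != 0 -> Int (fun x => \1_(fdom B) x * wave xi theta x) = 0.
Proof.
move=> uB xiB xi0; have [e [inj_e re]] := lspan_enum d0 uB.
have [psi [c [mpsi psi0 ipsi Ipsi cP]]] := universal_weight d0
  (fun _ : 'I_1 => uB) (fun=> inj_e) (fun=> re).
have cv k x := (cP k).2 x.
have one : {ae leb, forall x, \sum_(k < 1) period_sum e (\1_(fdom B)) (x - 0) = (1 : R)}.
  apply: aeW => x; rewrite big_ord1 subr0.
  have h1 := period_sum_cvg (summable_at_fdom (x := x) uB inj_e re).
  exact: (cvg_unique _ h1 (period_sum_fdom x uB inj_e re)).
have := tiling_spectrum (z := fun=> 0) (integ_fdom uB) one
  (fun=> inj_e) (fun=> re) mpsi psi0 ipsi cv theta xi0.
rewrite big_mkcond big_ord1 asboolT// /dot mul0mx mxE addr0 => /eqP.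
by rewrite mulf_eq0 gt_eqF ?(cP ord0).1//= => /eqP.
Qed.

Variables (n : nat) (B : 'I_n -> 'M[R]_d) (e : 'I_n -> nat -> V) (z : 'I_n -> V).
Hypothesis uB : forall k, B k \in unitmx.
Hypothesis inj_e : forall k, injective (e k).
Hypothesis re : forall k, range (e k) = lspan (B k).

(** The pairings of [xi] with the rows of [B j] are multiples of [N]. In the dual basis every phase
    is therefore a product of [N]-th powers of phases from a finite list, as [exp_sum_neq0]
    requires. *)
Lemma spectral_sublattice (c : 'I_n -> R) (j : 'I_n) : (forall k, 0 < c k) ->
  exists2 N, (0 < N)%N & forall xi, dual_mem (N%:R^-1 *: B j) xi ->
    \sum_(k | `[< dual_mem (B k) xi >]) (c k)%:C%C * expi (dot (z k) xi) != 0.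
Proof.
move=> c0.
have ch0 : [pchar R[i]] =i pred0 by exact: pchar_num.
have u0 (k : 'I_n) (i : 'I_d) : expi (dot (z k) (dual_vec (B j) i)) != 0.
  exact: expi_neq0.
have S0 (S : {set 'I_n}) : S != finset.set0 -> \sum_(k in S) (c k)%:C%C != 0.
  case/set0Pn => k kS; rewrite -rmorph_sum/= fmorph_eq0 gt_eqF//.
  rewrite (bigD1 k)//= ltr_pwDl//; apply: sumr_ge0 => i _; exact: ltW.
have [N N0 NP] := exp_sum_neq0 ch0 u0 S0.
exists N => // xi xiN.
have /choice[m mE] i : exists m : int, dot (row i (N%:R^-1 *: B j)) xi = m%:~R.
  by have /intrP[m ->] := xiN _ (row_lspan _ i); exists m.
have zE k : expi (dot (z k) xi) =
    \prod_i expi (dot (z k) (dual_vec (B j) i)) ^ (N%:Z * m i).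
  rewrite (dot_dual_basis _ _ (uB j)) expi_sum; apply: eq_bigr => i _.
  rewrite -expiMz intrM; congr (expi (_ * _)).
  rewrite -mE linearZ/= dotZl mulrA divff ?mul1r// intr_eq0.
  by rewrite eqz_nat -lt0n.
(* The selected set of indices contains [j], hence is nonempty. *)
have xij : dual_mem (B j) xi by move=> l /(lspan_scale N0); exact: xiN.
have := NP [set k | `[< dual_mem (B k) xi >]]%SET m.
have -> : [set k | `[< dual_mem (B k) xi >]]%SET != finset.set0.
  by apply/set0Pn; exists j; rewrite inE; apply/asboolP.
move=> /(_ isT).
under eq_bigr do rewrite -zE.
by under eq_bigl do rewrite inE.
Qed.

(** [N] and [rho] come before [f] and [w], so that the real and imaginary parts of a complex
    function obtain the same lattice and the same factor. *)
Lemma tiling_sublattice (j : 'I_n) : exists2 N, (0 < N)%N & exists rho : R,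
  forall e', injective e' -> range e' = lspan (N%:R^-1 *: B j) ->
  forall f w, integ f ->
  {ae leb, forall x, \sum_(k < n) period_sum (e k) f (x - z k) = w} ->
  {ae leb, forall x, period_sum e' f x = rho * w}.
Proof.
have [psi [c [mpsi psi0 ipsi Ipsi cP]]] := universal_weight d0 uB inj_e re.
have c0 k := (cP k).1; have cv k x := (cP k).2 x.
have [N N0 NP] := spectral_sublattice j c0.
exists N => //; set B' := _ *: _.
have uB' : B' \in unitmx by exact: unitmx_scaleV.
pose vol : R := Int (\1_(fdom B')).
pose C := \sum_k c k.
(* By [tiling_mean] the integral of [f] is w Int psi / C; the mean of its periodization over the new
   lattice is this integral divided by the cell volume. *)
exists (Int psi / C / vol) => e' inj_e' re' f w fi fw.
have vol0 : vol != 0.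
  rewrite gt_eqF// /vol /Rintegral lebesgue_indic; last exact: measurable_fdom.
  by rewrite fine_gt0// (fdom_gt0 uB' inj_e' re') fdom_lty.
have C0 : C != 0.
  rewrite gt_eqF// /C (bigD1 j)//= ltr_pwDl// sumr_ge0// => i _; exact: ltW.
have fmean : Int f = w * Int psi / C.
  by rewrite (tiling_mean fi fw mpsi psi0 ipsi cv) mulrAC divff ?mul1r.
have ifw xi theta : integ (fun x => f x * wave xi theta x).
  apply: (integ_bounded_mul fi (M := 1)); first exact: measurable_wave.
  by move=> x; exact: norm_cosT.
have fwave xi theta : dual_mem B' xi -> xi != 0 ->
    Int (fun x => f x * wave xi theta x) = 0.
  move=> xiB xi0.
  (* a - i b is the Fourier transform of f at xi. *)
  pose a := Int (fun x => f x * wave xi 0 x).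
  pose b := Int (fun x => f x * wave xi (- 4^-1) x).
  have waveE s : Int (fun x => f x * wave xi s x) = cosT s * a - sinT s * b.
    rewrite /a /b -mulNr -!Int_scale// -Int_add; [|exact: integ_scale..].
    apply: eq_Rintegral => x _; rewrite /wave addr0 cosT_quarter cosTD; ring.
  have waveE' s : Int (fun x => f x * wave xi (- 4^-1 + s) x) = cosT s * b + sinT s * a.
    rewrite /a /b -!Int_scale// -Int_add; [|exact: integ_scale..].
    apply: eq_Rintegral => x _; rewrite /wave addr0 addrA addrAC !cosT_quarter sinTD; ring.
  have spec theta' := tiling_spectrum fi fw inj_e re mpsi psi0 ipsi cv theta' xi0.
  have : \sum_(k | `[< dual_mem (B k) xi >])
      c k * (cosT (dot (z k) xi) * a - sinT (dot (z k) xi) * b) = 0.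
    by rewrite -[RHS](spec 0); apply: eq_bigr => k _; rewrite add0r waveE.
  have : \sum_(k | `[< dual_mem (B k) xi >])
      c k * (cosT (dot (z k) xi) * b + sinT (dot (z k) xi) * a) = 0.
    by rewrite -[RHS](spec (- 4^-1)); apply: eq_bigr => k _; rewrite waveE'.
  have := NP _ xiB.
  pose X := \sum_(k | `[< dual_mem (B k) xi >]) c k * cosT (dot (z k) xi).
  pose Y := \sum_(k | `[< dual_mem (B k) xi >]) c k * sinT (dot (z k) xi).
  have -> : \sum_(k | `[< dual_mem (B k) xi >]) (c k)%:C%C * expi (dot (z k) xi) =
      Complex X Y.
    apply/eqP; rewrite eq_complex; apply/andP; split; apply/eqP.
      rewrite raddf_sum/=; apply: eq_bigr => k _.
      by rewrite mul0r subr0.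
    rewrite raddf_sum/=; apply: eq_bigr => k _.
    by rewrite mul0r addr0.
  move=> XY0.
  have -> : \sum_(k | `[< dual_mem (B k) xi >])
      c k * (cosT (dot (z k) xi) * b + sinT (dot (z k) xi) * a) = X * b + Y * a.
    rewrite /X /Y !mulr_suml -big_split/=; apply: eq_bigr => k _; ring.
  have -> : \sum_(k | `[< dual_mem (B k) xi >])
      c k * (cosT (dot (z k) xi) * a - sinT (dot (z k) xi) * b) = X * a - Y * b.
    rewrite /X /Y !mulr_suml -sumrB/=; apply: eq_bigr => k _; ring.
  move=> e1 e2.
  (* The phases 0 and -1/4 gave the real and imaginary parts of (X + i Y)(a + i b) = 0, a linear
     system in [a] and [b] with determinant X^2 + Y^2. *)
  have XY : X ^+ 2 + Y ^+ 2 != 0.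
    apply: contraNneq XY0 => XY.
    have /andP[X0 Y0] : (X ^+ 2 == 0) && (Y ^+ 2 == 0).
      by rewrite -paddr_eq0 ?sqr_ge0// XY.
    by move: X0 Y0; rewrite !sqrf_eq0 eq_complex/= => -> ->.
  have a0 : a = 0.
    apply: (mulfI XY); rewrite mulr0.
    rewrite (_ : _ * a = X * (X * a - Y * b) + Y * (X * b + Y * a)); last by ring.
    by rewrite e1 e2 !mulr0 addr0.
  have b0 : b = 0.
    apply: (mulfI XY); rewrite mulr0.
    rewrite (_ : _ * b = X * (X * b + Y * a) - Y * (X * a - Y * b)); last by ring.
    by rewrite e1 e2 !mulr0 subr0.
  by rewrite waveE a0 b0 !mulr0 subr0.
(* Subtracting [kappa] times the indicator of the cell cancels the zeroth coefficient and leaves the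
   others at 0. The periodization of that indicator is 1, so that of [f] equals [kappa]. *)
pose kappa := Int f / vol.
have iD := integ_fdom uB'.
pose f0 x := f x + (- kappa) * \1_(fdom B') x.
have if0 : integ f0 by apply: integ_add => //; exact: integ_scale.
have f0wave xi theta : dual_mem B' xi -> Int (fun x => f0 x * wave xi theta x) = 0.
  move=> xiB; rewrite /f0; under eq_Rintegral do rewrite mulrDl -mulrA.
  have iDw : integ (fun x => \1_(fdom B') x * wave xi theta x).
    apply: (integ_bounded_mul iD (M := 1)); first exact: measurable_wave.
    by move=> x; exact: norm_cosT.
  rewrite Int_add//; last exact: integ_scale.
  rewrite Int_scale//.
  have [xi0|xi0] := eqVneq xi 0; last by rewrite fwave// Int_fdom_wave// mulr0 addr0.
  have w0 (x : V) : wave xi theta x = cosT theta by rewrite xi0 /wave dot0r add0r.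
  under eq_Rintegral do rewrite w0 mulrC.
  rewrite Int_scale//.
  have -> : Int (fun x => \1_(fdom B') x * wave xi theta x) = cosT theta * vol.
    by rewrite -Int_scale//; apply: eq_Rintegral => x _; rewrite w0 mulrC.
  by rewrite /kappa mulrCA mulNr divfK// mulrN subrr.
have := fourier_uniqueness uB' if0 f0wave inj_e' re'.
apply: filterS3 (ae_summable_lattice uB' inj_e' re' fi)
  (ae_summable_lattice uB' inj_e' re' if0) => x Sx Sf0 f0x.
have -> : Int psi / C / vol * w = kappa by rewrite /kappa fmean mulrC !mulrA.
have cf := period_sum_cvg Sx.
have cD := period_sum_fdom x uB' inj_e' re'.
have c0' : series (fun k => f0 (x - e' k)) @ \oo --> period_sum e' f x - kappa * 1.
  rewrite (_ : series _ = fun n => series (fun k => f (x - e' k)) n -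
      kappa * series (fun k => \1_(fdom B') (x - e' k)) n).
    by apply: cvgB => //; exact: cvgMr.
  apply/funext => m; rewrite /series/= mulr_sumr -sumrB; apply: eq_bigr => k _.
  by rewrite /f0 mulNr.
have cf0 := period_sum_cvg Sf0.
have : period_sum e' f0 x = period_sum e' f x - kappa * 1.
  exact: (cvg_unique _ cf0 c0').
by rewrite f0x mulr1 => /esym/subr0_eq.
Qed.

End spectrum_to_sublattice.

(** * Sums over multi-sets *)

Section complex_sums.
Context (R : realType) (I : choiceType).
Implicit Types (a : I -> R[i]) (l : R[i]).

Lemma partial_sum_Re a (A : {fset I}) :
  complex.Re (summability.partial_sum (a : I -> R[i]^o) A) =
  summability.partial_sum (fun i => complex.Re (a i)) A.
Proof. by rewrite /summability.partial_sum raddf_sum. Qed.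

Lemma partial_sum_Im a (A : {fset I}) :
  complex.Im (summability.partial_sum (a : I -> R[i]^o) A) =
  summability.partial_sum (fun i => complex.Im (a i)) A.
Proof. by rewrite /summability.partial_sum raddf_sum. Qed.

Lemma normc_ge_Im (x : R[i]) : (`|complex.Im x|)%:C%C <= `|x|.
Proof. by rewrite normc_def lecR -sqrtr_sqr ler_wsqrtr// lerDr sqr_ge0. Qed.

Lemma normc_le_ReIm (x : R[i]) :
  `|x| <= (`|complex.Re x| + `|complex.Im x|)%:C%C.
Proof.
rewrite normc_def lecR -[leRHS]ger0_norm ?addr_ge0// -sqrtr_sqr ler_wsqrtr//.
rewrite sqrrD !real_normK ?num_real// addrAC lerDl.
by rewrite mulrn_wge0// mulr_ge0.
Qed.

Lemma partial_sum_complexP a l :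
  (summability.partial_sum (a : I -> R[i]^o) @ summability.totally --> (l : R[i]^o)) <->
  (summability.partial_sum (fun i => complex.Re (a i)) @ summability.totally -->
     complex.Re l /\
   summability.partial_sum (fun i => complex.Im (a i)) @ summability.totally -->
     complex.Im l).
Proof.
have FT : Filter (@summability.totally I) by exact: _.
split=> [al|[re im]].
  have al' := iffLR (cvgrPdist_le _ _) al.
  split; apply/cvgrPdist_le => eps eps0.
    have eps0' : 0 < (eps%:C%C : R[i]) by rewrite ltcR.
    have := al' FT _ eps0'; apply: filterS => A.
    rewrite -partial_sum_Re -raddfB => h.
    by rewrite -lecR; apply: le_trans h; exact: normc_ge_Re.
  have eps0' : 0 < (eps%:C%C : R[i]) by rewrite ltcR.
  have := al' FT _ eps0'; apply: filterS => A.
  rewrite -partial_sum_Im -raddfB => h.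
  by rewrite -lecR; apply: le_trans h; exact: normc_ge_Im.
(* In the order of [R[i]] a positive bound has zero imaginary part. *)
apply/cvgrPdist_le => -[er ei]; rewrite ltcE/= => /andP[/eqP -> er0].
have e2 : 0 < er / 2 by rewrite divr_gt0.
have re' := iffLR (cvgrPdist_le _ _) re _ e2.
have im' := iffLR (cvgrPdist_le _ _) im _ e2.
apply: filterS2 (re' FT) (im' FT) => A hr hi.
apply: (le_trans (normc_le_ReIm _)).
rewrite (_ : Complex er 0 = er%:C%C)// lecR !raddfB/= partial_sum_Re partial_sum_Im.
by rewrite (splitr er) lerD.
Qed.

End complex_sums.

(** * From multi-sets and tilings to lattice series *)

Section multiplicities.
Context (R : realType) (d : nat).
Local Notation V := 'rV[R]_d.

Lemma measurable_set1_rV (x : V) : measurable [set x].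
Proof.
rewrite (_ : [set x] = \bigcap_(i in [set: 'I_d])
    ((fun y : V => y ord0 i : measurableTypeR R) @^-1` [set x ord0 i])).
  apply: fin_bigcap_measurable => // i _.
  by rewrite -[X in measurable X]setTI; exact: measurable_coord.
apply/seteqP; split => [_ -> i _ //|y h /=].
by apply/rowP => i; exact: h.
Qed.

Lemma delta_mset_set1 (Lam : V -> nat) (x : V) :
  delta_mset Lam [set x] = (Lam x)%:R%:E.
Proof.
rewrite /delta_mset esum_mkcond.
transitivity (\esum_(y in [set: V]) if y \in [set x] then (Lam x)%:R%:E else 0%E : \bar R).
  apply: eq_esum => y _; rewrite diracE.
  case: (boolP (y \in [set x])) => [/set_mem -> |yx]; last by rewrite mule0; case: ifP.
  rewrite mule1; case: ifPn => // /negP xS.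
  have [->//|Lx] := posnP (Lam x).
  by exfalso; apply: xS; exact/mem_set.
rewrite -(esum_mkcond [set x] (fun=> (Lam x)%:R%:E)) esum_set1//.
Qed.

(** Evaluating both measures on singletons recovers the multiplicities. *)
Lemma multiplicity_sum (Lam : V -> nat) n (A : 'I_n -> set V) :
  (forall S : set V, measurable S ->
     delta_mset Lam S = (\sum_(j < n) delta_mset (mset_of_set (A j)) S)%E) ->
  forall x, Lam x = \sum_(j < n) mset_of_set (A j) x.
Proof.
move=> h x; have := h _ (measurable_set1_rV x).
under eq_bigr do rewrite delta_mset_set1.
rewrite delta_mset_set1 sumEFin -natr_sum => -[] /eqP.
by rewrite eqr_nat => /eqP.
Qed.

End multiplicities.

Section ae_translation.
Context (R : realType) (d : nat).
Local Notation V := 'rV[R]_d.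
Local Notation leb := (lebesgue_rV R d).

Lemma ae_translate (P : set V) (v : V) : {ae leb, forall x, P x} ->
  {ae leb, forall x, P (x + v)}.
Proof.
move=> [N [mN N0 PN]]; exists ((fun x => x + v) @^-1` N); split.
- by rewrite -[X in measurable X]setTI; exact: measurable_addr_rV.
- by rewrite -[RHS]N0; exact: lebesgue_rV_translate.
- by move=> x h; exact: PN.
Qed.

End ae_translation.

Section tiling_sums.
Context (R : realType) (d : nat).
Local Notation V := 'rV[R]_d.
Local Notation leb := (lebesgue_rV R d).
Local Notation integ g := (leb.-integrable setT (EFin \o g)).

Lemma partial_sum_translate (B : 'M[R]_d) (e : nat -> V) (z x : V) (g : V -> R) :
  injective e -> range e = lspan B -> summable_at e g (x - z) ->
  summability.partial_sum
    (fun y => g (x - y) *+ mset_of_set (translate (lspan B) z) y)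
    @ summability.totally --> period_sum e g (x - z).
Proof.
move=> inj_e re Sx; pose e' i := e i + z.
have inj_e' : injective e' by move=> i k /addIr; exact: inj_e.
have e'P i : translate (lspan B) z (e' i) by exists (e i) => //; rewrite -re; exists i.
pose a y := g (x - y) *+ mset_of_set (translate (lspan B) z) y.
have ae : a \o e' = fun i => g (x - z - e i).
  apply/funext => i; rewrite /a/= /mset_of_set mem_set//.
  by rewrite /e' opprD addrA addrAC.
have a0 y : ~ range e' y -> a y = 0.
  move=> ny; rewrite /a /mset_of_set memNset// => -[l + ly].
  by rewrite -re => -[i _ il]; apply: ny; exists i => //; rewrite /e' il.
have := has_sum_enum inj_e' a0; rewrite ae => /(_ Sx).
by rewrite (cvg_lim _ (period_sum_cvg Sx)).
Qed.

Lemma partial_sum_unique (I : choiceType) (a : I -> R) (s t : R) :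
  summability.partial_sum a @ summability.totally --> s ->
  summability.partial_sum a @ summability.totally --> t -> s = t.
Proof. by move=> h h'; exact: (cvg_unique _ h h'). Qed.

Lemma cvg_partial_sum_sum (I : choiceType) n (a : 'I_n -> I -> R) (s : 'I_n -> R) :
  (forall k, summability.partial_sum (a k) @ summability.totally --> s k) ->
  summability.partial_sum (fun y => \sum_(k < n) a k y) @ summability.totally -->
    \sum_(k < n) s k.
Proof.
move=> h.
rewrite (_ : summability.partial_sum _ =
    fun A => \sum_(k < n) summability.partial_sum (a k) A); last first.
  by apply/funext => A; rewrite /summability.partial_sum exchange_big.
elim: n a s h => [|n IH] a s h.
  rewrite big_ord0 (_ : (fun _ => _) = fun=> 0); first exact: cvg_cst.
  by apply/funext => A; rewrite big_ord0.
rewrite big_ord_recl (_ : (fun _ => _) = fun A => summability.partial_sum (a ord0) A +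
    \sum_(k < n) summability.partial_sum (a (lift ord0 k)) A).
  apply: cvgD; first exact: h.
  by apply: (IH (fun k => a (lift ord0 k)) (fun k => s (lift ord0 k))).
by apply/funext => A; rewrite big_ord_recl.
Qed.

Lemma ae_forall_ord n (P : 'I_n -> V -> Prop) :
  (forall k, {ae leb, forall x, P k x}) -> {ae leb, forall x, forall k, P k x}.
Proof.
move=> h.
have : {ae leb, forall x, forall m : nat, forall k : 'I_n, k = m :> nat -> P k x}.
  apply/ae_foralln => m.
  have [mn|mn] := ltnP m n.
    apply: filterS (h (Ordinal mn)) => x Px k km.
    by rewrite (_ : k = Ordinal mn)//; exact: val_inj.
  by apply: aeW => x k km; move: (ltn_ord k); rewrite km ltnNge mn.
by apply: filterS => x Px k; exact: (Px k k).
Qed.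

Lemma L1_borel (f : V -> R[i]) : L1 f -> exists g1 g2 : V -> R,
  [/\ integ g1, integ g2 & {ae leb, forall x, f x = Complex (g1 x) (g2 x)}].
Proof.
move=> [/completed_integrable_borel[g1 [ig1 fg1]] /completed_integrable_borel[g2 [ig2 fg2]]].
exists g1, g2; split => //; apply: filterS2 fg1 fg2 => x <- <-.
by case: (f x).
Qed.

Lemma ae_tiling_sum (f : V -> R[i]) (g1 g2 : V -> R) n (B : 'I_n -> 'M[R]_d)
    (e : 'I_n -> nat -> V) (z : 'I_n -> V) (Lam : V -> nat) :
  integ g1 -> integ g2 -> {ae leb, forall x, f x = Complex (g1 x) (g2 x)} ->
  (forall k, B k \in unitmx) -> (forall k, injective (e k)) ->
  (forall k, range (e k) = lspan (B k)) ->
  (forall y, Lam y = \sum_(k < n) mset_of_set (translate (lspan (B k)) (z k)) y) ->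
  {ae leb, forall x,
    summability.partial_sum (fun y => f (x - y) *+ Lam y : R[i]^o)
      @ summability.totally -->
    (Complex (\sum_(k < n) period_sum (e k) g1 (x - z k))
             (\sum_(k < n) period_sum (e k) g2 (x - z k)) : R[i]^o)}.
Proof.
move=> ig1 ig2 fg uB inj_e re LamE.
have S1 : {ae leb, forall x, forall k, summable_at (e k) g1 (x - z k)}.
  apply: ae_forall_ord => k; apply: (ae_translate (- z k)).
  exact: (ae_summable_lattice (uB k) (inj_e k) (re k) ig1).
have S2 : {ae leb, forall x, forall k, summable_at (e k) g2 (x - z k)}.
  apply: ae_forall_ord => k; apply: (ae_translate (- z k)).
  exact: (ae_summable_lattice (uB k) (inj_e k) (re k) ig2).
have fg' : {ae leb, forall x, forall k, forall i,
    f (x - z k - e k i) = Complex (g1 (x - z k - e k i)) (g2 (x - z k - e k i))}.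
  apply: ae_forall_ord => k; apply/ae_foralln => i.
  exact: (ae_translate (- z k) (ae_translate (- e k i) fg)).
apply: filterS3 S1 S2 fg' => x S1x S2x fgx.
(* The almost everywhere equality of [f] with its Borel representative is available only along the
   countably many lattice points; elsewhere the multiplicity 0 removes the term. *)
have fE y : (0 < Lam y)%N -> f (x - y) = Complex (g1 (x - y)) (g2 (x - y)).
  rewrite LamE lt0n sum_nat_eq0 negb_forall => /existsP[k].
  rewrite /= /mset_of_set; case: (boolP (y \in _)) => // /set_mem[l + ly] _.
  rewrite -re => -[i _ il]; have := fgx k i.
  by rewrite il -ly addrAC -addrA -opprD.
apply/partial_sum_complexP; split => /=.
- rewrite (_ : (fun _ => _) = fun y => \sum_(k < n)
      g1 (x - y) *+ mset_of_set (translate (lspan (B k)) (z k)) y).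
    apply: cvg_partial_sum_sum => k.
    exact: partial_sum_translate.
  apply/funext => y; rewrite raddfMn/= sumrMnr -LamE.
  by have [->|Ly] := posnP (Lam y); [rewrite !mulr0n|rewrite fE].
- rewrite (_ : (fun _ => _) = fun y => \sum_(k < n)
      g2 (x - y) *+ mset_of_set (translate (lspan (B k)) (z k)) y).
    apply: cvg_partial_sum_sum => k.
    exact: partial_sum_translate.
  apply/funext => y; rewrite raddfMn/= sumrMnr -LamE.
  by have [->|Ly] := posnP (Lam y); [rewrite !mulr0n|rewrite fE].
Qed.

End tiling_sums.

Theorem theorem1p6 (R : realType) (d : nat) (hd : (1 <= d)%N)
    (f : 'rV[R]_d -> R[i]) (hf : L1 f)
    (Lam : 'rV[R]_d -> nat) (hLam : discrete_mset Lam)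
    (n : nat) (hn : (1 <= n)%N)
    (L : 'I_n -> set 'rV[R]_d) (z : 'I_n -> 'rV[R]_d)
    (hL : forall j, lattice (L j))
    (hdelta : forall A : set 'rV[R]_d, measurable A ->
       delta_mset Lam A =
       (\sum_(j < n) delta_mset (mset_of_set (translate (L j) (z j))) A)%E)
    (htile : tiles f Lam) :
  forall j : 'I_n, exists L' : set 'rV[R]_d,
    [/\ lattice L', L j `<=` L' & tiles f (mset_of_set L')].
Proof.
move=> j.
have /choice[B BP] k : exists B : 'M[R]_d, B \in unitmx /\ L k = lspan B.
  by have [B uB LB] := lattice_basis (hL k); exists B.
have uB k := (BP k).1; have LE k := (BP k).2.
have /choice[e eP] k : exists e : nat -> 'rV[R]_d, injective e /\ range e = lspan (B k).
  exact: lspan_enum.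
have inj_e k := (eP k).1; have re k := (eP k).2.
have LamE y : Lam y = \sum_(k < n) mset_of_set (translate (lspan (B k)) (z k)) y.
  by rewrite (multiplicity_sum hdelta); apply: eq_bigr => k _; rewrite LE.
have [g1 [g2 [ig1 ig2 fg]]] := L1_borel hf.
have [w /ae_completed fw] := htile.
have sums := ae_tiling_sum ig1 ig2 fg uB inj_e re LamE.
(* The weight is real, so the imaginary part tiles with weight 0. *)
have sum_g : {ae lebesgue_rV R d, forall x,
    \sum_(k < n) period_sum (e k) g1 (x - z k) = w /\
    \sum_(k < n) period_sum (e k) g2 (x - z k) = 0}.
  apply: filterS2 fw sums => x /partial_sum_complexP[/= re1 im1].
  move=> /partial_sum_complexP[/= re2 im2].
  by split; [exact: partial_sum_unique re2 re1|exact: partial_sum_unique im2 im1].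
have [N N0 [rho rhoP]] := tiling_sublattice hd z uB inj_e re j.
pose B' := N%:R^-1 *: B j.
have uB' : B' \in unitmx by exact: unitmx_scaleV.
have [e' [inj_e' re']] := lspan_enum hd uB'.
exists (lspan B'); split; first exact: lattice_lspan.
  by rewrite LE; exact: lspan_scale.
(* The imaginary part tiles with [rho * 0], so the new weight is real too. *)
exists (rho * w); apply: completed_ae.
have sum_g1 : {ae lebesgue_rV R d, forall x,
    \sum_(k < n) period_sum (e k) g1 (x - z k) = w}.
  by apply: filterS sum_g => x [].
have sum_g2 : {ae lebesgue_rV R d, forall x,
    \sum_(k < n) period_sum (e k) g2 (x - z k) = 0}.
  by apply: filterS sum_g => x [].
have tile1 := rhoP e' inj_e' re' g1 w ig1 sum_g1.
have tile2 := rhoP e' inj_e' re' g2 0 ig2 sum_g2.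
(* The superlattice is treated as a family of one lattice translated by 0, so that [ae_tiling_sum]
   applies again. *)
have LamE' y : mset_of_set (lspan B') y =
    \sum_(k < 1) mset_of_set (translate (lspan B') 0) y.
  rewrite big_ord1 (_ : translate _ _ = lspan B')//.
  by apply/seteqP; split => [_ [l ll <-]|l ll]; [rewrite addr0|exists l; rewrite ?addr0].
have sums' := @ae_tiling_sum R d f g1 g2 1 (fun=> B') (fun=> e') (fun=> 0) _ ig1 ig2 fg
  (fun=> uB') (fun=> inj_e') (fun=> re') LamE'.
apply: filterS3 sums' tile1 tile2 => x + t1 t2.
by rewrite !big_ord1 subr0 t1 t2 mulr0.
Qed.
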